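(* Suppose $K\subset\mathbb{R}^2\subset\mathbb{C}^2$ is a convex body that contains a pair of parallel line segments. Suppose $C$ is an extremal curve of $K$ that intersects $\partial K$ in the interior of these two line segments and in no other points. Then for any $z\in C\setminus K$, the Siciak-Zaharjuta extremal function $V_K$ is pluriharmonic in a neighborhood of $z$.
   Context: A convex body in $\mathbb{R}^2$ is a compact convex set with nonempty interior in $\mathbb{R}^2$; $\partial K$ is its boundary in $\mathbb{R}^2$. The interior of a line segment means the segment without its endpoints. $C$ is assumed to meet the interior of each of the two segments. For compact $K\subset\mathbb{C}^n$, $V_K(z)=\sup\{u(z):u\in L(\mathbb{C}^n),\ u\le0\text{ on }K\}$, where $L(\mathbb{C}^n)$ is the class of plurisubharmonic $u$ on $\mathbb{C}^n$ with $u(z)\le\log^+|z|+C$ for some $C\in\mathbb{R}$. Extremal curves. For $b\in\mathbb{C}^2\setminus\{0\}$ consider all (possibly degenerate) real ellipses $\{a+r(be^{i\theta}+\bar be^{-i\theta}):\theta\in\mathbb{R}\}$ with $a\in\mathbb{R}^2$, $r>0$, contained in $K$ (these all have the same eccentricity and orientation; they are line segments when $b$ is a complex multiple of a real vector). For one with maximal $r$, its complexification $C=\{a+r(b\zeta+\bar b/\zeta):\zeta\in\mathbb{C}\setminus\{0\}\}$ is called an extremal curve (or extremal ellipse, including the degenerate case of a complexified real line) for $K$. It is known that $V_K(a+r(b\zeta+\bar b/\zeta))=|\log|\zeta||$. *)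

(* Defs.v *)
From mathcomp Require Import all_boot all_order all_algebra.
From mathcomp Require Import all_classical all_reals all_analysis.
From mathcomp Require Import complex.

Set Implicit Arguments.
Unset Strict Implicit.
Unset Printing Implicit Defensive.

Import Order.TTheory GRing.Theory Num.Theory.
Import numFieldNormedType.Exports.

Local Open Scope classical_set_scope.
Local Open Scope ring_scope.
Local Open Scope complex_scope.

(* The topology of C is carried by R[i]^o, not by R[i]. *)
Notation Cvec R n := 'rV[R[i]^o]_n.

Section ComplexVectors.
Context {R : realType} {n : nat}.

Definition cplx (x : 'rV[R]_n) : Cvec R n := map_mx (real_complex R) x.

Definition conjv (z : Cvec R n) : Cvec R n := map_mx (@conjc R) z.

Definition enorm (z : Cvec R n) : R :=
  Num.sqrt (\sum_(j < n) (complex.Re (z 0 j) ^+ 2 + complex.Im (z 0 j) ^+ 2)).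

Definition expi (t : R) : R[i] := cos t +i* sin t.

End ComplexVectors.

Section Pluripotential.
Context {R : realType} {n : nat}.

Definition upper_semicontinuous (u : Cvec R n -> \bar R) : Prop :=
  forall z (c : R), (u z < c%:E)%E -> \forall w \near z, (u w < c%:E)%E.

(* Values are in [-oo, +oo[; the sub-mean value inequality is over all closed
   discs of all complex lines. The function identically -oo is allowed, which
   does not change the supremum in [siciak]. *)
Definition plurisubharmonic (u : Cvec R n -> \bar R) : Prop :=
  [/\ forall z, (u z < +oo)%E,
      upper_semicontinuous u &
      forall a b : Cvec R n,
        (u a <= ((2 * pi)^-1)%:E *
          \int[lebesgue_measure]_(t in `[0%R, (2 * pi)%R]) u (a + expi t *: b)%R)%E].

(* [ln 0 = 0] in the library, so this is 0 at 0 as it should be. *)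
Definition logp (x : R) : R := Num.max 0 (ln x).

Definition lelong_class (u : Cvec R n -> \bar R) : Prop :=
  plurisubharmonic u /\
  exists C : R, forall z, (u z <= (logp (enorm z) + C)%:E)%E.

Definition siciak (K : set (Cvec R n)) (z : Cvec R n) : \bar R :=
  ereal_sup [set u z | u in
    [set u | lelong_class u /\ forall w, K w -> (u w <= 0)%E]].

(* Derivatives in the real direction v of C^n = R^2n. The library's ['D_v] is
   not applicable: C^n is a normed module over C, not over R. *)
Definition rderivable (h : Cvec R n -> R) (v z : Cvec R n) : Prop :=
  derivable (fun t : R => h (z + t%:C *: v)) 0 1.

Definition rderive (v : Cvec R n) (h : Cvec R n -> R) (z : Cvec R n) : R :=
  derive1 (fun t : R => h (z + t%:C *: v)) 0.

Definition C2_on (U : set (Cvec R n)) (h : Cvec R n -> R) : Prop :=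
  forall z, U z ->
    [/\ {for z, continuous h},
        forall v, rderivable h v z /\ {for z, continuous (rderive v h)} &
        forall v w, rderivable (rderive v h) w z /\
                    {for z, continuous (rderive w (rderive v h))}].

(* C^2, with vanishing Laplacian along every complex line z + C b. *)
Definition pluriharmonic_on (U : set (Cvec R n)) (h : Cvec R n -> R) : Prop :=
  C2_on U h /\
  forall z (b : Cvec R n), U z ->
    rderive b (rderive b h) z +
    rderive ((0 +i* 1) *: b) (rderive ((0 +i* 1) *: b) h) z = 0.

Definition pluriharmonic_near (u : Cvec R n -> \bar R) (z : Cvec R n) : Prop :=
  exists U : set (Cvec R n),
    [/\ open U, U z, forall w, U w -> u w \is a fin_num &
        pluriharmonic_on U (fun w => fine (u w))].

End Pluripotential.

Section ConvexGeometry.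
Context {R : realType} {n : nat}.
Implicit Types (K : set 'rV[R]_n) (p q a : 'rV[R]_n).

Definition convex_body K : Prop :=
  [/\ compact K, convex_set K & K° !=set0].

Definition boundary K : set 'rV[R]_n := closure K `\` K°.

Definition segment p q : set 'rV[R]_n :=
  [set (1 - t) *: p + t *: q | t in [set t : R | 0 <= t <= 1]].

Definition open_segment p q : set 'rV[R]_n :=
  [set (1 - t) *: p + t *: q | t in [set t : R | 0 < t < 1]].

(* Nondegenerate segments on two distinct parallel lines. *)
Definition parallel_segments p1 q1 p2 q2 : Prop :=
  [/\ p1 != q1, p2 != q2,
      exists c : R, q2 - p2 = c *: (q1 - p1) &
      forall t : R, p2 != p1 + t *: (q1 - p1)].

Definition real_ellipse a (b : Cvec R n) (r : R) : set (Cvec R n) :=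
  [set cplx a + r%:C *: (expi t *: b + expi (- t) *: conjv b) | t in [set: R]].

Definition complex_ellipse a (b : Cvec R n) (r : R) : set (Cvec R n) :=
  [set cplx a + r%:C *: (zeta *: b + zeta^-1 *: conjv b) |
     zeta in [set zeta : R[i] | zeta != 0]].

Definition extremal_curve K (C : set (Cvec R n)) : Prop :=
  exists a b r,
    [/\ b != 0, 0 < r, real_ellipse a b r `<=` cplx @` K,
        forall a' r', 0 < r' -> real_ellipse a' b r' `<=` cplx @` K ->
          r' <= r &
        C = complex_ellipse a b r].

End ConvexGeometry.

(* Main.v *)
(* On the strip between the two lines let l be the affine function equal to -1
   and 1 on them. The extremal curve is w = a + B z + conj B / z with
   l w = (z + 1 / z) / 2, and it touches the boundary of K only inside the two
   segments, so shearing the ellipse along the segments, B -> B + delta d with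
   delta small and complex, keeps it inscribed in K. The complexifications of
   the sheared ellipses fill a neighbourhood of every point of C outside K,
   hence V_K w = ln |z| there, where z is the exterior root of
   l w = (z + 1 / z) / 2: the upper bound is the one-variable estimate along
   these curves, the lower bound comes from the competitors
   2^-k ln max (1, |T_(2^k) (l w)|), with T the Chebyshev polynomials.
   Finally ln |z| is locally the real part of a holomorphic function of l w. *)

Require Import Defs.
From mathcomp Require Import all_boot all_order all_algebra.
From mathcomp Require Import all_classical all_reals all_analysis.
From mathcomp Require Import complex.
From mathcomp Require Import ring lra.

Set Implicit Arguments.
Unset Strict Implicit.
Unset Printing Implicit Defensive.

Import Order.TTheory GRing.Theory Num.Theory.
Import numFieldNormedType.Exports.
Import Normc.

Local Open Scope classical_set_scope.
Local Open Scope ring_scope.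
Local Open Scope complex_scope.

(** * Moduli and circle integrals *)

Section Modulus.
Context {R : realType}.
Implicit Types z w : R[i].

(** Plurisubharmonicity is available as a sub-mean value inequality on circles in complex lines,
    while the ellipses are curved, so a competitor for V_K cannot simply be restricted to them. The
    upper bound is therefore a maximum principle in a neighbourhood of the curve: the point may
    leave the curve by a displacement, at a quadratic cost, and circles in tangent lines serve as
    test circles. The formula l w = (z + 1 / z) / 2 expresses that the real ellipse spans the whole
    strip. C is known to meet the two segments, but possibly at parameters off the unit circle,
    whose points need not lie on the real ellipse. Such real points exist only on a degenerate
    ellipse, and there the maximality of the radius decides. The lower bound needs the sub-mean
    value inequality for log+ |p| with p a polynomial, which is proved by averaging over rotations
    of the circle. *)

Lemma sqr_normcE z : normc z ^+ 2 = complex.Re z ^+ 2 + complex.Im z ^+ 2.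
Proof. by case: z => a b /=; rewrite sqr_sqrtr// addr_ge0 ?sqr_ge0. Qed.

Lemma normc_ge0 z : 0 <= normc z.
Proof. by case: z => a b; exact: sqrtr_ge0. Qed.

Lemma normc_eq0 z : (normc z == 0) = (z == 0).
Proof.
by apply/eqP/eqP => [/eq0_normc//|->]; rewrite normc0.
Qed.

Lemma normc_gt0 z : (0 < normc z) = (z != 0).
Proof. by rewrite lt_def normc_ge0 andbT normc_eq0. Qed.

Lemma normc_real (x : R) : normc x%:C = `|x|.
Proof. by rewrite /= expr0n/= addr0 sqrtr_sqr. Qed.

Lemma normc_nat k : normc k%:R = k%:R :> R.
Proof. by rewrite -(rmorph_nat (real_complex R)) normc_real ger0_norm. Qed.

Lemma normcX z k : normc (z ^+ k) = normc z ^+ k.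
Proof. by elim: k => [|k IH]; rewrite ?expr0 ?normc1// !exprS normcM IH. Qed.

Lemma normc_conj z : normc (conjc z) = normc z.
Proof. by case: z => a b /=; rewrite sqrrN. Qed.

Lemma Re_le_normc z : `|complex.Re z| <= normc z.
Proof.
rewrite -(@ler_pXn2r _ 2) ?nnegrE ?normc_ge0// sqr_normcE real_normK ?num_real//.
by rewrite lerDl sqr_ge0.
Qed.

Lemma normc_le_ReIm z : normc z <= `|complex.Re z| + `|complex.Im z|.
Proof.
rewrite -(@ler_pXn2r _ 2) ?nnegrE ?normc_ge0 ?addr_ge0// sqr_normcE.
rewrite sqrrD !real_normK ?num_real//.
by rewrite -addrA lerD2l lerDr mulrn_wge0// mulr_ge0.
Qed.

Lemma normcB_sym z w : normc (z - w) = normc (w - z).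
Proof. by rewrite -normcN opprB. Qed.

Lemma le_normcB z w : normc z - normc w <= normc (z - w).
Proof. by rewrite lerBlDr (le_trans _ (le_normcD _ _))// subrK. Qed.

Lemma le_normcB2 z w : normc (z - w) <= normc z + normc w.
Proof. by rewrite -(normcN w); exact: le_normcD. Qed.

Lemma ler_sum_normc (I : Type) (r : seq I) (F : I -> R[i]) :
  normc (\sum_(i <- r) F i) <= \sum_(i <- r) normc (F i).
Proof.
elim: r => [|i r IH]; first by rewrite !big_nil normc0.
by rewrite !big_cons (le_trans (le_normcD _ _))// lerD2l.
Qed.

Lemma normc_expi (t : R) : normc (expi t) = 1.
Proof. by rewrite /= cos2Dsin2 sqrtr1. Qed.

Lemma expi0 : expi (0 : R) = 1.
Proof. by rewrite /expi cos0 sin0. Qed.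

Lemma expiD (s t : R) : expi (s + t) = expi s * expi t.
Proof.
rewrite /expi cosD sinD; apply/eqP; rewrite eq_complex /=.
by rewrite [cos s * sin t + _]addrC !eqxx.
Qed.

Lemma expiN (t : R) : expi (- t) = conjc (expi t).
Proof. by rewrite /expi cosN sinN. Qed.

Lemma expi_neq0 (t : R) : expi t != 0.
Proof. by rewrite -normc_gt0 normc_expi. Qed.

Lemma expiV (t : R) : expi (- t) = (expi t)^-1.
Proof.
apply: (mulIf (expi_neq0 t)); rewrite -expiD addNr expi0 mulVf//; exact: expi_neq0.
Qed.

Lemma expi_mulrn (t : R) k : expi (t *+ k) = expi t ^+ k.
Proof. by elim: k => [|k IH]; rewrite ?mulr0n ?expi0// mulrS expiD IH exprS. Qed.

Lemma expi_pi : expi pi = -1 :> R[i].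
Proof. by rewrite /expi cospi sinpi; apply/eqP; rewrite eq_complex /= oppr0 !eqxx. Qed.

Lemma expi_2pi : expi (2 * pi) = 1 :> R[i].
Proof. by rewrite mulr_natl expi_mulrn expi_pi sqrrN expr1n. Qed.

Lemma mulcJ z : z * conjc z = (normc z ^+ 2)%:C.
Proof.
rewrite sqr_normcE; case: z => a b; apply/eqP; rewrite eq_complex /=.
by apply/andP; split; apply/eqP; ring.
Qed.

Lemma cReD z w : complex.Re (z + w) = complex.Re z + complex.Re w.
Proof. by case: z w => a b [c d]. Qed.
Lemma cReN z : complex.Re (- z) = - complex.Re z.
Proof. by case: z. Qed.
Lemma cReB z w : complex.Re (z - w) = complex.Re z - complex.Re w.
Proof. by rewrite cReD cReN. Qed.
Lemma cReM z w : complex.Re (z * w) =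
  complex.Re z * complex.Re w - complex.Im z * complex.Im w.
Proof. by case: z w => a b [c d]. Qed.
Lemma complex_ext z w :
  complex.Re z = complex.Re w -> complex.Im z = complex.Im w -> z = w.
Proof. by case: z w => a b [c d] /= -> ->. Qed.

(** The range [-pi, pi] is recorded because compactness arguments on the circle run over that
    interval. *)
Lemma polar z : exists2 t : R, - pi <= t <= pi & z = (normc z)%:C * expi t.
Proof.
have [->|z0] := eqVneq z 0; first by exists 0; rewrite ?normc0 ?mul0r// oppr_le0 pi_ge0.
pose u := z / (normc z)%:C.
have n0 : (normc z)%:C != 0 by rewrite -normc_gt0 normc_real normr_gt0 normc_eq0.
have hz : z = (normc z)%:C * u by rewrite /u mulrCA mulfV// mulr1.
have hu : normc u = 1.
  rewrite /u normcM normcV normc_real ger0_norm ?normc_ge0// mulfV//.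
  by rewrite normc_eq0.
have hu2 : complex.Re u ^+ 2 + complex.Im u ^+ 2 = 1 by rewrite -sqr_normcE hu expr1n.
have hx : -1 <= complex.Re u <= 1 by rewrite -ler_norml -hu Re_le_normc.
have cosx := acosK hx.
have hs : sin (acos (complex.Re u)) = `|complex.Im u|.
  rewrite sin_acos//; have -> : 1 - complex.Re u ^+ 2 = complex.Im u ^+ 2 by lra.
  by rewrite sqrtr_sqr.
have [s0|s0] := leP 0 (complex.Im u).
  exists (acos (complex.Re u)).
    by rewrite acos_lepi// andbT (le_trans _ (acos_ge0 hx))// oppr_le0 pi_ge0.
  rewrite {1}hz; congr (_ * _).
  by apply: complex_ext; rewrite /= ?cosx// hs ger0_norm.
exists (- acos (complex.Re u)).
  rewrite lerN2 acos_lepi//= (le_trans _ (pi_ge0 R))// oppr_le0 acos_ge0//.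
rewrite {1}hz; congr (_ * _).
apply: complex_ext; rewrite /= ?cosN ?cosx// sinN hs ltr0_norm// opprK//.
Qed.

Lemma unit_polar z : normc z = 1 -> exists t : R, z = expi t.
Proof. by move=> h; have [t _ ht] := polar z; exists t; rewrite ht h mul1r. Qed.

End Modulus.

(** Over the scalars [R[i]] the radius of a ball is a complex number, and its positivity forces it
    to be real. Neighbourhoods are restated here with a real radius and moduli of coordinates. *)
Lemma nbhs_CvecP (R : realType) n (z : Cvec R n) (A : set (Cvec R n)) :
  nbhs z A <-> exists e : R, 0 < e /\
    forall w : Cvec R n, (forall j, normc (w 0 j - z 0 j : R[i]) < e) -> A w.
Proof.
split.
  move=> /nbhs_ballP[[e e'] /=]; rewrite ltcE/= => /andP[/eqP/= -> e0] h.
  exists e; split=> // w hw; apply: h; split; first by rewrite ltcR.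
  move=> i j; rewrite (ord1 i) -ball_normE /= distrC.
  by rewrite ltcR; exact: hw.
move=> [e [e0 h]]; apply/nbhs_ballP; exists e%:C; first by rewrite /= ltcR.
move=> w [_ hw]; apply: h => j; move: (hw 0 j); rewrite -ball_normE /= distrC.
by rewrite ltcR.
Qed.

Section CircleIntegral.
Context {R : realType}.
Local Notation mu := (@lebesgue_measure R).

(** The integrals of the positive and negative parts are suprema over simple functions, so
    monotonicity is an inclusion of sets of competitors and holds for arbitrary functions. It is
    applied to plurisubharmonic functions on circles. *)
Lemma le_integral_pointwise (D : set R) (f g : R -> \bar R) :
  (forall x, D x -> (f x <= g x)%E) ->
  (\int[mu]_(x in D) f x <= \int[mu]_(x in D) g x)%E.
Proof.
move=> fg; have fgD x : ((f \_ D) x <= (g \_ D) x)%E.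
  by rewrite !patchE; case: ifPn => //; rewrite inE; exact: fg.
rewrite /integral; apply: leeB; apply: le_ereal_sup => _ [h hf <-]; exists h => // x;
  apply: le_trans (hf x) _; rewrite ?funeposE ?funenegE ge_max !le_max lexx orbT andbT.
  by rewrite fgD.
by rewrite leeN2 fgD.
Qed.

Lemma continuous_Re_expi (c : R[i]) k :
  continuous (fun t : R => complex.Re (c * expi t ^+ k)).
Proof.
move=> t; rewrite (_ : (fun t : R => _) =
  (fun t => complex.Re c * cos (t *+ k) - complex.Im c * sin (t *+ k))).
  have ck : (fun t : R => t *+ k) @ t --> t *+ k.
    by apply: cvgMn; exact: cvg_id.
  apply: cvgB; apply: cvgM; first exact: cvg_cst.
  - by apply: continuous_comp; [exact: ck|exact: continuous_cos].
  - exact: cvg_cst.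
  - by apply: continuous_comp; [exact: ck|exact: continuous_sin].
by apply/funext => s; rewrite -expi_mulrn cReM.
Qed.

Lemma integral_trig (A : R) (c1 c2 : R[i]) :
  (\int[mu]_(t in `[0%R, (2 * pi)%R])
    (A + complex.Re (c1 * expi t) + complex.Re (c2 * expi t ^+ 2))%R%:E =
    (2 * pi * A)%R%:E)%E.
Proof.
(* An explicit primitive; [sin t * cos t] and [cos t ^+ 2 - 2^-1] are the halves of sin 2t and cos
   2t. *)
pose F (t : R) := A * t + complex.Re c1 * sin t + complex.Im c1 * cos t +
  (complex.Re c2 * (sin t * cos t) + complex.Im c2 * (cos t ^+ 2 - 2^-1)).
have dF (t : R) : is_derive t 1 F
    (A + complex.Re (c1 * expi t) + complex.Re (c2 * expi t ^+ 2)).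
  rewrite /F; apply: is_derive_eq.
  rewrite !cReM /= /GRing.scale /=.
  move: (cos t) (sin t) (cos2Dsin2 t) => x y h; ring.
rewrite (@continuous_FTC2 _ _ F)//.
- rewrite -EFinB /F mulr_natl sin2pi cos2pi sin0 cos0.
  by congr (_%:E); ring.
- by rewrite mulr_gt0// pi_gt0.
- apply: continuous_subspaceT => t; apply: cvgD; first apply: cvgD.
  + exact: cvg_cst.
  + by have := @continuous_Re_expi c1 1; exact.
  + exact: continuous_Re_expi.
- have cF : continuous F.
    by move=> t; apply: differentiable_continuous; apply/derivable1_diffP; exact: ex_derive.
  split; first by move=> t _; exact: ex_derive.
    by apply: cvg_at_right_filter; exact: cF.
  by apply: cvg_at_left_filter; exact: cF.
- by move=> t _; rewrite derive1E; apply: derive_val.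
Qed.

(** The harmonics integrate to zero, so a pointwise trigonometric majorant on a circle bounds the
    value at the centre by its constant term. *)
Lemma submean_trig n (u : Cvec R n -> \bar R) (a b : Cvec R n) (A : R) (c1 c2 : R[i]) :
  plurisubharmonic u ->
  (forall t, (u (a + expi t *: b)%R <=
    (A + complex.Re (c1 * expi t) + complex.Re (c2 * expi t ^+ 2))%R%:E)%E) ->
  (u a <= A%:E)%E.
Proof.
move=> [_ _ /(_ a b) hu] h; apply: (le_trans hu).
have p0 : (0 : R) < 2 * pi by rewrite mulr_gt0// pi_gt0.
apply: (@le_trans _ _ (((2 * pi)^-1)%:E * (2 * pi * A)%R%:E)%E).
  rewrite lee_pmul2l// ?lte_fin ?invr_gt0//.
  by rewrite -(integral_trig A c1 c2); apply: le_integral_pointwise => t _; exact: h.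
by rewrite -EFinM mulKf// gt_eqF.
Qed.

End CircleIntegral.

(** * Upper bound along a complexified ellipse *)

Section Perturbation.
Context {R : realType}.

(** The difference [g] of the two sides has derivative x^3 / (1 + x), which has the sign of x, so
    its minimum is [g 0 = 0]. *)
Lemma ln1D_le3 (y : R) : -1 < y -> ln (1 + y) <= y - y ^+ 2 / 2 + y ^+ 3 / 3.
Proof.
move=> y1.
pose g (x : R) := x - x ^+ 2 / 2 + x ^+ 3 / 3 - ln (1 + x).
have dg (x : R) : -1 < x -> is_derive x 1 g (x ^+ 3 / (1 + x)).
  move=> x1; have x0 : 0 < 1 + x by lra.
  have dl : is_derive x (1 : R) (fun x : R => ln (1 + x)) ((1 + x)^-1 * 1).
    have d1 : is_derive x (1 : R) (fun x : R => 1 + x) 1.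
      rewrite -[X in is_derive _ _ _ X]add0r; apply: is_deriveD.
    exact: (@is_derive1_comp _ _ _ _ _ _ (is_derive1_ln x0) d1).
  rewrite /g; apply: is_derive_eq.
  rewrite /GRing.scale /=.
  by field; rewrite gt_eqF.
have cg (x : R) : -1 < x -> {for x, continuous g}.
  move=> x1; apply: differentiable_continuous; apply/derivable1_diffP.
  exact: (@ex_derive _ _ _ _ _ _ _ (dg x x1)).
have mvt a b : -1 < a -> a < b ->
    exists2 c, a < c < b & g b - g a = c ^+ 3 / (1 + c) * (b - a).
  move=> a1 ab; have [| |c] := @MVT _ g (fun c => c ^+ 3 / (1 + c)) a b ab.
  - by move=> z; rewrite in_itv/= => /andP[az _]; apply: dg; exact: lt_trans az.
  - apply: continuous_in_subspaceT => z; rewrite inE/= in_itv/= => /andP[az _].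
    by apply: cg; exact: lt_le_trans az.
  - by rewrite in_itv => cab ->; exists c.
have g0 : g 0 = 0 by rewrite /g addr0 ln1 !expr0n/= !mul0r !subr0 addr0.
suff : 0 <= g y by rewrite /g; lra.
have [y0|y0|->] := ltgtP y 0; last by rewrite g0.
- have [c /andP[yc c0]] := mvt _ _ y1 y0; rewrite g0 !sub0r => h.
  rewrite -oppr_le0 h mulrN oppr_le0 mulr_le0 ?(ltW y0)//.
  rewrite mulr_le0_ge0 ?invr_ge0//; last by lra.
  by rewrite exprS mulr_le0_ge0 ?sqr_ge0 ?ltW.
- have N0 : -1 < 0 :> R by lra.
  have [c /andP[c0 cy]] := mvt _ _ N0 y0; rewrite g0 !subr0 => ->.
  by rewrite mulr_ge0 ?(ltW y0)// divr_ge0 ?exprn_ge0 ?(ltW c0)//; lra.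
Qed.

Lemma sqr_normc1D (eta : R[i]) : normc (1 + eta) ^+ 2 =
  1 + (2 * complex.Re eta + normc eta ^+ 2).
Proof. by rewrite !sqr_normcE; case: eta => x y /=; ring. Qed.

Section Estimates.
Variables (eta : R[i]) (rho : R).
Hypothesis heta : normc eta = rho.
Hypothesis hrho : rho <= 2^-1.

Let x := complex.Re eta.
Let y := 2 * x + rho ^+ 2.

Let rho0 : 0 <= rho. Proof. by rewrite -heta normc_ge0. Qed.
Let hx : - rho <= x <= rho. Proof. by rewrite -ler_norml -heta Re_le_normc. Qed.
Let hy : - (3 * rho) <= y <= 3 * rho.
Proof.
have := hx => /andP[h1 h2].
have h3 : rho ^+ 2 <= rho by have := hrho; have := rho0 => ? ?; rewrite expr2 ler_piMl//; lra.
have h4 : 0 <= rho ^+ 2 by rewrite sqr_ge0.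
by rewrite /y; apply/andP; split; lra.
Qed.
Let hy3 : `|y ^+ 3| <= 27 * rho ^+ 3.
Proof.
rewrite normrX; have : `|y| <= 3 * rho by rewrite ler_norml.
move=> h.
apply: (@le_trans _ _ ((3 * rho) ^+ 3)); last by rewrite exprMn -natrX.
by rewrite lerXn2r ?nnegrE ?mulr_ge0.
Qed.
Let Re2 : complex.Re (eta ^+ 2) = 2 * x ^+ 2 - rho ^+ 2.
Proof. by rewrite -heta sqr_normcE expr2 cReM /x; ring. Qed.
Let hxr : `|x * rho ^+ 2| <= rho ^+ 3.
Proof.
by rewrite normrM [`|rho ^+ 2|]ger0_norm ?sqr_ge0// [leRHS]exprS ler_wpM2r ?sqr_ge0// ler_norml.
Qed.

Lemma normc1D_gt0 : 0 < normc (1 + eta).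
Proof.
have := le_normcB 1 (- eta); rewrite normc1 normcN heta opprK; have := hrho; lra.
Qed.

(** Up to order [rho ^+ 3] the bound is the real part of log (1 + eta). It comes from [ln1D_le3] at
    [y], where |1 + eta|^2 = 1 + y. *)
Lemma ln_normc1D : ln (normc (1 + eta)) <=
  complex.Re eta - complex.Re (eta ^+ 2) / 2 + 6 * rho ^+ 3.
Proof.
have n0 := normc1D_gt0.
suff : ln (normc (1 + eta) ^+ 2) <=
    2 * x - complex.Re (eta ^+ 2) + 12 * rho ^+ 3.
  by rewrite lnXn// mulr2n -/x; lra.
rewrite sqr_normc1D heta -/x -/y; apply: le_trans (ln1D_le3 _) _.
  have : 0 < normc (1 + eta) ^+ 2 by rewrite exprn_gt0.
  by rewrite sqr_normc1D heta -/x -/y; lra.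
have := hy3; rewrite ler_norml => /andP[_ h3].
have := hxr; rewrite ler_norml => /andP[h4 _].
have h5 : 0 <= rho ^+ 4 by rewrite exprn_ge0.
have h6 : 0 <= rho ^+ 3 by rewrite exprn_ge0.
have e1 : y ^+ 2 = 4 * x ^+ 2 + 4 * (x * rho ^+ 2) + rho ^+ 4 by rewrite /y; ring.
have e2 : y = 2 * x + rho ^+ 2 by [].
by move: h3 h4 h5 h6 e1 e2; rewrite Re2 -/x; move: (y) (x) => Y X; lra.
Qed.

(** Since (1 + y) (1 - y + y^2 - y^3) = 1 - y^4, the truncated geometric series is a lower bound.
    Its quadratic part is rewritten with Re (eta^2) = 2 x^2 - rho^2. *)
Lemma invsqr_normc1D : 1 - 2 * complex.Re eta + rho ^+ 2 +
  2 * complex.Re (eta ^+ 2) - 31 * rho ^+ 3 <= (normc (1 + eta) ^+ 2)^-1.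
Proof.
have n0 : 0 < normc (1 + eta) ^+ 2 by rewrite exprn_gt0// normc1D_gt0.
have hN : normc (1 + eta) ^+ 2 = 1 + y by rewrite sqr_normc1D heta.
apply: (@le_trans _ _ (1 - y + y ^+ 2 - y ^+ 3)).
  have := hy3; rewrite ler_norml => /andP[_ h3].
  have := hxr; rewrite ler_norml => /andP[h4 _].
  have h5 : 0 <= rho ^+ 4 by rewrite exprn_ge0.
  have e1 : y ^+ 2 = 4 * x ^+ 2 + 4 * (x * rho ^+ 2) + rho ^+ 4 by rewrite /y; ring.
  have e2 : y = 2 * x + rho ^+ 2 by [].
  by move: h3 h4 h5 e1 e2; rewrite Re2 -/x; move: (y) (x) => Y X; lra.
rewrite -[leRHS]mul1r ler_pdivlMr// hN.
have : 0 <= y ^+ 4 by rewrite (_ : 4 = 2 * 2)%N// exprM sqr_ge0.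
by rewrite !exprS expr0 mulr1; lra.
Qed.

(** The remainder of 1 / (1 + eta) after 1 - eta. It measures how far the curve leaves its tangent
    line when the parameter is multiplied by 1 + eta. *)
Definition quadratic_remainder := eta ^+ 2 / (1 + eta).

Lemma inv1DE : (1 + eta)^-1 = 1 - eta + quadratic_remainder.
Proof.
have n0 : 1 + eta != 0 by rewrite -normc_gt0 normc1D_gt0.
by rewrite /quadratic_remainder; field.
Qed.

Let invn : (normc (1 + eta))^-1 <= 2.
Proof.
rewrite -[leRHS]invrK lef_pV2 ?posrE ?normc1D_gt0 ?invr_gt0//.
have := le_normcB 1 (- eta); rewrite normc1 normcN heta opprK; have := hrho; lra.
Qed.

Lemma normc_quadratic_remainder : normc quadratic_remainder <= 2 * rho ^+ 2.
Proof.
rewrite /quadratic_remainder normcM normcX normcV heta mulrC ler_wpM2r// exprn_ge0//.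
Qed.

Lemma quadratic_remainderB :
  normc (quadratic_remainder - eta ^+ 2) <= 2 * rho ^+ 3.
Proof.
have n0 : 1 + eta != 0 by rewrite -normc_gt0 normc1D_gt0.
have -> : quadratic_remainder - eta ^+ 2 = - (eta ^+ 3 / (1 + eta)).
  by rewrite /quadratic_remainder; field.
by rewrite normcN normcM normcX normcV heta mulrC ler_wpM2r// exprn_ge0//.
Qed.

End Estimates.

Definition sqn n (d : Cvec R n) : R := \sum_(j < n) normc (d 0 j : R[i]) ^+ 2.

Lemma sqn_ge0 n (d : Cvec R n) : 0 <= sqn d.
Proof. by apply: sumr_ge0 => j _; exact: sqr_ge0. Qed.

Lemma sqn0 n : sqn (0 : Cvec R n) = 0.
Proof. by rewrite /sqn big1// => j _; rewrite mxE normc0 expr0n. Qed.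

Lemma sqnZ n (c : R[i]) (d : Cvec R n) : sqn (c *: d) = normc c ^+ 2 * sqn d.
Proof.
rewrite /sqn mulr_sumr; apply: eq_bigr => j _.
by rewrite mxE normcM exprMn.
Qed.

Lemma normc_coord_sqn n (d : Cvec R n) j : normc (d 0 j : R[i]) ^+ 2 <= sqn d.
Proof.
rewrite /sqn (bigD1 j)//= lerDl; apply: sumr_ge0 => k _; exact: sqr_ge0.
Qed.

Definition cpair n (c d : Cvec R n) : R[i] :=
  \sum_(j < n) (c 0 j : R[i]) * conjc (d 0 j : R[i]).

Lemma normc_cpair n (c d : Cvec R n) : normc (cpair c d) <= sqn c + sqn d.
Proof.
apply: le_trans (ler_sum_normc _ _) _; rewrite -big_split; apply: ler_sum => j _ /=.
rewrite normcM normc_conj.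
set x := normc _; set y := normc _.
have : 0 <= (x - y) ^+ 2 by exact: sqr_ge0.
have : 0 <= x ^+ 2 by exact: sqr_ge0.
have : 0 <= y ^+ 2 by exact: sqr_ge0.
rewrite sqrrB -mulr_natr; lra.
Qed.

Lemma sqnBZ n (tau : R[i]) (c d : Cvec R n) : sqn (d - tau *: c) =
  sqn d - 2 * complex.Re (tau * cpair c d) + normc tau ^+ 2 * sqn c.
Proof.
rewrite -sqnZ /sqn /cpair mulr_sumr.
rewrite (big_morph (@complex.Re R) (id1 := 0) (op1 := +%R)); [|exact: cReD|by []].
rewrite mulr_sumr -sumrB -big_split; apply: eq_bigr => j _ /=.
rewrite !mxE; set x := d _ _; set y := c _ _.
rewrite !sqr_normcE; case: x y tau => a b [a' b'] [s t] /=; ring.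
Qed.

(** Replacing [quadratic_remainder eta] by [eta ^+ 2] in the cross term costs order rho^3, and its
    square is of order rho^4. What is left besides [sqn d] is a second harmonic, which averages to
    zero over |eta| = rho. *)
Lemma sqn_perturb n (eta : R[i]) (rho : R) (c d : Cvec R n) :
  normc eta = rho -> rho <= 2^-1 ->
  sqn (d - quadratic_remainder eta *: c) <=
  sqn d - 2 * complex.Re (cpair c d * eta ^+ 2) + (8 * sqn c + 4 * sqn d) * rho ^+ 3.
Proof.
move=> he hr; rewrite sqnBZ; set q := quadratic_remainder eta.
have r0 : 0 <= rho by rewrite -he normc_ge0.
have h1 : normc q ^+ 2 <= 4 * rho ^+ 3.
  have h := normc_quadratic_remainder he hr.
  have h2 : normc q ^+ 2 <= (2 * rho ^+ 2) ^+ 2.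
    by rewrite lerXn2r// nnegrE ?normc_ge0// mulr_ge0// sqr_ge0.
  apply: le_trans h2 _; have -> : (2 * rho ^+ 2) ^+ 2 = 4 * rho ^+ 3 * rho by ring.
  rewrite ler_piMr ?mulr_ge0 ?exprn_ge0//; lra.
have h3 : `|complex.Re ((q - eta ^+ 2) * cpair c d)| <=
    2 * rho ^+ 3 * (sqn c + sqn d).
  apply: le_trans (Re_le_normc _) _; rewrite normcM.
  apply: ler_pM; rewrite ?normc_ge0//; last exact: normc_cpair.
  exact: quadratic_remainderB.
have h4 : normc q ^+ 2 * sqn c <= 4 * rho ^+ 3 * sqn c by rewrite ler_wpM2r ?sqn_ge0.
have h5 : complex.Re (q * cpair c d) =
    complex.Re (cpair c d * eta ^+ 2) + complex.Re ((q - eta ^+ 2) * cpair c d).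
  by rewrite -cReD; congr complex.Re; ring.
rewrite h5; move: h3; rewrite ler_norml => /andP[h3 _]; lra.
Qed.

End Perturbation.

(** * Comparison with a barrier along the curve *)

Section LelongOnCurve.
Context {R : realType} {n : nat}.
Variables (a B B' : Cvec R n).
Implicit Types (zeta eta : R[i]) (d : Cvec R n).

Definition crv zeta : Cvec R n := a + zeta *: B + zeta^-1 *: B'.

(** The middle term stays in a fixed complex line, so |eta| = rho gives a test circle. The last term
    has order rho^2 and is compensated by a displacement off the curve. *)
Lemma crv_perturb zeta eta (rho : R) : zeta != 0 -> normc eta = rho -> rho <= 2^-1 ->
  crv (zeta * (1 + eta)) = crv zeta + eta *: (zeta *: B - zeta^-1 *: B') +
    quadratic_remainder eta *: (zeta^-1 *: B').
Proof.
move=> z0 he hr; rewrite /crv invfM (inv1DE he hr).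
set q := quadratic_remainder eta; apply/rowP => j; rewrite !mxE.
by move: (a 0 j) (B 0 j) (B' 0 j) (zeta^-1) => x y w i; ring.
Qed.

(** The term in [kappa] outgrows the logarithmic growth of the Lelong class; the terms in [delta]
    keep the barrier at least [delta / 2] for |zeta| >= 1. *)
Definition barrier (kappa delta : R) zeta : R :=
  (1 + kappa) * ln (normc zeta) + delta - delta / 2 * (normc zeta ^+ 2)^-1.

Lemma barrier_perturb kappa delta zeta eta (rho : R) : 0 <= kappa -> 0 <= delta ->
  1 <= normc zeta -> normc eta = rho -> rho <= 2^-1 ->
  barrier kappa delta (zeta * (1 + eta)) <= barrier kappa delta zeta +
    (1 + kappa + delta * (normc zeta ^+ 2)^-1) * complex.Re eta -
    ((1 + kappa) / 2 + delta * (normc zeta ^+ 2)^-1) * complex.Re (eta ^+ 2) -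
    delta / 2 * (normc zeta ^+ 2)^-1 * rho ^+ 2 + (6 * (1 + kappa) + 16 * delta) * rho ^+ 3.
Proof.
move=> k0 de0 z1 he hr; rewrite /barrier normcM; set m := (normc zeta ^+ 2)^-1.
have rho0 : 0 <= rho by rewrite -he normc_ge0.
have z0 : 0 < normc zeta by rewrite (lt_le_trans ltr01).
have e0 := normc1D_gt0 he hr.
rewrite lnM ?posrE// exprMn invfM -/m.
have m0 : 0 <= m by rewrite invr_ge0 exprn_ge0// ltW.
have m1 : m <= 1 by rewrite invf_le1 ?exprn_gt0// exprn_ege1.
have hk : 0 <= 1 + kappa by rewrite addr_ge0.
have h1 := ler_wpM2l hk (ln_normc1D he hr).
have h2 := ler_wpM2l (mulr_ge0 (divr_ge0 de0 (ler0n _ 2)) m0) (invsqr_normc1D he hr).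
have r3 : 0 <= rho ^+ 3 by rewrite exprn_ge0.
have h3 : delta * m * rho ^+ 3 <= delta * rho ^+ 3 by rewrite ler_wpM2r// ler_piMr.
have h4 : 0 <= delta * rho ^+ 3 by rewrite mulr_ge0.
move: h1 h2 h3 h4; rewrite -/m.
move: (complex.Re eta) (complex.Re (eta ^+ 2)) (ln _) (ln _) (normc (1 + eta) ^- 2).
move: (rho ^+ 3) (rho ^+ 2) => r r' x x' l l' i h1 h2 h3 h4.
by lra.
Qed.

(* The term in (normc zeta ^+ 2)^-1 makes the barrier strictly superharmonic,
   which yields the gain of order rho ^+ 2 over the cubic errors. *)
Lemma barrier_submean (u : Cvec R n -> \bar R) (kappa delta S Q rho : R) zeta d :
  plurisubharmonic u -> 0 <= kappa -> 0 <= delta -> 0 <= Q ->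
  (forall z e, 1 <= normc z ->
    (u (crv z + e)%R <= (S + Q * sqn e + barrier kappa delta z)%R%:E)%E) ->
  1 <= normc zeta -> 0 <= rho <= 2^-1 ->
  (forall eta, normc eta = rho -> 1 <= normc (zeta * (1 + eta))) ->
  (u (crv zeta + d)%R <= (S + Q * sqn d + barrier kappa delta zeta
    - delta / 2 * (normc zeta ^+ 2)^-1 * rho ^+ 2
    + (Q * (8 * sqn B' + 4 * sqn d) + 6 * (1 + kappa) + 16 * delta) * rho ^+ 3)%R%:E)%E.
Proof.
move=> pu k0 de0 Q0 hu z1 /andP[r0 r1] hz.
set m := (normc zeta ^+ 2)^-1.
set c := zeta^-1 *: B'; set g := cpair c d.
(* Coefficients of the first and second harmonics in the expansion of penalty and barrier around
   [zeta]; only the terms in rho^2 and rho^3 survive the mean. *)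
pose c1 : R[i] := (rho * (1 + kappa + delta * m))%:C.
pose c2 : R[i] := (rho ^+ 2)%:C * (- (2 * Q)%:C * g - ((1 + kappa) / 2 + delta * m)%:C).
have z0 : zeta != 0 by rewrite -normc_gt0 (lt_le_trans ltr01).
apply: (@submean_trig _ _ u _ (rho%:C *: (zeta *: B - zeta^-1 *: B')) _ c1 c2) => // t.
pose eta := rho%:C * expi t.
have he : normc eta = rho by rewrite normcM normc_expi normc_real ger0_norm ?mulr1.
(* With this displacement at the parameter [zeta * (1 + eta)] the curvature term cancels, and the
   point runs over a circle around [crv zeta + d] in the tangent direction. *)
have := hu _ (d - quadratic_remainder eta *: c) (hz _ he).
rewrite (crv_perturb z0 he r1).
have -> : crv zeta + eta *: (zeta *: B - zeta^-1 *: B') +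
    quadratic_remainder eta *: (zeta^-1 *: B') + (d - quadratic_remainder eta *: c) =
  crv zeta + d + expi t *: (rho%:C *: (zeta *: B - zeta^-1 *: B')).
  by rewrite -/c addrA addrAC addrK addrAC scalerA [expi t * _]mulrC.
move=> /le_trans; apply; rewrite lee_fin.
have := barrier_perturb k0 de0 z1 he r1; rewrite -/m => h1.
have := ler_wpM2l Q0 (sqn_perturb c d he r1); rewrite -/g => h2.
have hc : sqn c <= sqn B'.
  rewrite /c sqnZ normcV ler_piMl ?sqn_ge0// exprn_ile1 ?invr_ge0 ?normc_ge0//.
  by rewrite invf_le1// (lt_le_trans ltr01).
have h3 : Q * (8 * sqn c * rho ^+ 3) <= Q * (8 * sqn B' * rho ^+ 3).
  by rewrite ler_wpM2l// ler_wpM2r ?exprn_ge0// ler_wpM2l.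
have e1 : complex.Re (c1 * expi t) = (1 + kappa + delta * m) * complex.Re eta.
  by rewrite /c1 /eta /=; ring.
have e2 : complex.Re (c2 * expi t ^+ 2) =
   - (2 * Q) * complex.Re (g * eta ^+ 2)
   - ((1 + kappa) / 2 + delta * m) * complex.Re (eta ^+ 2).
  rewrite /c2 /eta exprMn; rewrite -rmorphXn; move: (g) (expi t ^+ 2) => [x y] [s w].
  by rewrite /=; ring.
rewrite e1 e2; move: h1 h2 h3.
move: (complex.Re (eta ^+ 2)) (complex.Re (g * eta ^+ 2)) (complex.Re eta).
move: (barrier _ _ _) (barrier _ _ _) (sqn _) (sqn d) (sqn c) (sqn B').
move: (rho ^+ 3) (rho ^+ 2) => r r' b b' s s' s'' s''' x y w h1 h2 h3.
lra.
Qed.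

End LelongOnCurve.

(** Compactness of [a, b] replaces radii depending on the point by a single one. The local
    hypothesis ranges over all smaller radii so that it speaks of a right neighbourhood of 0. *)
Lemma uniform_radius (R : realType) (a b : R) (P : R -> R -> Prop) :
  (forall t, a <= t <= b -> exists e eta : R, [/\ 0 < e, 0 < eta &
    forall e' s : R, 0 < e' < e -> `|s - t| < eta -> P e' s]) ->
  exists2 e : R, 0 < e & forall t, a <= t <= b -> P e t.
Proof.
move=> h; have := @segment_compact R a b.
move/compact_near_coveringP => /(_ R (0 : R)^'+ P _) => H.
have /H hn : forall x : R, `[a, b]%classic x ->
    \forall x' \near x & i \near (0 : R)^'+, P i x'.
  move=> t; rewrite /= in_itv/= => /h[e [eta [e0 eta0 hP]]].
  exists (ball t eta, [set i | 0 < i < e]).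
    split; first exact: nbhsx_ballx.
    by near=> i; apply/andP; split; near: i; [exact: nbhs_right_gt|exact: nbhs_right_lt].
  by move=> [x i] [/= hx hi]; apply: hP => //; rewrite distrC.
have [e [e0 he]] : exists e, 0 < e /\ `[a, b]%classic `<=` P e.
  have hp : \forall i \near (0 : R)^'+, 0 < i by exact: nbhs_right_gt.
  have [e [h1 h2]] := @filter_ex _ ((0 : R)^'+) _ _ (filterI hp hn).
  by exists e.
by exists e => // t ht; apply: he; rewrite /= in_itv.
Unshelve. all: by end_near.
Qed.

Section Growth.
Context {R : realType}.

Lemma expi_continuity (t eps : R) : 0 < eps ->
  exists2 eta, 0 < eta & forall s, `|s - t| < eta -> normc (expi s - expi t) < eps.
Proof.
move=> e0.
have e2 : 0 < eps / 2 by rewrite divr_gt0.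
have /cvgrPdist_lt/(_ _ e2)/nbhs_ballP[/= e1 e1_gt0 h1] := @continuous_cos R t.
have /cvgrPdist_lt/(_ _ e2)/nbhs_ballP[/= e3 e3_gt0 h3] := @continuous_sin R t.
exists (Num.min e1 e3); first by rewrite lt_min e1_gt0.
move=> s; rewrite lt_min => /andP[s1 s3].
apply: (le_lt_trans (normc_le_ReIm (expi s - expi t)) _).
rewrite [ltRHS](splitr eps); apply: ltrD; rewrite distrC.
  by apply: h1; rewrite /ball/= distrC.
by apply: h3; rewrite /ball/= distrC.
Qed.

Lemma logp_le (x y : R) : x <= y -> 1 <= y -> logp x <= ln y.
Proof.
move=> xy y1; rewrite /logp ge_max ln_ge0//=.
have [x0|x0] := leP x 0; first by rewrite ln0// ln_ge0.
by rewrite ler_ln// posrE (lt_le_trans ltr01).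
Qed.

Definition l1norm n (v : Cvec R n) : R := \sum_(j < n) normc (v 0 j : R[i]).

Lemma l1norm_ge0 n (v : Cvec R n) : 0 <= l1norm v.
Proof. by apply: sumr_ge0 => j _; exact: normc_ge0. Qed.

Lemma normc_coord_l1norm n (v : Cvec R n) j : normc (v 0 j : R[i]) <= l1norm v.
Proof. by rewrite /l1norm (bigD1 j)//= lerDl sumr_ge0// => k _; exact: normc_ge0. Qed.

Lemma l1normD n (v w : Cvec R n) : l1norm (v + w) <= l1norm v + l1norm w.
Proof.
by rewrite /l1norm -big_split; apply: ler_sum => j _; rewrite mxE; exact: le_normcD.
Qed.

Lemma l1normZ n (c : R[i]) (v : Cvec R n) : l1norm (c *: v) = normc c * l1norm v.
Proof. by rewrite /l1norm mulr_sumr; apply: eq_bigr => j _; rewrite mxE normcM. Qed.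

(** This sums x <= 1 + x^2 over the coordinates; growth caused by a displacement is thereby
    controlled by the quadratic penalty. *)
Lemma l1norm_sqn n (v : Cvec R n) : l1norm v <= n%:R + sqn v.
Proof.
rewrite -[n in n%:R]card_ord -sum1_card natr_sum /l1norm /sqn -big_split.
apply: ler_sum => j _ /=; set x := normc _.
have : 0 <= (x - 1) ^+ 2 by exact: sqr_ge0.
have : 0 <= x by exact: normc_ge0.
have : 0 <= x ^+ 2 by exact: sqr_ge0.
by rewrite sqrrB -mulr_natr mulr1 expr1n; lra.
Qed.

Lemma enorm_le_l1norm n (v : Cvec R n) : enorm v <= l1norm v.
Proof.
rewrite /enorm -(@ler_pXn2r _ 2) ?nnegrE ?sqrtr_ge0 ?l1norm_ge0//.
rewrite sqr_sqrtr; last by apply: sumr_ge0 => j _; rewrite addr_ge0 ?sqr_ge0.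
rewrite expr2 {1}/l1norm mulr_suml; apply: ler_sum => j _; rewrite -sqr_normcE expr2.
by rewrite ler_wpM2l ?normc_ge0// normc_coord_l1norm.
Qed.

End Growth.

(** * Growth and boundary values along the curve *)

Section LelongOnCurveBound.
Context {R : realType} {n : nat}.
Variables (a B B' : Cvec R n) (u : Cvec R n -> \bar R).
Hypothesis uL : lelong_class u.
Local Notation crv := (crv a B B').

(** The norm of [crv z + d] is at most [A * normc z * (1 + sqn d)], and the logarithm of the last
    factor is at most [sqn d]. The coefficient 1 of ln |z| matters: any positive [kappa] in the
    barrier beats it. *)
Lemma lelong_growth_curve : exists2 C1 : R, 0 <= C1 & forall z (d : Cvec R n), 1 <= normc z ->
  (u (crv z + d)%R <= (C1 + ln (normc z) + sqn d)%R%:E)%E.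
Proof.
have [_ [C hC]] := uL.
pose A := 1 + n%:R + l1norm a + l1norm B + l1norm B' : R.
have A1 : 1 <= A by rewrite /A -!addrA lerDl !addr_ge0 ?l1norm_ge0.
exists (ln A + `|C|); first by rewrite addr_ge0// ln_ge0.
move=> z d z1; apply: le_trans (hC _) _; rewrite lee_fin.
have z0 : 0 < normc z by rewrite (lt_le_trans ltr01).
have hd : l1norm d <= n%:R + sqn d by exact: l1norm_sqn.
have sd := sqn_ge0 d.
have hs : 1 <= 1 + sqn d by rewrite lerDl.
have hw : enorm (crv z + d) <= A * normc z * (1 + sqn d).
  apply: le_trans (enorm_le_l1norm _) _; apply: le_trans (l1normD _ _) _.
  have := l1normD (a + z *: B) (z^-1 *: B'); have := l1normD a (z *: B).
  rewrite !l1normZ normcV => h1 h2.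
  have h3 : (normc z)^-1 * l1norm B' <= l1norm B'.
    by rewrite ler_piMl ?l1norm_ge0// invf_le1.
  have h4 : A <= A * normc z by rewrite ler_peMr// (le_trans ler01).
  have h5 : (n%:R + l1norm a + l1norm B' + 1) * 1 <= (n%:R + l1norm a + l1norm B' + 1) * normc z.
    by rewrite ler_wpM2l// !addr_ge0 ?l1norm_ge0.
  have h6 : 1 * sqn d <= A * normc z * sqn d.
    by rewrite ler_wpM2r// (le_trans A1).
  rewrite mulrDr mulr1; move: h1 h2 h3 h5 h6; rewrite /crv /A; lra.
have := logp_le hw; rewrite mulr_ege1 ?mulr_ege1//.
rewrite !lnM ?posrE ?mulr_gt0 ?(lt_le_trans ltr01)// => /(_ isT) h.
have h2 : ln (1 + sqn d) <= sqn d by apply: le_ln1Dx; lra.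
by have := ler_norm C; lra.
Qed.

(** For parameters of modulus at least 1 the map z -> 1 / z does not increase distances. *)
Lemma crv_lipschitz z z' j : 1 <= normc z -> 1 <= normc z' ->
  normc (crv z 0 j - crv z' 0 j : R[i]) <= normc (z - z') * (l1norm B + l1norm B').
Proof.
move=> z1 z1'; rewrite !mxE.
have zn : z != 0 by rewrite -normc_gt0 (lt_le_trans ltr01).
have zn' : z' != 0 by rewrite -normc_gt0 (lt_le_trans ltr01).
set x : R[i] := a 0 j; set b : R[i] := B 0 j; set b' : R[i] := B' 0 j.
have -> : x + z * b + z^-1 * b' - (x + z' * b + z'^-1 * b') =
  (z - z') * b - (z - z') * (z^-1 * z'^-1 * b') by field; rewrite zn zn'.
apply: le_trans (le_normcB2 _ _) _; rewrite !normcM !normcV mulrDr lerD//.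
  by rewrite ler_wpM2l ?normc_ge0// normc_coord_l1norm.
rewrite ler_wpM2l ?normc_ge0//; apply: le_trans (normc_coord_l1norm B' j).
rewrite ler_piMl ?normc_ge0// mulr_ile1 ?invr_ge0 ?normc_ge0// invf_le1//;
  exact: lt_le_trans ltr01 _.
Qed.

Hypothesis u_le0 : forall t, (u (crv (expi t)) <= 0)%E.

(** Upper semicontinuity of [u] at the points of the curve over the unit circle, where u <= 0, is
    made uniform by compactness. *)
Lemma curve_collar (delta : R) : 0 < delta -> exists2 e : R, 0 < e &
  forall z (d : Cvec R n), 1 <= normc z <= 1 + e -> (forall j, normc (d 0 j : R[i]) < e) ->
    (u (crv z + d)%R < delta%:E)%E.
Proof.
move=> d0; have [[_ usc _] _] := uL.
pose A : R := l1norm B + l1norm B' + 1.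
have A0 : 0 < A by rewrite ltr_wpDl// addr_ge0// l1norm_ge0.
have [|e e0 he] := @uniform_radius R (- pi) pi (fun e s => forall w : Cvec R n,
    (forall j, normc (w 0 j - crv (expi s) 0 j : R[i]) < e) -> (u w < delta%:E)%E).
  move=> t _; have ut : (u (crv (expi t)) < delta%:E)%E.
    by apply: le_lt_trans (u_le0 t) _; rewrite lte_fin.
  have /nbhs_CvecP[e [e0 he]] := usc _ _ ut.
  have [eta eta0 heta] := expi_continuity t (divr_gt0 e0 (mulr_gt0 (ltr0Sn R 1) A0)).
  exists (e / 2), eta; split => //; first by rewrite divr_gt0.
  move=> e' s /andP[e'0 e'1] hs w hw; apply: he => j.
  have -> : w 0 j - crv (expi t) 0 j = (w 0 j - crv (expi s) 0 j) +
    (crv (expi s) 0 j - crv (expi t) 0 j) by rewrite addrA subrK.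
  apply: le_lt_trans (le_normcD _ _) _; rewrite [ltRHS](splitr e).
  apply: ltrD; first exact: lt_trans (hw j) e'1.
  apply: le_lt_trans (crv_lipschitz _ _ _) _; rewrite ?normc_expi//.
  have h1 := heta _ hs.
  apply: (@le_lt_trans _ _ (normc (expi s - expi t) * A)).
    by rewrite ler_wpM2l ?normc_ge0// lerDl.
  apply: (lt_le_trans (y := e / (2 * A) * A)); first by rewrite ltr_pM2r.
  by rewrite invfM mulrA mulfVK// gt_eqF.
exists (Num.min (e / 2) (e / (2 * A))).
  by rewrite lt_min !divr_gt0// mulr_gt0.
move=> z d /andP[z1 z2] hd.
have [t tpi zt] := polar z.
apply: (he t) => // j; rewrite [(crv z + d) 0 j]mxE addrAC.
apply: le_lt_trans (le_normcD _ _) _; rewrite [ltRHS](splitr e).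
apply: ler_ltD; last by apply: lt_le_trans (hd j) _; rewrite ge_min lexx.
apply: le_trans (crv_lipschitz _ z1 _) _; rewrite ?normc_expi//.
have -> : normc (z - expi t) = normc z - 1.
  have -> : z - expi t = (normc z - 1)%:C * expi t.
    by rewrite {1}zt rmorphB rmorph1 mulrBl mul1r.
  by rewrite normcM normc_real normc_expi mulr1 ger0_norm// subr_ge0.
have z3 : normc z - 1 <= e / (2 * A).
  by rewrite lerBlDl; apply: le_trans z2 _; rewrite lerD2l ge_min lexx orbT.
apply: (@le_trans _ _ (e / (2 * A) * A)).
  by rewrite ler_pM// ?subr_ge0 ?addr_ge0 ?l1norm_ge0// lerDl.
by rewrite invfM mulrA mulfVK// gt_eqF.
Qed.

End LelongOnCurveBound.

Section LelongOnCurveMain.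
Context {R : realType} {n : nat}.
Variables (a B B' : Cvec R n) (u : Cvec R n -> \bar R).
Hypothesis uL : lelong_class u.
Local Notation crv := (crv a B B').
Hypothesis u_le0 : forall t, (u (crv (expi t)) <= 0)%E.

Lemma barrier_ge (kappa delta : R) z : 0 <= kappa -> 0 <= delta -> 1 <= normc z ->
  (1 + kappa) * ln (normc z) + delta / 2 <= barrier kappa delta z.
Proof.
move=> k0 d0 z1; rewrite /barrier.
have : (normc z ^+ 2)^-1 <= 1 by rewrite invf_le1 ?exprn_ege1// exprn_gt0// (lt_le_trans ltr01).
move=> /(ler_wpM2l (divr_ge0 d0 (ler0n R 2))); lra.
Qed.

(* Doubling of variables: u is compared with the barrier on the curve through
   the penalised function u (crv z + d) - Q |d|^2 - barrier z, whose supremum is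
   nearly attained at a point where moving along the tangent line of the curve
   contradicts the sub-mean value inequality. *)
Lemma lelong_le_on_curve z0 : 1 <= normc z0 -> (u (crv z0) <= (ln (normc z0))%:E)%E.
Proof.
move=> z1; rewrite leNgt; apply/negP => hlt.
have [pu _] := uL; have [ufin _ _] := pu.
have [x hx] : exists x, u (crv z0) = x%:E.
  by move: hlt (ufin (crv z0)); case: (u _) => // x _ _; exists x.
set L := ln (normc z0); have L0 : 0 <= L by exact: ln_ge0.
have xL : L < x by rewrite -lte_fin -hx.
(* The excess x - L is 3 delta, and [kappa] is chosen with kappa L <= delta, so the barrier at [z0]
   is at most L + 2 delta and stays below x. The denominator [1 + L] covers L = 0. *)
pose delta := (x - L) / 3; have de0 : 0 < delta by rewrite divr_gt0// subr_gt0.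
pose kappa := delta / (1 + L).
have L1 : 0 < 1 + L by rewrite ltr_wpDr.
have k0 : 0 < kappa by rewrite divr_gt0.
have kL : kappa * L <= delta.
  by rewrite /kappa mulrAC ler_pdivrMr// ler_wpM2l ?(ltW de0)// lerDr.
have hb0 : barrier kappa delta z0 < x.
  have : 0 <= delta / 2 * (normc z0 ^+ 2)^-1.
    by rewrite mulr_ge0 ?invr_ge0 ?exprn_ge0 ?normc_ge0// divr_ge0// ltW.
  have : x = L + 3 * delta by rewrite /delta mulrC divfK ?subrKC.
  by rewrite /barrier -/L => -> h; move: kL de0 h; lra.
have [C1 C10 hC1] := lelong_growth_curve a B B' uL.
have [e e0 he] := curve_collar uL u_le0 (divr_gt0 de0 (ltr0Sn R 1)).
have e20 : 0 < e ^+ 2 by rewrite exprn_gt0.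
(* The summand 1 absorbs the [sqn d] of the growth bound, and C1 / e^2 makes the remaining penalty
   at least C1 once |d| >= e. *)
pose Q := 1 + C1 / e ^+ 2.
have Q0 : 0 <= Q by rewrite addr_ge0// divr_ge0// ltW.
(* Here [s] is the value of the penalised function at (z, d). The equation also records that [u],
   which may be -oo elsewhere, is finite at this point. *)
pose pen (s : R) z (d : Cvec R n) := u (crv z + d) = (s + Q * sqn d + barrier kappa delta z)%:E.
have pen_growth s z d : 1 <= normc z -> pen s z d ->
    s + C1 / e ^+ 2 * sqn d + kappa * ln (normc z) + delta / 2 <= C1.
  move=> zge1 hp; have := hC1 z d zge1; rewrite hp lee_fin.
  by have := barrier_ge (ltW k0) (ltW de0) zge1; rewrite /Q; lra.
have sC1 (d : Cvec R n) : 0 <= C1 / e ^+ 2 * sqn d by rewrite mulr_ge0 ?sqn_ge0// divr_ge0// ltW.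
(* A positive value forces |d| < e by the penalty, |z| > 1 + e by the collar estimate, and a bound
   on |z| by the term in [kappa]. Nearly optimal points thus stay away from the unit circle and from
   infinity. *)
have inner s z d : 1 <= normc z -> pen s z d -> 0 < s ->
    [/\ sqn d < e ^+ 2, 1 + e < normc z & ln (normc z) <= C1 / kappa].
  move=> zge1 hp s0; have hg := pen_growth _ _ _ zge1 hp.
  have lz : 0 <= kappa * ln (normc z) by rewrite mulr_ge0 ?ln_ge0// ltW.
  have sd : sqn d < e ^+ 2.
    rewrite ltNge; apply/negP => hd.
    have : C1 <= C1 / e ^+ 2 * sqn d.
      by rewrite mulrAC ler_pdivlMr// ler_wpM2l.
    by move: hg lz s0 de0; lra.
  split=> //.
    rewrite ltNge; apply/negP => hz.
    have : (u (crv z + d)%R < (delta / 2)%:E)%E.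
      apply: he; first by rewrite zge1.
      move=> j; rewrite -(@ltr_pXn2r _ 2) ?nnegrE ?normc_ge0 ?(ltW e0)//.
      exact: le_lt_trans (normc_coord_sqn d j) sd.
    rewrite hp lte_fin; have := barrier_ge (ltW k0) (ltW de0) zge1.
    have : 0 <= ln (normc z) by exact: ln_ge0.
    have : 0 <= Q * sqn d by rewrite mulr_ge0 ?sqn_ge0.
    by move: lz s0; lra.
  by rewrite ler_pdivlMr// mulrC; move: hg (sC1 d) s0 de0; lra.
pose E := [set s : R | exists z d, 1 <= normc z /\ pen s z d].
have E0 : E (x - barrier kappa delta z0).
  by exists z0, 0; split=> //; rewrite /pen addr0 hx sqn0 mulr0 addr0 subrK.
have hE : has_sup E.
  split; first by exists (x - barrier kappa delta z0).
  exists C1 => s [z [d [zge1 hp]]]; have := pen_growth _ _ _ zge1 hp.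
  have : 0 <= kappa * ln (normc z) by rewrite mulr_ge0 ?ln_ge0// ltW.
  by move: (sC1 d) de0; lra.
set S := sup E.
have S0 : 0 < S.
  by apply: lt_le_trans (ub_le_sup (proj2 hE) E0); rewrite subr_gt0.
have hS z d : 1 <= normc z ->
    (u (crv z + d)%R <= (S + Q * sqn d + barrier kappa delta z)%R%:E)%E.
  move=> zge1; case hu: (u (crv z + d)) => [r| |]; last by rewrite leNye.
    have : E (r - (Q * sqn d + barrier kappa delta z)).
      by exists z, d; split=> //; rewrite /pen hu -addrA subrK.
    by move=> /(ub_le_sup (proj2 hE)); rewrite -/S lee_fin; lra.
  by have := ufin (crv z + d); rewrite hu.
pose K := Q * (8 * sqn B' + 4 * e ^+ 2) + 6 * (1 + kappa) + 16 * delta.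
have K0 : 0 < K.
  have : 0 <= Q * (8 * sqn B' + 4 * e ^+ 2).
    by rewrite mulr_ge0// addr_ge0 ?mulr_ge0 ?sqn_ge0// ltW.
  by rewrite /K; move: k0 de0; lra.
pose m0 := (expR (C1 / kappa) ^+ 2)^-1.
have m00 : 0 < m0 by rewrite invr_gt0 exprn_gt0// expR_gt0.
(* The three bounds make the expansions valid, keep the test circle in |z| >= 1, and hold the cubic
   error to half of the gain delta / 2 * m0 * rho^2. By [inner], m0 is a lower bound for |z|^-2 at
   the relevant points. *)
pose rho := Num.min (2^-1) (Num.min (e / (1 + e)) (delta * m0 / (4 * K))).
have e1 : 0 < 1 + e by rewrite ltr_wpDr// ltW.
have rho0 : 0 < rho.
  rewrite /rho !lt_min; apply/and3P; split; first by rewrite invr_gt0.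
    by rewrite divr_gt0.
  by apply: divr_gt0; apply: mulr_gt0.
have rho1 : rho <= 2^-1 by rewrite /rho ge_min lexx.
have rho2 : rho * (1 + e) <= e.
  by rewrite -ler_pdivlMr// /rho !ge_min lexx orbT.
have rho3 : K * rho <= delta / 4 * m0.
  have : rho <= delta * m0 / (4 * K) by rewrite /rho !ge_min lexx !orbT.
  by rewrite ler_pdivlMr ?mulr_gt0//; lra.
(* This is the gain left after the cubic error: a point within [theta] of the supremum violates the
   sub-mean value inequality. The minimum with [S] keeps the value there positive, so that [inner]
   applies. *)
pose theta := delta / 4 * m0 * rho ^+ 2.
have th0 : 0 < theta by rewrite /theta mulr_gt0 ?exprn_gt0// mulr_gt0// divr_gt0.
have thS : 0 < Num.min theta S by rewrite lt_min th0.
have [s [z [d [zge1 hp]]]] := sup_adherent thS hE; rewrite -/S => hs.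
have hs1 : S - theta < s.
  by apply: le_lt_trans hs; rewrite lerD2l lerN2 ge_min lexx.
have hs2 : 0 < s.
  by apply: le_lt_trans hs; rewrite subr_ge0 ge_min lexx orbT.
have [sd zgt lz] := inner _ _ _ zge1 hp hs2.
have hm : m0 <= (normc z ^+ 2)^-1.
  have zp : 0 < normc z by rewrite (lt_le_trans ltr01).
  rewrite lef_pV2 ?posrE ?exprn_gt0 ?expR_gt0//.
  by rewrite lerXn2r ?nnegrE ?normc_ge0 ?expR_ge0// -[leLHS]lnK ?posrE// ler_expR.
have := @barrier_submean _ _ a B B' u kappa delta S Q rho z d pu (ltW k0) (ltW de0) Q0 hS zge1.
rewrite (ltW rho0) rho1 => /(_ isT) hsub.
have hz eta : normc eta = rho -> 1 <= normc (z * (1 + eta)).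
  move=> heta; rewrite normcM.
  have h1 : 1 - rho <= normc (1 + eta).
    by have := le_normcB 1 (- eta); rewrite normc1 normcN heta opprK.
  apply: (@le_trans _ _ ((1 + e) * (1 - rho))); first by move: rho2; lra.
  by apply: ler_pM => //; [exact: ltW|move: rho1; lra|exact: ltW].
have := hsub hz; rewrite hp lee_fin => hfin.
have r2 : 0 < rho ^+ 2 by rewrite exprn_gt0.
have hm2 : delta / 2 * m0 * rho ^+ 2 <= delta / 2 * (normc z ^+ 2)^-1 * rho ^+ 2.
  by rewrite ler_wpM2r ?(ltW r2)// ler_wpM2l// divr_ge0// ltW.
have hK : (Q * (8 * sqn B' + 4 * sqn d) + 6 * (1 + kappa) + 16 * delta) * rho ^+ 3 <=
    delta / 4 * m0 * rho ^+ 2.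
  apply: (@le_trans _ _ (K * rho * rho ^+ 2)); last by rewrite ler_wpM2r// ltW.
  rewrite -mulrA -exprS ler_wpM2r ?exprn_ge0 ?(ltW rho0)// /K !lerD2r ler_wpM2l//.
  by rewrite lerD2l ler_wpM2l// ltW.
by move: hs1 hfin hm2 hK; rewrite /theta; lra.
Qed.

End LelongOnCurveMain.

(** * Jensen's inequality on circles *)

Section CircleMeans.
Context {R : realType}.
Local Notation mu := (@lebesgue_measure R).

Lemma primitive_itv (f : R -> R) (A B : R) : continuous f -> A < B ->
  exists F : R -> R, forall x, A < x < B -> is_derive x 1 F (f x).
Proof.
move=> cf AB; exists (fun x => \int[mu]_(t in `[A, x]) f t)%R => x /andP[Ax xB].
have fi : mu.-integrable `[A, B] (EFin \o f).
  apply: continuous_compact_integrable; first exact: segment_compact.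
  exact: continuous_subspaceT.
have [d1 d2] := continuous_FTC1_closed xB fi Ax (cf x).
by apply: DeriveDef; [exact: d1|rewrite -derive1E].
Qed.

Definition cint (f : R -> R) : \bar R := (\int[mu]_(t in `[0%R, (2 * pi)%R]) (f t)%:E)%E.

Lemma twopi_gt0 : 0 < 2 * pi :> R.
Proof. by rewrite mulr_gt0// pi_gt0. Qed.

Lemma le_cint (f g : R -> R) : (forall t, f t <= g t) -> (cint f <= cint g)%E.
Proof. by move=> h; apply: le_integral_pointwise => t _; rewrite lee_fin. Qed.

Lemma cint_cst (c : R) : cint (fun=> c) = (2 * pi * c)%:E.
Proof.
have := integral_trig c 0 0; rewrite /cint => <-.
by congr integral; apply/funext => t; rewrite !mul0r !addr0.
Qed.

Lemma is_derive_shift (F : R -> R) (s x d : R) :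
  is_derive (x + s) 1 F d -> is_derive x 1 (fun t => F (t + s)) d.
Proof.
move=> h; rewrite -[d]mulr1; apply: (@is_derive1_comp _ F (fun t => t + s)).
rewrite -[X in is_derive _ _ _ X]addr0; exact: is_deriveD.
Qed.

(** For a primitive F of f, the function r -> F (r + 2 pi) - F r has zero derivative by
    periodicity. *)
Lemma cint_shift (f : R -> R) (s : R) : continuous f ->
  (forall t, f (t + 2 * pi) = f t) -> 0 < s -> s <= 2 * pi ->
  cint (fun t => f (t + s)) = cint f.
Proof.
move=> cf pf s0 s1; have p0 := twopi_gt0.
(* The interval exceeds [0, 4 pi] by 1 on both sides, so F has a two-sided derivative at every point
   used. *)
have [|F hF] := @primitive_itv f (-1) (4 * pi + 1) cf; first by lra.
have val r : 0 <= r <= 2 * pi ->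
    cint (fun t => f (t + r)) = (F (2 * pi + r) - F r)%:E.
  move=> /andP[r0 r1]; have dF t : -1 < t + r < 4 * pi + 1 ->
      is_derive t 1 (fun t => F (t + r)) (f (t + r)).
    by move=> ht; apply: is_derive_shift; exact: hF.
  have cF t : -1 < t + r < 4 * pi + 1 -> {for t, continuous (fun t => F (t + r))}.
    move=> ht; apply: differentiable_continuous; apply/derivable1_diffP.
    exact: (@ex_derive _ _ _ _ _ _ _ (dF t ht)).
  rewrite /cint (@continuous_FTC2 _ _ (fun t => F (t + r))).
  - by rewrite add0r EFinB.
  - by [].
  - apply: continuous_subspaceT => t.
    apply: (@continuous_comp _ _ _ (fun t => t + r) f); last exact: cf.
    by apply: cvgD; [exact: cvg_id|exact: cvg_cst].
  - split.
    + move=> t; rewrite in_itv/= => /andP[t0 t1].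
      have ht : -1 < t + r < 4 * pi + 1 by apply/andP; split; lra.
      exact: (@ex_derive _ _ _ _ _ _ _ (dF t ht)).
    + by apply: cvg_at_right_filter; apply: cF; apply/andP; split; lra.
    + by apply: cvg_at_left_filter; apply: cF; apply/andP; split; lra.
  - move=> t; rewrite in_itv/= => /andP[t0 t1]; rewrite derive1E.
    have ht : -1 < t + r < 4 * pi + 1 by apply/andP; split; lra.
    exact: (@derive_val _ _ _ _ _ _ _ (dF t ht)).
rewrite val ?(ltW s0)//.
have -> : cint f = cint (fun t => f (t + 0)).
  by congr cint; apply/funext => t; rewrite addr0.
rewrite val ?lexx ?(ltW p0)//.
pose D (r : R) := F (r + 2 * pi) - F r.
suff : D s = D 0 by rewrite /D ![_ + 2 * pi]addrC => ->.
have dD r : 0 <= r <= 2 * pi -> is_derive r 1 D 0.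
  move=> /andP[r0 r1]; rewrite -[X in is_derive _ _ _ X](subrr (f r)).
  apply: is_deriveB; last by apply: hF; apply/andP; split; lra.
  rewrite -{1}(pf r); apply: is_derive_shift; apply: hF; apply/andP; split; lra.
have [||c _] := @MVT _ D (fun=> 0) 0 s s0.
- by move=> r; rewrite in_itv/= => /andP[? ?]; apply: dD; apply/andP; split; lra.
- apply: continuous_in_subspaceT => r; rewrite inE/= in_itv/= => /andP[? ?].
  have hr : 0 <= r <= 2 * pi by apply/andP; split; lra.
  apply: differentiable_continuous; apply/derivable1_diffP.
  exact: (@ex_derive _ _ _ _ _ _ _ (dD r hr)).
by rewrite mul0r => /subr0_eq.
Qed.

Lemma cint_average (f : R -> R) (s : R) : continuous f ->
  (forall t, f (t + 2 * pi) = f t) -> 0 < s -> s <= 2 * pi ->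
  cint (fun t => (f t + f (t + s)) / 2) = cint f.
Proof.
move=> cf pf s0 s1.
have cs : continuous (fun t => f (t + s)).
  move=> t; apply: (@continuous_comp _ _ _ (fun t => t + s) f); last exact: cf.
  by apply: cvgD; [exact: cvg_id|exact: cvg_cst].
have int (g : R -> R) : continuous g -> mu.-integrable `[0%R, (2 * pi)%R] (EFin \o g).
  move=> cg; apply: continuous_compact_integrable; first exact: segment_compact.
  exact: continuous_subspaceT.
have hs := cint_shift cf pf s0 s1.
have -> : cint (fun t => (f t + f (t + s)) / 2) =
    ((2^-1)%:E * (cint f + cint (fun t => f (t + s)%R)))%E.
  rewrite /cint -integralD//; try exact: int.
  rewrite -integralZl//; last by apply: integrableD => //; exact: int.
  by apply: eq_integral => t _; rewrite /= -EFinD -EFinM mulrC.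
rewrite hs; have : cint f \is a fin_num by apply: integral_fune_fin_num => //; exact: int.
move/fineK => <-; rewrite -EFinD -EFinM; congr (_%:E).
by field.
Qed.

(** Built by doubling: sums of distinct shifts among pi, pi / 2, pi / 4, ... give all multiples of 2
    pi / 2^k in [0, 2 pi[. *)
Fixpoint shift_average (f : R -> R) (k : nat) : R -> R :=
  if k is k'.+1 then fun t =>
    (shift_average f k' t + shift_average f k' (t + pi / 2 ^+ k')) / 2
  else f.

Lemma shift_averageP (f : R -> R) k : continuous f -> (forall t, f (t + 2 * pi) = f t) ->
  [/\ continuous (shift_average f k),
      forall t, shift_average f k (t + 2 * pi) = shift_average f k t &
      cint (shift_average f k) = cint f].
Proof.
move=> cf pf; elim: k => [|k [IH1 IH2 IH3]] //=; split.
- move=> t; apply: cvgMl; apply: cvgD; first exact: IH1.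
  apply: (@continuous_comp _ _ _ (fun t => t + pi / 2 ^+ k)); last exact: IH1.
  by apply: cvgD; [exact: cvg_id|exact: cvg_cst].
- by move=> t; rewrite IH2 addrAC IH2.
- rewrite cint_average// ?divr_gt0 ?pi_gt0 ?exprn_gt0//.
  rewrite ler_pdivrMr ?exprn_gt0//; have h : 1 <= 2 ^+ k :> R by rewrite exprn_ege1// ler1n.
  have := pi_ge0 R => p0; have := ler_wpM2l p0 h; lra.
Qed.

(** Rotation by pi / 2^k changes the sign of x = (g e^(it))^(2^k), and (1 - x) (1 + x) = 1 - x^2
    merges the two logarithms. The condition |g| < 1 keeps their arguments positive. *)
Lemma shift_average_ge (f : R -> R) (L : R) (s : seq R[i]) (k : nat) :
  (forall g, g \in s -> normc g < 1) ->
  (forall t, L + \sum_(g <- s) ln (normc (1 - g * expi t)) <= f t) ->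
  forall t, L + (2 ^+ k)^-1 *
    \sum_(g <- s) ln (normc (1 - g ^+ (2 ^ k) * expi t ^+ (2 ^ k))) <= shift_average f k t.
Proof.
move=> hs hf; elim: k => [|k IH] t.
  by rewrite expr0 invr1 mul1r /=; under eq_bigr do rewrite !expr1; exact: hf.
rewrite /=; have h1 := IH t; have h2 := IH (t + pi / 2 ^+ k).
rewrite ler_pdivlMr//; apply: le_trans (lerD h1 h2).
have e1 : expi (t + pi / 2 ^+ k) ^+ (2 ^ k) = - expi t ^+ (2 ^ k).
  rewrite -!expi_mulrn mulrnDl expiD -[(pi / _) *+ _]mulr_natr natrX divfK ?expf_neq0//.
  by rewrite expi_pi mulrN1.
rewrite e1 exprS invfM; set S1 := \sum_(g <- s) _; set S2 := \sum_(g <- s) _.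
set S3 := \sum_(g <- s) _; suff -> : S1 = S2 + S3.
  by move: {h1 h2 IH hf hs} S2 S3 ((2 ^+ k)^-1) => x y c; lra.
rewrite /S1 /S2 /S3 -big_split /=.
rewrite big_seq [RHS]big_seq; apply: eq_bigr => g /hs g1.
set x := g ^+ (2 ^ k) * expi t ^+ (2 ^ k).
have x1 : normc x < 1.
  by rewrite normcM !normcX normc_expi expr1n mulr1 exprn_ilt1 ?normc_ge0// expn_eq0.
have p1 : 0 < normc (1 - x).
  by rewrite (lt_le_trans _ (le_normcB _ _))// normc1 subr_gt0.
have p2 : 0 < normc (1 + x).
  by rewrite -[x]opprK (lt_le_trans _ (le_normcB _ _))// normc1 normcN subr_gt0.
rewrite mulrN opprK -lnM ?posrE// -normcM; congr (ln (normc _)).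
by rewrite expnS mulnC !exprM -exprMn -/x; ring.
Qed.

Lemma ler_size_sum (I : eqType) (s : seq I) (F : I -> R) (c : R) :
  (forall i, i \in s -> c <= F i) -> (size s)%:R * c <= \sum_(i <- s) F i.
Proof.
elim: s => [|i s IH] h; first by rewrite big_nil mul0r.
rewrite big_cons /= -natr1 mulrDl mul1r addrC lerD// ?h ?mem_head//.
by apply: IH => j js; apply: h; rewrite inE js orbT.
Qed.

(* Averaging f over the 2^k rotations by multiples of 2 pi / 2^k preserves its
   integral and, since the product of 1 - g x over the rotated x is
   1 - (g x)^(2^k), makes the logarithmic terms tend to 0. *)
Lemma cint_log_ge (f : R -> R) (L rho : R) (s : seq R[i]) :
  continuous f -> (forall t, f (t + 2 * pi) = f t) -> 0 <= rho < 1 ->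
  (forall g, g \in s -> normc g <= rho) ->
  (forall t, L + \sum_(g <- s) ln (normc (1 - g * expi t)) <= f t) ->
  ((2 * pi * L)%:E <= cint f)%E.
Proof.
move=> cf pf /andP[r0 r1] hs hf; have p0 := twopi_gt0.
apply/lee_addgt0Pr => eps eps0.
(* Each logarithm is at least ln (1 - rho) whatever k is, so after k averagings the sum contributes
   at least - M / 2^k. *)
pose M := (size s)%:R * - ln (1 - rho).
have M0 : 0 <= M.
  by rewrite mulr_ge0// oppr_ge0 -[leRHS]ln1 ler_ln ?posrE// ?subr_gt0// gerBl.
have [k hk] : exists k, 2 * pi * M / eps <= 2 ^+ k.
  exists (Num.bound (2 * pi * M / eps)).
  have := archi_boundP (divr_ge0 (mulr_ge0 (ltW p0) M0) (ltW eps0)).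
  by move=> /ltW/le_trans; apply; rewrite -natrX ler_nat ltnW// ltn_expl.
have [ck pk <-] := shift_averageP k cf pf.
have low t : L - (2 ^+ k)^-1 * M <= shift_average f k t.
  have hs1 g : g \in s -> normc g < 1 by move=> /hs/le_lt_trans; apply.
  apply: le_trans (shift_average_ge k hs1 hf t); rewrite lerD2l -mulrN.
  rewrite ler_wpM2l ?invr_ge0 ?exprn_ge0// /M mulrN opprK.
  apply: ler_size_sum => g gs.
  have x1 : normc (g ^+ (2 ^ k) * expi t ^+ (2 ^ k)) <= rho.
    rewrite normcM !normcX normc_expi expr1n mulr1.
    apply: le_trans (hs _ gs); rewrite -[leRHS]expr1 ler_wiXn2l ?normc_ge0 ?expn_gt0//.
    exact/ltW/hs1.
  have x2 : 1 - rho <= normc (1 - g ^+ (2 ^ k) * expi t ^+ (2 ^ k)).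
    by rewrite (le_trans _ (le_normcB _ _))// normc1 lerD2l lerN2.
  have r2 : 0 < 1 - rho by rewrite subr_gt0.
  by rewrite ler_ln ?posrE// (lt_le_trans r2).
apply: (@le_trans _ _ (cint (fun=> (L - (2 ^+ k)^-1 * M)%R) + eps%:E)%E); last first.
  by rewrite leeD2r// le_cint.
rewrite cint_cst -EFinD lee_fin.
have : 2 * pi * M <= eps * 2 ^+ k by move: hk; rewrite ler_pdivrMr// [leRHS]mulrC.
move=> {}hk; have : 2 * pi * M / 2 ^+ k <= eps by rewrite ler_pdivrMr ?exprn_gt0.
by move: {low hf hs hk} ((2 ^+ k)^-1) (pi : R) => x y; lra.
Qed.

End CircleMeans.

(** * The sub-mean value inequality for log+ of a polynomial *)

Section PolynomialSubmean.
Context {R : realType}.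

Lemma horner_continuity (p : {poly R[i]}) (z : R[i]) (eps : R) : 0 < eps ->
  exists2 d : R, 0 < d & forall w, normc (w - z) < d -> normc (p.[w] - p.[z]) < eps.
Proof.
elim/poly_ind: p eps => [|p c IH] eps e0.
  by exists 1 => // w _; rewrite !horner0 subrr normc0.
pose M := normc z + 1; have M0 : 0 < M by rewrite ltr_wpDl// normc_ge0.
pose N := normc p.[z] + 1; have N0 : 0 < N by rewrite ltr_wpDl// normc_ge0.
have e2 : 0 < eps / 2 by rewrite divr_gt0.
have [d d0 hd] := IH _ (divr_gt0 e2 M0).
exists (Num.min 1 (Num.min d (eps / 2 / N))).
  by rewrite !lt_min ltr01 d0 divr_gt0.
move=> w; rewrite !lt_min => /and3P[w1 w2 w3]; rewrite !hornerE.
have -> : p.[w] * w + c - (p.[z] * z + c) = (p.[w] - p.[z]) * w + p.[z] * (w - z).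
  by ring.
apply: le_lt_trans (le_normcD _ _) _; rewrite !normcM [ltRHS](splitr eps).
have wM : normc w <= M.
  have := le_normcB w z; move: (w1) => /ltW; rewrite /M; lra.
apply: ler_ltD.
  apply: (@le_trans _ _ (eps / 2 / M * M)); last by rewrite mulfVK// gt_eqF.
  by rewrite ler_pM ?normc_ge0// ltW// hd.
apply: (@le_lt_trans _ _ (N * normc (w - z))).
  by rewrite ler_wpM2r ?normc_ge0// lerDl.
by rewrite mulrC -ltr_pdivlMr.
Qed.

Definition lnmax1 (x : R) : R := ln (Num.max 1 x).

Lemma lnmax1_ge0 x : 0 <= lnmax1 x.
Proof. by rewrite ln_ge0// le_max lexx. Qed.

Lemma max1_gt0 (x : R) : 0 < Num.max 1 x.
Proof. by rewrite lt_max ltr01. Qed.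

(** The logarithm has slope at most 1 on [1, +oo[: max (1, y) <= max (1, x) (1 + d) when d = |x -
    y|. Unlike for [ln], the bound persists at zeros, so products may be perturbed on the whole
    circle. *)
Lemma lnmax1_lip x y : lnmax1 y - `|x - y| <= lnmax1 x.
Proof.
rewrite lerBlDr; set d := `|x - y|; have d0 : 0 <= d by exact: normr_ge0.
apply: (@le_trans _ _ (ln (Num.max 1 x * (1 + d)))).
  rewrite /lnmax1 ler_ln ?posrE ?mulr_gt0 ?max1_gt0// ?ltr_wpDr//.
  have h : Num.max 1 x <= Num.max 1 x * (1 + d).
    by rewrite ler_peMr ?(ltW (max1_gt0 x))// lerDl.
  rewrite ge_max (le_trans _ h)/= ?le_max ?lexx//.
  apply: (@le_trans _ _ (Num.max 1 x + d)).
    have hd : y - x <= d by rewrite /d distrC ler_norm.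
    have hx : x <= Num.max 1 x by rewrite le_max lexx orbT.
    by move: {h d0} d (Num.max _ _) hd hx => d m; lra.
  by rewrite mulrDr mulr1 lerD2l ler_peMl// le_max lexx.
rewrite lnM ?posrE ?max1_gt0 ?ltr_wpDr// lerD2l le_ln1Dx//.
by rewrite (lt_le_trans _ d0)// ltrN10.
Qed.

Definition circle_lnmax1 (p : {poly R[i]}) (t : R) : R := lnmax1 (normc p.[expi t]).

Lemma circle_lnmax1_continuous p : continuous (circle_lnmax1 p).
Proof.
move=> t; apply/cvgrPdist_lt => eps e0.
have [d d0 hd] := horner_continuity p (expi t) e0.
have [eta eta0 heta] := expi_continuity t d0.
apply/nbhs_ballP; exists eta => //= s hs.
have {}hs : normc (p.[expi s] - p.[expi t]) < eps.
  by apply: hd; apply: heta; rewrite distrC.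
have hn : `|normc p.[expi s] - normc p.[expi t]| <= normc (p.[expi s] - p.[expi t]).
  rewrite ler_norml; have := le_normcB p.[expi s] p.[expi t].
  by have := le_normcB p.[expi t] p.[expi s]; rewrite normcB_sym; lra.
have h1 := lnmax1_lip (normc p.[expi s]) (normc p.[expi t]).
have h2 := lnmax1_lip (normc p.[expi t]) (normc p.[expi s]).
rewrite distrC in h2; rewrite /circle_lnmax1 ltr_norml; lra.
Qed.

Lemma circle_lnmax1_periodic p t : circle_lnmax1 p (t + 2 * pi) = circle_lnmax1 p t.
Proof. by rewrite /circle_lnmax1 expiD expi_2pi mulr1. Qed.

(** For |b| <= 1 one has |z - b| = |1 - conj b z| on the unit circle; for |b| > 1 the factor |b| is
    taken out. The bound [normc b <= c] keeps track of the value at 0. *)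
Lemma reflect_root (b : R[i]) : exists g (c : R),
  [/\ normc g <= 1, 0 < c, normc b <= c &
      forall t, normc (expi t - b) = c * normc (1 - g * expi t)].
Proof.
have [b1|b1] := leP (normc b) 1.
  exists (conjc b), 1; rewrite normc_conj; split=> // t.
  rewrite mul1r -[LHS]normc_conj -[LHS]mul1r -(normc_expi t) -normcM.
  congr normc; rewrite rmorphB /= mulrBr.
  have -> : expi t * (expi t)^* = 1 by rewrite mulcJ normc_expi expr1n.
  by rewrite mulrC.
have b0 : b != 0 by rewrite -normc_gt0 (lt_trans ltr01).
exists b^-1, (normc b); split => //.
- by rewrite normcV invf_le1 ?(ltW b1)// (lt_trans ltr01).
- exact: lt_trans b1.
- by move=> t; rewrite -normcM normcB_sym mulrBr mulr1 mulVKf.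
Qed.

(* Roots outside the unit disc are divided out and those inside are reflected,
   so that all the factors 1 - g z are zero free in the open disc. *)
Lemma circle_factor (p : {poly R[i]}) : p != 0 -> exists (s : seq R[i]) (A : R),
  [/\ forall g, g \in s -> normc g <= 1, 0 < A, normc p.[0] <= A &
      forall t, normc p.[expi t] = A * normc (\prod_(g <- s) (1 - g * expi t))].
Proof.
move=> p0; have [r ->] := closed_field_poly_normal p.
have l0 : 0 < normc (lead_coef p) by rewrite normc_gt0 lead_coef_eq0.
elim: r => [|b r [s [A [hs A0 hA ht]]]].
  exists [::], (normc (lead_coef p)); split=> //; first by rewrite big_nil hornerZ hornerC mulr1.
  by move=> t; rewrite !big_nil hornerZ hornerC normcM normc1.
have [g [c [g1 c0 bc hg]]] := reflect_root b.
exists (g :: s), (c * A); split.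
- by move=> x; rewrite inE => /predU1P[->//|/hs].
- exact: mulr_gt0.
- rewrite big_cons scalerAr hornerM normcM ler_pM ?normc_ge0//.
  by rewrite !hornerE ?sub0r ?add0r normcN.
- move=> t; rewrite !big_cons scalerAr hornerM [LHS]normcM ht hornerXsubC hg.
  by rewrite [in RHS]normcM mulrACA.
Qed.

(** Replacing g by rho g with rho < 1 moves the zeros of 1 - g z off the closed disc. The change of
    the product telescopes one factor at a time; the bound 2^n on the product feeds the induction
    for 4^n. *)
Lemma scaled_prod_le (s : seq R[i]) (z : R[i]) (rho : R) :
  (forall g, g \in s -> normc g <= 1) -> normc z = 1 -> 0 <= rho <= 1 ->
  normc (\prod_(g <- s) (1 - g * z)) <= 2 ^+ size s /\
  normc (\prod_(g <- s) (1 - g * z) - \prod_(g <- s) (1 - rho%:C * g * z)) <=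
    (1 - rho) * 4 ^+ size s.
Proof.
move=> hs z1 /andP[r0 r1]; elim: s hs => [|g s IH] hs.
  by rewrite !big_nil normc1 subrr normc0 mulr1 subr_ge0.
have [|IH1 IH2] := IH; first by move=> x xs; apply: hs; rewrite inE xs orbT.
have g1 : normc g <= 1 by apply: hs; rewrite mem_head.
have gz : normc (g * z) <= 1 by rewrite normcM z1 mulr1.
have f1 : normc (1 - g * z) <= 2.
  by apply: le_trans (le_normcB2 _ _) _; rewrite normc1; lra.
have f2 : normc (1 - rho%:C * g * z) <= 2.
  apply: le_trans (le_normcB2 _ _) _; rewrite normc1 -mulrA normcM normc_real ger0_norm//.
  have : rho * normc (g * z) <= 1 by rewrite mulr_ile1 ?normc_ge0.
  lra.
rewrite !big_cons /= !exprS; split; first by rewrite normcM ler_pM ?normc_ge0.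
set X := \prod_(g <- s) _ in IH1 IH2 *; set Y := \prod_(g <- s) _ in IH2 *.
have -> : (1 - g * z) * X - (1 - rho%:C * g * z) * Y =
    (rho%:C - 1) * (g * z) * X + (1 - rho%:C * g * z) * (X - Y) by ring.
apply: le_trans (le_normcD _ _) _; rewrite !normcM.
have h1 : normc (rho%:C - 1) = 1 - rho.
  by rewrite normcB_sym -(rmorph1 (real_complex R)) -rmorphB normc_real ger0_norm// subr_ge0.
have r2 : 0 <= 1 - rho by rewrite subr_ge0.
have h2 : normc (rho%:C - 1) * (normc g * normc z) * normc X <= (1 - rho) * 2 ^+ size s.
  by rewrite h1 ler_pM ?mulr_ge0 ?normc_ge0// ler_piMr// -normcM.
have h3 : normc (1 - rho%:C * g * z) * normc (X - Y) <= 2 * ((1 - rho) * 4 ^+ size s).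
  by rewrite ler_pM ?normc_ge0.
have h4 : (1 - rho) * 2 ^+ size s <= (1 - rho) * 4 ^+ size s.
  by rewrite ler_wpM2l// lerXn2r ?nnegrE// ler_nat.
move: h2 h3 h4; set a := (_ * normc X); set b := (_ * normc (X - Y)).
have : 0 <= (1 - rho) * 4 ^+ size s by rewrite mulr_ge0 ?exprn_ge0.
rewrite [4 * _]mulrC mulrA; lra.
Qed.

Lemma ln_normc_prod (I : eqType) (s : seq I) (F : I -> R[i]) :
  (forall i, i \in s -> 0 < normc (F i)) ->
  0 < normc (\prod_(i <- s) F i) /\
  ln (normc (\prod_(i <- s) F i)) = \sum_(i <- s) ln (normc (F i)).
Proof.
elim: s => [|i s IH] h; first by rewrite !big_nil normc1 ln1.
have [|p0 eq] := IH; first by move=> j js; apply: h; rewrite inE js orbT.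
have i0 : 0 < normc (F i) by apply: h; rewrite mem_head.
by rewrite !big_cons normcM mulr_gt0// lnM ?posrE// eq.
Qed.

(** For |p(0)| <= 1 the left side is 0. Otherwise p is factored on the circle; factors with |g| = 1
    may vanish there, so g is replaced by rho g at a cost controlled by [lnmax1_lip]. *)
Lemma cint_lnmax1_poly (p : {poly R[i]}) :
  ((2 * pi * lnmax1 (normc p.[0%R]))%:E <= cint (circle_lnmax1 p))%E.
Proof.
have p2 := @twopi_gt0 R.
have [p01|p01] := leP (normc p.[0]) 1.
  rewrite /lnmax1 max_l// ln1 -cint_cst; apply: le_cint => t; exact: lnmax1_ge0.
have p0 : p != 0.
  by apply: contraTneq p01 => ->; rewrite horner0 normc0 -leNgt ler01.
have [s [A [hs A0 hA hp]]] := circle_factor p0.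
apply: (@le_trans _ _ (2 * pi * ln A)%:E).
  rewrite lee_fin ler_pM2l// /lnmax1 max_r ?(ltW p01)// ler_ln ?posrE//.
  exact: lt_trans p01.
apply/lee_addgt0Pr => eps eps0.
pose N := 2 * pi * (A * 4 ^+ size s); have N0 : 0 < N.
  by apply: mulr_gt0 => //; apply: mulr_gt0; rewrite ?exprn_gt0.
pose d := Num.min (2^-1) (eps / N).
have d0 : 0 < d by rewrite /d lt_min divr_gt0 ?andbT.
have d1 : d <= 2^-1 by rewrite /d ge_min lexx.
have d2 : d * N <= eps by rewrite -ler_pdivlMr// /d ge_min lexx orbT.
pose rho := 1 - d.
have r0 : 0 <= rho < 1 by rewrite /rho; apply/andP; split; lra.
have r01 : 0 <= rho <= 1 by move: r0 => /andP[-> /ltW].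
have [r00 r1] := andP r0.
have hs2 g : g \in [seq rho%:C * g | g <- s] -> normc g <= rho.
  move=> /mapP[h hin ->]; rewrite normcM normc_real ger0_norm//.
  by rewrite ler_piMr ?hs.
have low t : ln A - A * (d * 4 ^+ size s) +
    \sum_(g <- [seq rho%:C * g | g <- s]) ln (normc (1 - g * expi t)) <= circle_lnmax1 p t.
  rewrite big_map.
  have [_ hd] := scaled_prod_le hs (normc_expi t) r01.
  set X := \prod_(g <- s) _ in hd; set Y := \prod_(g <- s) _ in hd.
  have [|Y0 <-] := @ln_normc_prod _ s (fun g => 1 - rho%:C * g * expi t).
    move=> g gs; rewrite (lt_le_trans _ (le_normcB _ _))// normc1 subr_gt0.
    rewrite !normcM normc_expi mulr1 normc_real ger0_norm//.
    by rewrite (le_lt_trans _ r1)// ler_piMr// hs.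
  rewrite -/Y /circle_lnmax1 hp -/X.
  apply: le_trans (lnmax1_lip (A * normc X) (A * normc Y)).
  rewrite addrAC lerB//.
    rewrite -lnM ?posrE// /lnmax1 ler_ln ?posrE ?mulr_gt0 ?max1_gt0//.
    by rewrite le_max lexx orbT.
  rewrite -mulrBr normrM (ger0_norm (ltW A0)) ler_wpM2l ?(ltW A0)//.
  have -> : d = 1 - rho by rewrite /rho subKr.
  apply: le_trans hd; rewrite ler_norml.
  have := le_normcB X Y; have := le_normcB Y X; rewrite normcB_sym; lra.
have := cint_log_ge (@circle_lnmax1_continuous p) (circle_lnmax1_periodic p) r0 hs2 low.
move=> /(leeD2r eps%:E); apply: le_trans; rewrite -EFinD lee_fin.
have -> : 2 * pi * (ln A - A * (d * 4 ^+ size s)) = 2 * pi * ln A - d * N.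
  by rewrite /N; ring.
lra.
Qed.

End PolynomialSubmean.

(** * Chebyshev competitors *)

Section Chebyshev.
Context {R : realType}.

(** The Chebyshev polynomial of degree 2^k, through the doubling formula T_(2m) = 2 T_m^2 - 1. *)
Fixpoint cheb (k : nat) : {poly R[i]} :=
  if k is k'.+1 then 2%:P * cheb k' ^+ 2 - 1 else 'X.

Lemma chebS k (w : R[i]) : (cheb k.+1).[w] = 2 * (cheb k).[w] ^+ 2 - 1.
Proof. by rewrite /= !hornerE. Qed.

Lemma cheb_joukowski k (z : R[i]) : z != 0 ->
  (cheb k).[(z + z^-1) / 2] = (z ^+ (2 ^ k) + (z ^+ (2 ^ k))^-1) / 2.
Proof.
move=> z0; elim: k => [|k IH]; first by rewrite /= hornerX expr1.
have x0 : z ^+ (2 ^ k) != 0 by rewrite expf_neq0.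
rewrite chebS IH expnS mulnC exprM; move: (z ^+ (2 ^ k)) x0 => x x0.
by field.
Qed.

Lemma cheb_real k (x : R) : `|x| <= 1 ->
  exists2 y : R, `|y| <= 1 & (cheb k).[x%:C] = y%:C.
Proof.
move=> x1; elim: k => [|k [y y1 IH]]; first by exists x; rewrite //= hornerX.
exists (2 * y ^+ 2 - 1).
  have : y ^+ 2 <= 1 by rewrite -real_normK ?num_real// exprn_ile1.
  by have := sqr_ge0 y; rewrite ler_norml => ? ?; apply/andP; split; lra.
by rewrite chebS IH rmorphB rmorphM rmorphXn rmorph1 rmorph_nat.
Qed.

(** The factor 3 makes 2^-k ln (3 max (1, |T_(2^k) w|)) nonincreasing in k: with M the maximum, |2
    T^2 - 1| <= 3 M^2, and 3 times 3 M^2 is (3 M)^2. The growth bound is thus the one for k = 0. *)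
Lemma cheb_growth k (w : R[i]) :
  (2 ^+ k)^-1 * lnmax1 (normc (cheb k).[w]) <= ln (3 * Num.max 1 (normc w)).
Proof.
have h3 x : lnmax1 x <= ln (3 * Num.max 1 x) :> R.
  rewrite /lnmax1 ler_ln ?posrE ?mulr_gt0 ?max1_gt0//.
  by rewrite ler_peMl ?(ltW (max1_gt0 _))// ler1n.
suff h : (2 ^+ k)^-1 * ln (3 * Num.max 1 (normc (cheb k).[w])) <= ln (3 * Num.max 1 (normc w)).
  by apply: le_trans h; rewrite ler_wpM2l ?invr_ge0 ?exprn_ge0.
elim: k => [|k IH]; first by rewrite expr0 invr1 mul1r /= hornerX.
apply: le_trans IH; rewrite exprS invfM [2^-1 * _]mulrC -mulrA ler_wpM2l ?invr_ge0 ?exprn_ge0//.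
set x := normc (cheb k).[w]; have M0 := max1_gt0 x.
rewrite mulrC ler_pdivrMr// mulr_natr -lnXn ?mulr_gt0//.
rewrite ler_ln ?posrE ?exprn_gt0 ?mulr_gt0 ?max1_gt0// exprMn.
have x0 : 0 <= x by exact: normc_ge0.
have M1 : 1 <= Num.max 1 x by rewrite le_max lexx.
have Mx : x <= Num.max 1 x by rewrite le_max lexx orbT.
have M2 : 1 <= Num.max 1 x ^+ 2 by rewrite exprn_ege1.
have Mx2 : x ^+ 2 <= Num.max 1 x ^+ 2 by rewrite lerXn2r// nnegrE ltW.
have : normc (cheb k.+1).[w] <= 3 * Num.max 1 x ^+ 2.
  rewrite chebS; apply: le_trans (le_normcB2 _ _) _.
  rewrite normc1 normcM normcX -/x.
  rewrite normc_nat.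
  lra.
move=> hc; have : Num.max 1 (normc (cheb k.+1).[w]) <= 3 * Num.max 1 x ^+ 2.
  by rewrite ge_max hc andbT; lra.
by move: (Num.max 1 (normc _)) => y; lra.
Qed.

Lemma pow2_small (M eps : R) : 0 < eps -> exists k, M / 2 ^+ k <= eps.
Proof.
move=> e0; exists (Num.bound (`|M| / eps)).
have := archi_boundP (divr_ge0 (normr_ge0 M) (ltW e0)); set k := Num.bound _.
move=> h; rewrite ler_pdivrMr ?exprn_gt0// mulrC -ler_pdivrMr//.
apply: (@le_trans _ _ (`|M| / eps)); first by rewrite ler_wpM2r ?invr_ge0 ?(ltW e0)// ler_norm.
by rewrite (le_trans (ltW h))// -natrX ler_nat ltnW// ltn_expl.
Qed.

Lemma cheb_lower (z : R[i]) (eps : R) : 1 < normc z -> 0 < eps -> exists k,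
  ln (normc z) - eps <= (2 ^+ k)^-1 * lnmax1 (normc (cheb k).[(z + z^-1) / 2]).
Proof.
set r := normc z => r1 e0; have r0 : 0 < r by rewrite (lt_trans ltr01).
have z0 : z != 0 by rewrite -normc_gt0.
(* From (r^N - r^-N) / 2 >= r^N (1 - 1 / r) / 2; the logarithm of [c] is divided by 2^k and becomes
   negligible. *)
pose c := (1 - r^-1) / 2; have c0 : 0 < c by rewrite divr_gt0// subr_gt0 invf_lt1.
have [k hk] := pow2_small (- ln c) e0; exists k.
rewrite cheb_joukowski//; set N := (2 ^ k)%N; have N0 : (0 < N)%N by rewrite expn_gt0.
have rN : 0 < r ^+ N by rewrite exprn_gt0.
have rN1 : r <= r ^+ N by rewrite -[leLHS]expr1 ler_weXn2l ?ltW.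
have low : r ^+ N * c <= normc ((z ^+ N + (z ^+ N)^-1) / 2).
  rewrite normcM normcV.
  rewrite normc_nat.
  rewrite /c mulrA ler_pM2r ?invr_gt0//.
  have := le_normcB (z ^+ N) (- (z ^+ N)^-1).
  rewrite opprK normcN normcV normcX -/r => h; apply: le_trans h.
  rewrite mulrBr mulr1 lerB//.
  apply: (@le_trans _ _ 1); first by rewrite invf_le1// (le_trans (ltW r1)).
  by rewrite ler_pdivlMr// mul1r.
have : ln (r ^+ N * c) <= lnmax1 (normc ((z ^+ N + (z ^+ N)^-1) / 2)).
  by rewrite /lnmax1 ler_ln ?posrE ?max1_gt0 ?le_max ?low ?orbT// mulr_gt0.
rewrite lnM ?posrE// lnXn// => h.
apply: (@le_trans _ _ ((2 ^+ k)^-1 * (ln r *+ N + ln c))); last first.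
  by rewrite ler_wpM2l ?invr_ge0 ?exprn_ge0.
rewrite mulrDr -[ln r *+ N]mulr_natl /N natrX mulrA mulVf ?expf_neq0// mul1r lerD2l.
by rewrite lerNl -mulrN mulrC.
Qed.

End Chebyshev.

Section LinearForm.
Context {R : realType} {n : nat}.
Implicit Types (L : 'rV[R]_n) (v w : Cvec R n).

Definition rform L (x : 'rV[R]_n) : R := \sum_(j < n) L 0 j * x 0 j.

Definition cform L w : R[i] := \sum_(j < n) (L 0 j)%:C * (w 0 j : R[i]).

Lemma cformD L v w : cform L (v + w) = cform L v + cform L w.
Proof. by rewrite /cform -big_split; apply: eq_bigr => j _; rewrite mxE mulrDr. Qed.

Lemma cformZ L (c : R[i]) v : cform L (c *: v) = c * cform L v.
Proof.
rewrite /cform mulr_sumr; apply: eq_bigr => j _.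
by rewrite mxE mulrCA.
Qed.

Lemma cform_cplx L x : cform L (cplx x) = (rform L x)%:C.
Proof.
by rewrite /cform /rform rmorph_sum; apply: eq_bigr => j _; rewrite mxE rmorphM.
Qed.

Lemma cform_conjv L v : cform L (conjv v) = conjc (cform L v).
Proof.
rewrite /cform rmorph_sum; apply: eq_bigr => j _.
by rewrite mxE rmorphM /= oppr0.
Qed.

Lemma normc_cform L v : normc (cform L v) <= l1norm (cplx L) * l1norm v.
Proof.
apply: le_trans (ler_sum_normc _ _) _; rewrite /l1norm mulr_suml; apply: ler_sum => j _.
rewrite normcM mxE ler_wpM2l ?normc_ge0//.
exact: normc_coord_l1norm.
Qed.

Lemma normc_le_enorm v j : normc (v 0 j : R[i]) <= enorm v.
Proof.
rewrite /enorm -(@ler_pXn2r _ 2) ?nnegrE ?sqrtr_ge0 ?normc_ge0//.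
rewrite sqr_sqrtr; last by apply: sumr_ge0 => i _; rewrite addr_ge0 ?sqr_ge0.
rewrite sqr_normcE (bigD1 j)//= lerDl; apply: sumr_ge0 => i _.
by rewrite addr_ge0 ?sqr_ge0.
Qed.

Lemma l1norm_le_enorm v : l1norm v <= n%:R * enorm v.
Proof.
rewrite -[n in n%:R]card_ord -sum1_card natr_sum mulr_suml /l1norm; apply: ler_sum => j _.
by rewrite mul1r normc_le_enorm.
Qed.

Lemma lnmax1_le_logp (x : R) : lnmax1 x <= logp x.
Proof.
rewrite /lnmax1 /logp; have [x1|x1] := leP x 1; first by rewrite ln1 le_max lexx.
by rewrite le_max lexx orbT.
Qed.

End LinearForm.

Section ChebyshevCandidate.
Context {R : realType} {n : nat}.
Variables (c : R) (L : 'rV[R]_n).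
Local Notation mu := (@lebesgue_measure R).

Definition cheb_cand (k : nat) (w : Cvec R n) : \bar R :=
  ((2 ^+ k)^-1 * lnmax1 (normc (cheb k).[c%:C + cform L w]))%:E.

Lemma cheb_cand_usc k : upper_semicontinuous (cheb_cand k).
Proof.
move=> z r; rewrite /cheb_cand lte_fin => hz; set x := (X in X < r) in hz.
have e0 : 0 < r - x by rewrite subr_gt0.
have [d d0 hd] := horner_continuity (cheb k) (c%:C + cform L z) e0.
pose A := l1norm (cplx L) * n%:R + 1.
have A0 : 0 < A by rewrite ltr_wpDl// mulr_ge0// l1norm_ge0.
apply/nbhs_CvecP; exists (d / A); split; first by rewrite divr_gt0.
move=> w hw; rewrite lte_fin.
have {}hw : normc (c%:C + cform L w - (c%:C + cform L z)) < d.
  have -> : c%:C + cform L w - (c%:C + cform L z) = cform L (w - z).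
    by rewrite cformD -(scaleN1r z) cformZ mulN1r opprD addrACA subrr add0r.
  apply: le_lt_trans (normc_cform _ _) _.
  have h : l1norm (w - z) <= n%:R * (d / A).
    rewrite -[n in n%:R]card_ord -sum1_card natr_sum mulr_suml /l1norm.
    by apply: ler_sum => j _; rewrite mul1r !mxE ltW// hw.
  apply: le_lt_trans (ler_wpM2l (l1norm_ge0 _) h) _.
  by rewrite !mulrA ltr_pdivrMr// [ltLHS]mulrC ltr_pM2l// ltrDl.
have hk : 0 <= (2 ^+ k : R)^-1 <= 1.
  by rewrite invr_ge0 exprn_ge0//= invf_le1 ?exprn_gt0// exprn_ege1// ler1n.
have := hd _ hw; set a := normc (_ - _) => ha.
have h1 := lnmax1_lip (normc (cheb k).[c%:C + cform L z]) (normc (cheb k).[c%:C + cform L w]).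
have hn : `|normc (cheb k).[c%:C + cform L z] - normc (cheb k).[c%:C + cform L w]| <= a.
  rewrite ler_norml; have := le_normcB (cheb k).[c%:C + cform L z] (cheb k).[c%:C + cform L w].
  have := le_normcB (cheb k).[c%:C + cform L w] (cheb k).[c%:C + cform L z].
  by rewrite [X in _ -> _ <= X -> _]normcB_sym -/a; lra.
rewrite -(subrK x r) -ltrBlDr /x -mulrBr.
move: h1 hn ha hk; set y := lnmax1 _; set y' := lnmax1 _; move: `|_| => b h1 hn ha /andP[k0 k1].
have [yy|yy] := leP (y - y') 0.
  by apply: le_lt_trans e0; rewrite mulr_ge0_le0.
by apply: le_lt_trans (ler_piMl (ltW yy) k1) _; rewrite -/x; lra.
Qed.

(** On a complex line the argument of the Chebyshev polynomial is affine in the parameter, so the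
    inequality is [cint_lnmax1_poly] for the composed polynomial. *)
Lemma cheb_cand_psh k : plurisubharmonic (cheb_cand k).
Proof.
split; first by move=> z; rewrite /cheb_cand ltry.
  exact: cheb_cand_usc.
move=> a b; pose q : {poly R[i]} := (c%:C + cform L a)%:P + cform L b *: 'X.
pose p := cheb k \Po q.
have hp t : c%:C + cform L (a + t *: b) = q.[t].
  by rewrite /q !hornerE cformD cformZ addrA [t * _]mulrC.
have q0 : 0 <= (2 ^+ k : R)^-1 by rewrite invr_ge0 exprn_ge0.
have hint : (\int[mu]_(t in `[0%R, (2 * pi)%R]) cheb_cand k (a + expi t *: b)%R =
    ((2 ^+ k)^-1)%:E * cint (circle_lnmax1 p))%E.
  rewrite /cint -integralZl//; last first.
    apply: continuous_compact_integrable; first exact: segment_compact.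
    by apply: continuous_subspaceT; exact: circle_lnmax1_continuous.
  by apply: eq_integral => t _; rewrite /cheb_cand hp /circle_lnmax1 horner_comp.
rewrite hint /cheb_cand.
have -> : c%:C + cform L a = q.[0] by rewrite -hp scale0r addr0.
have p2 := @twopi_gt0 R.
apply: (@le_trans _ _ (((2 * pi)^-1)%:E * (((2 ^+ k)^-1)%:E *
    (2 * pi * lnmax1 (normc p.[0%R]))%R%:E))%E).
  rewrite -!EFinM lee_fin mulrCA mulKf ?gt_eqF// /p horner_comp//.
rewrite lee_pmul2l ?lte_fin ?invr_gt0// lee_wpmul2l ?lee_fin//.
exact: cint_lnmax1_poly.
Qed.

Lemma cheb_cand_lelong k : lelong_class (cheb_cand k).
Proof.
split; first exact: cheb_cand_psh.
pose A := `|c| + l1norm (cplx L) * n%:R + 1.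
have nn : 0 <= l1norm (cplx L) * n%:R by rewrite mulr_ge0// l1norm_ge0.
have A0 : 0 < A by rewrite ltr_wpDl// addr_ge0.
exists (ln (3 * A)) => z; rewrite /cheb_cand lee_fin.
apply: le_trans (cheb_growth _ _) _.
have e1 : 0 <= enorm z by rewrite sqrtr_ge0.
have M0 := max1_gt0 (enorm z).
have M1 : 1 <= Num.max 1 (enorm z) by rewrite le_max lexx.
have Me : enorm z <= Num.max 1 (enorm z) by rewrite le_max lexx orbT.
apply: (@le_trans _ _ (ln (3 * A * Num.max 1 (enorm z)))); last first.
  by rewrite lnM ?posrE ?mulr_gt0// addrC lerD2r lnmax1_le_logp.
have A3 : 0 < 3 * A by rewrite mulr_gt0.
rewrite ler_ln ?posrE; [|by rewrite mulr_gt0 ?max1_gt0|exact: mulr_gt0].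
rewrite -mulrA ler_wpM2l// ge_max; apply/andP; split.
  rewrite mulr_ege1// /A lerDr addr_ge0//.
apply: le_trans (le_normcD _ _) _; rewrite normc_real.
have h1 := normc_cform L z.
have h2 := ler_wpM2l (l1norm_ge0 (cplx L)) (l1norm_le_enorm z).
have h3 := ler_wpM2l nn Me.
have h4 : `|c| * 1 <= `|c| * Num.max 1 (enorm z) by rewrite ler_wpM2l.
rewrite /A !mulrDl mul1r; rewrite mulrA in h2; move: h1 h2 h3 h4.
clear -M0 M1; lra.
Qed.

End ChebyshevCandidate.

(** On K the affine function takes values in [-1, 1], where the Chebyshev polynomials are bounded by
    1, so the candidates vanish on K and compete in the supremum. *)
Lemma siciak_ge_joukowski (R : realType) n (K : set 'rV[R]_n) (c : R) (L : 'rV[R]_n)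
    (w : Cvec R n) (z : R[i]) :
  (forall x, K x -> `|c + rform L x| <= 1) ->
  c%:C + cform L w = (z + z^-1) / 2 -> 1 < normc z ->
  ((ln (normc z))%:E <= siciak (cplx @` K) w)%E.
Proof.
move=> hK hw z1; apply/lee_subgt0Pr => eps eps0.
have [k hk] := cheb_lower z1 eps0.
apply: (@le_trans _ _ (cheb_cand c L k w)).
  by rewrite -EFinB lee_fin hw.
apply: ereal_sup_ubound; exists (cheb_cand c L k) => //.
split; first exact: cheb_cand_lelong.
move=> _ [x Kx <-]; rewrite /cheb_cand lee_fin cform_cplx -rmorphD.
have [y y1 ->] := cheb_real k (hK x Kx).
by rewrite normc_real /lnmax1 max_l// ln1 mulr0.
Qed.

(** * The inverse Joukowski map *)

Section InverseJoukowski.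
Context {R : realType}.
Implicit Types w z : R[i].

(** The roots w + s and w - s, with s^2 = w^2 - 1, have product 1, so one of them has modulus at
    least 1. *)
Lemma joukowski_surj w :
  exists z : R[i], [/\ z != 0, 1 <= normc z & w = (z + z^-1) / 2].
Proof.
pose s := sqrtc (w ^+ 2 - 1); have s2 : s ^+ 2 = w ^+ 2 - 1 by exact: sqr_sqrtc.
have prod1 : (w + s) * (w - s) = 1.
  by rewrite mulrC -subr_sqr s2 opprB addrC subrK.
have n2 : (2 : R[i]) != 0 by rewrite pnatr_eq0.
have e1 : w + s != 0.
  by apply/eqP => h; move: prod1; rewrite h mul0r => /esym/eqP; rewrite oner_eq0.
have e2 : w - s != 0.
  by apply/eqP => h; move: prod1; rewrite h mulr0 => /esym/eqP; rewrite oner_eq0.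
have i1 : (w + s)^-1 = w - s by apply: (mulfI e1); rewrite prod1 mulfV.
have i2 : (w - s)^-1 = w + s by rewrite -i1 invrK.
have [h|h] := leP 1 (normc (w + s)).
  by exists (w + s); split=> //; rewrite i1; field.
exists (w - s); split=> //; last by rewrite i2; field.
by rewrite -i1 normcV invf_ge1 ?normc_gt0// ltW.
Qed.

(** Off [-1, 1] the exterior root is unique. On [-1, 1] both roots have modulus 1 and the choice is
    arbitrary; regularity is claimed only where |jouk w| > 1. *)
Definition jouk w : R[i] := projT1 (cid (joukowski_surj w)).

Lemma joukP w : [/\ jouk w != 0, 1 <= normc (jouk w) & w = (jouk w + (jouk w)^-1) / 2].
Proof. exact: (projT2 (cid (joukowski_surj w))). Qed.

Lemma joukowski_sub z z' : z != 0 -> z' != 0 ->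
  (z' + z'^-1) / 2 - (z + z^-1) / 2 = (z' - z) * (1 - (z * z')^-1) / 2.
Proof. by move=> z0 z0'; field; rewrite z0 z0'. Qed.

(** In [joukowski_sub] the factor 1 - 1 / (z z') is bounded below when |z| > 1 and |z'| >= 1. Equal
    values then give uniqueness of the exterior root, nearby values continuity of [jouk]. *)
Lemma joukowski_lip z z' : 1 < normc z -> 1 <= normc z' ->
  normc (z' - z) <=
    2 / (1 - (normc z)^-1) * normc ((z' + z'^-1) / 2 - (z + z^-1) / 2).
Proof.
move=> z1 z1'.
have n0 : 0 < normc z by rewrite (lt_trans ltr01).
have n0' : 0 < normc z' by rewrite (lt_le_trans ltr01).
have z0 : z != 0 by rewrite -normc_gt0.
have z0' : z' != 0 by rewrite -normc_gt0.
have k0 : 0 < 1 - (normc z)^-1 by rewrite subr_gt0 invf_lt1.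
have low : 1 - (normc z)^-1 <= normc (1 - (z * z')^-1).
  apply: le_trans (le_normcB _ _); rewrite normc1 normcV normcM lerD2l lerN2 invfM.
  by rewrite ler_piMr ?invr_ge0 ?normc_ge0// invf_le1.
rewrite joukowski_sub// !normcM normcV.
rewrite normc_nat.
rewrite mulrAC ler_pdivlMr//.
by have := ler_wpM2l (normc_ge0 (z' - z)) low; lra.
Qed.

Lemma jouk_joukowski z : 1 < normc z -> jouk ((z + z^-1) / 2) = z.
Proof.
move=> z1; have [_ j1 jE] := joukP ((z + z^-1) / 2).
have := joukowski_lip z1 j1; rewrite -jE subrr normc0 mulr0 => h.
apply/eqP; rewrite -subr_eq0 -normc_eq0 eq_le h; exact: normc_ge0.
Qed.

(** The square root of w^2 - 1 on the branch with jouk w = w + jsig w. *)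
Definition jsig w : R[i] := (jouk w - (jouk w)^-1) / 2.

Lemma sqr_jsig w : jsig w ^+ 2 = w ^+ 2 - 1.
Proof.
have [j0 _ {2}->] := joukP w; rewrite /jsig; field.
by rewrite j0.
Qed.

Lemma jsig_neq0 w : 1 < normc (jouk w) -> jsig w != 0.
Proof.
move=> j1; have [j0 _ _] := joukP w; apply/eqP => h.
have : jouk w = (jouk w)^-1.
  apply/eqP; rewrite -subr_eq0; move/eqP: h; rewrite /jsig mulf_eq0 invr_eq0.
  by rewrite pnatr_eq0 orbF.
move/(congr1 (@normc _)); rewrite normcV => h2.
have : (normc (jouk w))^-1 < 1 by rewrite invf_lt1// (lt_trans ltr01).
by rewrite -h2 ltNge (ltW j1).
Qed.

Lemma jouk_local w : 1 < normc (jouk w) -> exists d C : R,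
  [/\ 0 < d, 0 < C & forall w', normc (w' - w) < d ->
    [/\ normc (jouk w' - jouk w) <= C * normc (w' - w),
        normc (jouk w' - jouk w) <= 4^-1,
        normc (jsig w' - jsig w) <= C * normc (w' - w),
        jsig w' != 0 & normc (jsig w')^-1 <= 2 * normc (jsig w)^-1]].
Proof.
move=> j1; have [j0 _ jE] := joukP w.
have s0 := jsig_neq0 j1; have ns0 : 0 < normc (jsig w) by rewrite normc_gt0.
have k0 : 0 < 1 - (normc (jouk w))^-1 by rewrite subr_gt0 invf_lt1// (lt_trans ltr01).
pose C := 2 / (1 - (normc (jouk w))^-1); have C0 : 0 < C by rewrite divr_gt0.
(* The first bound gives |jouk w' - jouk w| <= 1 / 4, the second |jsig w'| >= |jsig w| / 2. *)
exists (Num.min (4^-1 / C) (normc (jsig w) / 2 / C)), C; split=> //.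
  by rewrite lt_min !divr_gt0.
move=> w'; rewrite lt_min => /andP[h1 h2].
have [j0' j1' jE'] := joukP w'.
have lipJ : normc (jouk w' - jouk w) <= C * normc (w' - w).
  by rewrite {2}jE {2}jE'; exact: joukowski_lip.
have lipS : normc (jsig w' - jsig w) <= C * normc (w' - w).
  apply: le_trans lipJ; rewrite /jsig.
  have -> : (jouk w' - (jouk w')^-1) / 2 - (jouk w - (jouk w)^-1) / 2 =
      (jouk w' - jouk w) * ((1 + (jouk w * jouk w')^-1) / 2).
    by field; rewrite j0 j0'.
  rewrite normcM ler_piMr ?normc_ge0// normcM normcV.
  rewrite normc_nat.
  rewrite ler_pdivrMr// mul1r; apply: le_trans (le_normcD _ _) _.
  have : normc (jouk w * jouk w')^-1 <= 1.
    by rewrite normcV normcM invf_le1 ?mulr_gt0 ?normc_gt0// mulr_ege1// ltW.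
  rewrite normc1; lra.
have hS : normc (jsig w' - jsig w) <= normc (jsig w) / 2.
  by apply: le_trans lipS _; rewrite mulrC -ler_pdivlMr// ltW.
have hs' : normc (jsig w) / 2 <= normc (jsig w').
  by have := le_normcB (jsig w) (jsig w'); rewrite normcB_sym; lra.
have ns' : 0 < normc (jsig w') by apply: lt_le_trans hs'; rewrite divr_gt0.
split=> //.
- by apply: le_trans lipJ _; rewrite mulrC -ler_pdivlMr// ltW.
- by rewrite -normc_gt0.
- rewrite !normcV -[leRHS]invrK invfM invrK [2^-1 * _]mulrC.
  by rewrite lef_pV2 ?posrE// divr_gt0.
Qed.

(* The derivative of the inverse Joukowski map J is J / sig. *)
Lemma ln_jouk_expand w : 1 < normc (jouk w) -> exists d C : R,
  [/\ 0 < d, 0 < C & forall w', normc (w' - w) < d ->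
    `|ln (normc (jouk w')) - ln (normc (jouk w)) - complex.Re ((w' - w) / jsig w)|
      <= C * normc (w' - w) ^+ 2].
Proof.
move=> j1; have [d [C [d0 C0 hd]]] := jouk_local j1.
have s0 := jsig_neq0 j1; have ns0 : 0 < normc (jsig w) by rewrite normc_gt0.
have [j0 _ jE] := joukP w.
have nj0 : 0 < normc (jouk w) by rewrite normc_gt0.
exists d, ((18 + (normc (jsig w))^-1) * C ^+ 2); split=> //.
  by rewrite mulr_gt0 ?exprn_gt0// ltr_wpDr ?invr_ge0 ?normc_ge0.
move=> w' /hd[lipJ J4 _ _ _].
have [j0' j1' jE'] := joukP w'.
have nj0' : 0 < normc (jouk w') by rewrite normc_gt0.
pose eta := (jouk w' - jouk w) / jouk w.
set D := normc (jouk w' - jouk w) in lipJ J4.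
have heta : normc eta <= D.
  by rewrite normcM normcV ler_pdivrMr// ler_peMr ?normc_ge0// ltW.
have e4 : normc eta <= 4^-1 by exact: le_trans J4.
have lnE : ln (normc (jouk w')) - ln (normc (jouk w)) = ln (normc (1 + eta)).
  have h : jouk w' = jouk w * (1 + eta) by rewrite /eta; field.
  have e0 : 0 < normc (1 + eta).
    by rewrite normc_gt0; apply: contraNneq j0' => h0; rewrite h h0 mulr0.
  by rewrite h [normc (_ * _)]normcM lnM ?posrE// addrC addKr.
have D0 : 0 <= D by exact: normc_ge0.
have up (e : R[i]) : normc e <= 2^-1 ->
    ln (normc (1 + e)) <= complex.Re e + 4 * normc e ^+ 2.
  move=> e2; have := @ln_normc1D _ e _ erefl e2.
  have h1 := Re_le_normc (e ^+ 2); rewrite normcX ler_norml in h1.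
  move: h1 => /andP[h1 _].
  have h3 : normc e ^+ 3 <= 2^-1 * normc e ^+ 2 by rewrite exprS ler_wpM2r ?sqr_ge0.
  have := sqr_ge0 (normc e); lra.
have hup := up eta; rewrite -lnE in hup.
(* The lower bound is the upper bound [up] applied to 1 / (1 + eta) = 1 + eta', whose logarithmic
   modulus is the opposite one. *)
pose eta' := quadratic_remainder eta - eta.
have e2 : normc eta <= 2^-1 by apply: le_trans e4 _; rewrite lef_pV2 ?posrE// ler_nat.
have e1 : (1 + eta)^-1 = 1 + eta' by rewrite (inv1DE erefl e2) /eta'; ring.
have q2 := normc_quadratic_remainder erefl e2.
have e'2 : normc eta' <= 2 * normc eta.
  apply: le_trans (le_normcB2 _ _) _.
  have : normc eta ^+ 2 <= 4^-1 * normc eta by rewrite expr2 ler_wpM2r ?normc_ge0.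
  have := normc_ge0 eta; lra.
have e'1 : normc eta' <= 2^-1 by apply: le_trans e'2 _; move: e4; lra.
have hlow := up eta' e'1.
have lnV' : ln (normc (1 + eta')) = - (ln (normc (jouk w')) - ln (normc (jouk w))).
  by rewrite -e1 normcV lnV ?posrE ?lnE//; exact: (normc1D_gt0 erefl e2).
rewrite lnV' in hlow.
have hRe : complex.Re eta' <= - complex.Re eta + 2 * normc eta ^+ 2.
  rewrite /eta' cReB addrC lerD2l.
  by apply: le_trans q2; apply: le_trans (ler_norm _) (Re_le_normc _).
have hsq : normc eta' ^+ 2 <= 4 * normc eta ^+ 2.
  have -> : 4 * normc eta ^+ 2 = (2 * normc eta) ^+ 2 by ring.
  by rewrite lerXn2r ?nnegrE ?normc_ge0// mulr_ge0 ?normc_ge0.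
have hsq2 : normc eta ^+ 2 <= D ^+ 2 by rewrite lerXn2r ?nnegrE ?normc_ge0.
have hdiff : eta - (w' - w) / jsig w =
    - ((jouk w' - jouk w) ^+ 2 / (2 * jsig w * (jouk w ^+ 2 * jouk w'))).
  apply: (mulIf s0); rewrite mulrBl mulfVK//.
  transitivity (- ((jouk w' - jouk w) ^+ 2 / (2 * (jouk w ^+ 2 * jouk w')))).
    have -> : w' - w = (jouk w' - jouk w) * (1 - (jouk w * jouk w')^-1) / 2.
      by rewrite -joukowski_sub// -jE -jE'.
    rewrite /eta /jsig; move: (jouk w) (jouk w') j0 j0' => j j' j0 j0'.
    by field; rewrite j0 j0'.
  move: (jouk w) (jouk w') (jsig w) j0 j0' s0 => j j' g j0 j0' g0.
  by field; rewrite j0 j0' g0.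
have hdiff2 : normc (eta - (w' - w) / jsig w) <= (normc (jsig w))^-1 * D ^+ 2.
  rewrite hdiff normcN normcM normcX -/D mulrC ler_wpM2r ?sqr_ge0//.
  rewrite normcV 2!normcM [normc (_ * jouk w')]normcM lef_pV2 ?posrE
    ?mulr_gt0 ?normc_gt0 ?pnatr_eq0 ?expf_neq0//.
  rewrite normc_nat.
  have h1 : 1 <= normc (jouk w ^+ 2) * normc (jouk w').
    by rewrite mulr_ege1// normcX exprn_ege1// ltW.
  have h2 := ler_wpM2l (mulr_ge0 (ler0n R 2) (ltW ns0)) h1.
  rewrite mulr1 in h2; apply: (le_trans _ h2).
  by move: (normc (jsig w)) ns0 => x x0; lra.
have hR := le_trans (Re_le_normc _) hdiff2; rewrite cReB ler_norml in hR.
have hD : D ^+ 2 <= C ^+ 2 * normc (w' - w) ^+ 2.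
  by rewrite -exprMn lerXn2r ?nnegrE ?mulr_ge0 ?normc_ge0// ltW.
have hfin : (18 + (normc (jsig w))^-1) * D ^+ 2 <=
    (18 + (normc (jsig w))^-1) * C ^+ 2 * normc (w' - w) ^+ 2.
  by rewrite -mulrA ler_wpM2l// addr_ge0 ?invr_ge0 ?normc_ge0.
apply: le_trans hfin; move: hR => /andP[hR1 hR2]; rewrite ler_norml.
have {}hup := hup e2.
move: hup hlow hRe hsq hsq2 hR1 hR2.
move: (ln _ - ln _) (complex.Re eta) (complex.Re eta') (complex.Re _) (normc eta ^+ 2)
  (normc eta' ^+ 2) (normc (jsig w))^-1 (D ^+ 2) => l a b c e f s g; lra.
Qed.

(** Differentiating sig^2 = w^2 - 1 gives w / sig for sig and - w / sig^3 for 1 / sig. The relation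
    [rel] is this computation for finite increments S of sig and D of w. *)
Lemma jsig_inv_expand w : 1 < normc (jouk w) -> exists d C : R,
  [/\ 0 < d, 0 < C & forall w', normc (w' - w) < d ->
    normc ((jsig w')^-1 - (jsig w)^-1 + (w' - w) * (w / jsig w ^+ 3))
      <= C * normc (w' - w) ^+ 2].
Proof.
move=> j1; have [d [C [d0 C0 hd]]] := jouk_local j1.
have s0 := jsig_neq0 j1.
set s := (jsig w)^-1; have ns0 : 0 < normc s by rewrite normc_gt0 invr_eq0.
exists d, (normc s ^+ 3 * (1 + 3 * C ^+ 2)); split=> //.
  by rewrite mulr_gt0 ?exprn_gt0// ltr_wpDr// mulr_ge0// exprn_ge0// ltW.
move=> w' /hd[_ _ lipS s0' sB].
pose S := jsig w' - jsig w; pose D := w' - w.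
have rel : D ^+ 2 - S ^+ 2 = 2 * (jsig w * S - w * D).
  have := sqr_jsig w; have := sqr_jsig w'; rewrite /S /D => e1 e2.
  have e3 : jsig w' ^+ 2 - jsig w ^+ 2 = w' ^+ 2 - w ^+ 2 by rewrite e1 e2; ring.
  apply/eqP; rewrite -subr_eq0; apply/eqP.
  by rewrite -[RHS](subrr (w' ^+ 2 - w ^+ 2)) -[X in _ = _ - X]e3; ring.
have -> : (jsig w')^-1 - s + (w' - w) * (w / jsig w ^+ 3) =
    - ((D ^+ 2 - S ^+ 2) / 2 * s ^+ 3) + S ^+ 2 * (s ^+ 2 * (jsig w')^-1).
  rewrite rel /s /S -/D; move: (jsig w) (jsig w') s0 s0' => x y x0 y0.
  by field; rewrite x0 y0.
have na : normc (- ((D ^+ 2 - S ^+ 2) / 2 * s ^+ 3)) =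
    normc (D ^+ 2 - S ^+ 2) / 2 * normc s ^+ 3.
  by rewrite normcN 2!normcM normcV normc_nat normcX.
have nb : normc (S ^+ 2 * (s ^+ 2 * (jsig w')^-1)) =
    normc S ^+ 2 * (normc s ^+ 2 * normc (jsig w')^-1).
  by rewrite normcM [normc (s ^+ 2 * _)]normcM !normcX.
apply: le_trans (le_normcD _ _) _; rewrite na nb.
have hS2 : normc S ^+ 2 <= C ^+ 2 * normc D ^+ 2.
  by rewrite -exprMn lerXn2r ?nnegrE ?mulr_ge0 ?normc_ge0// ltW.
have h1 : normc (D ^+ 2 - S ^+ 2) <= (1 + C ^+ 2) * normc D ^+ 2.
  have := le_normcB2 (D ^+ 2) (S ^+ 2); rewrite !normcX => /le_trans; apply.
  by rewrite mulrDl mul1r lerD2l.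
have h2 : normc (D ^+ 2 - S ^+ 2) / 2 * normc s ^+ 3 <=
    (1 + C ^+ 2) * normc D ^+ 2 / 2 * normc s ^+ 3.
  by rewrite ler_wpM2r ?exprn_ge0 ?normc_ge0// ler_wpM2r ?invr_ge0.
have h3 : normc S ^+ 2 * (normc s ^+ 2 * normc (jsig w')^-1) <=
    C ^+ 2 * normc D ^+ 2 * (2 * normc s ^+ 3).
  apply: ler_pM => //; rewrite ?mulr_ge0 ?exprn_ge0 ?normc_ge0//.
  have := ler_wpM2l (exprn_ge0 2 (normc_ge0 s)) sB.
  by rewrite -/s [X in _ <= X]mulrCA -exprSr.
have h4 : 0 <= normc D ^+ 2 * normc s ^+ 3 by rewrite mulr_ge0 ?exprn_ge0 ?normc_ge0.
have h5 : 0 <= C ^+ 2 * (normc D ^+ 2 * normc s ^+ 3) by rewrite mulr_ge0 ?exprn_ge0 ?(ltW C0).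
apply: le_trans (lerD h2 h3) _; rewrite -/D; move: h4 h5.
by move: (C ^+ 2) (normc D ^+ 2) (normc s ^+ 3) => x y u; lra.
Qed.

Lemma jsig_inv_lip w : 1 < normc (jouk w) -> exists d C : R,
  [/\ 0 < d, 0 < C & forall w', normc (w' - w) < d ->
    normc ((jsig w')^-1 - (jsig w)^-1) <= C * normc (w' - w) /\
    normc (jsig w')^-1 <= 2 * normc (jsig w)^-1].
Proof.
move=> j1; have [d [C [d0 C0 hd]]] := jouk_local j1.
have s0 := jsig_neq0 j1.
have ns0 : 0 < normc (jsig w)^-1 by rewrite normc_gt0 invr_eq0.
exists d, (2 * C * normc (jsig w)^-1 ^+ 2); split=> //.
  by apply: mulr_gt0; [exact: mulr_gt0|exact: exprn_gt0].
move=> w' /hd[_ _ lipS s0' sB]; split=> //.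
have -> : (jsig w')^-1 - (jsig w)^-1 =
   - ((jsig w' - jsig w) * ((jsig w)^-1 * (jsig w')^-1)) by field; rewrite s0 s0'.
rewrite normcN 2!normcM.
have h := ler_wpM2l (ltW ns0) sB.
apply: le_trans (ler_pM _ _ lipS h) _; rewrite ?mulr_ge0 ?normc_ge0//.
by rewrite expr2 le_eqVlt; apply/orP; left; apply/eqP; ring.
Qed.

End InverseJoukowski.

(** * Derivatives of the logarithm of the exterior root *)

Section Pluriharmonicity.
Context {R : realType}.

Lemma is_derive_quadratic (f : R -> R) (l d C : R) : 0 < d -> 0 <= C ->
  (forall t, `|t| < d -> `|f t - f 0 - t * l| <= C * t ^+ 2) -> is_derive (0 : R) 1 f l.
Proof.
move=> d0 C0 hf.
have h : (fun h : R => h^-1 *: (f (h *: 1 + 0) - f 0)) @ 0^' --> l.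
  apply/cvgrPdist_le => eps eps0.
  have C1 : 0 < C + 1 by rewrite ltr_wpDl.
  near=> t.
  have t0 : t != 0 by near: t; exact: nbhs_dnbhs_neq.
  have td : `|t| < d.
    near: t; apply: dnbhs0_lt; exact: d0.
  have te : `|t| < eps / (C + 1).
    by near: t; apply: dnbhs0_lt; rewrite divr_gt0.
  rewrite addr0 /GRing.scale /= mulr1.
  have -> : l - t^-1 * (f t - f 0) = - (t^-1 * (f t - f 0 - t * l)).
    by field.
  rewrite normrN normrM normfV.
  have nt : 0 < `|t| by rewrite normr_gt0.
  rewrite mulrC ler_pdivrMr//; apply: le_trans (hf _ td) _.
  rewrite -real_normK ?num_real// expr2 mulrA ler_wpM2r//.
  have : `|t| * (C + 1) <= eps by rewrite -ler_pdivlMr// ltW.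
  by rewrite mulrDr mulr1 mulrC; move: (normr_ge0 t); lra.
by apply: DeriveDef; [apply/cvg_ex; exists l|exact: cvg_lim h].
Unshelve. all: by end_near.
Qed.

Context {n : nat}.
Variables (U : set (Cvec R n)) (h : Cvec R n -> R) (c : R) (L : 'rV[R]_n).
Local Notation aff w := (c%:C + cform L w).
Hypothesis openU : open U.
Hypothesis hU : forall w, U w -> 1 < normc (jouk (aff w)).
Hypothesis hE : forall w, U w -> h w = ln (normc (jouk (aff w))).

Let aff_line z (v : Cvec R n) (t : R) : aff (z + t%:C *: v) = aff z + t%:C * cform L v.
Proof. by rewrite cformD cformZ addrA. Qed.

Let U_line z (v : Cvec R n) : U z -> exists2 d : R, 0 < d &
  forall t : R, `|t| < d -> U (z + t%:C *: v).
Proof.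
move=> Uz; have /nbhs_CvecP[e [e0 he]] := open_nbhs_nbhs (conj openU Uz).
have v0 : 0 < l1norm v + 1 by rewrite ltr_wpDl// l1norm_ge0.
exists (e / (l1norm v + 1)); first by rewrite divr_gt0.
move=> t ht; apply: he => j; rewrite !mxE addrAC subrr add0r normcM normc_real.
move: ht; rewrite ltr_pdivlMr//; apply: le_lt_trans.
rewrite ler_wpM2l//; apply: le_trans (normc_coord_l1norm v j) _.
by rewrite lerDl.
Qed.

Lemma continuous_aff (G : Cvec R n -> R) (k : R[i] -> R) z (d C : R) : U z ->
  (forall w, U w -> G w = k (aff w)) -> 0 < d ->
  (forall x, normc (x - aff z) < d -> `|k x - k (aff z)| <= C * normc (x - aff z)) ->
  {for z, continuous G}.
Proof.
move=> Uz hG d0 hk B /nbhs_ballP[/= eps eps0 hA]; apply/nbhs_CvecP.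
have /nbhs_CvecP[e [e0 he]] := open_nbhs_nbhs (conj openU Uz).
pose A := l1norm (cplx L) * n%:R + 1.
have A0 : 0 < A by rewrite ltr_wpDl// mulr_ge0// l1norm_ge0.
have C1 : 0 < `|C| + 1 by rewrite ltr_wpDl.
have pd : 0 < d / A by exact: divr_gt0.
have pe : 0 < eps / (`|C| + 1) / A by apply: divr_gt0 => //; exact: divr_gt0.
exists (Num.min e (Num.min (d / A) (eps / (`|C| + 1) / A))); split.
  by rewrite !lt_min e0 pd pe.
move=> w hw.
have Uw : U w by apply: he => j; apply: lt_le_trans (hw j) _; rewrite ge_min lexx.
set r := Num.min (d / A) (eps / (`|C| + 1) / A) in hw.
have r0 : 0 < r by rewrite /r lt_min pd pe.
have hl : normc (aff w - aff z) < A * r.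
  have -> : aff w - aff z = cform L (w - z).
    by rewrite cformD -(scaleN1r z) cformZ mulN1r opprD addrACA subrr add0r.
  apply: le_lt_trans (normc_cform _ _) _.
  have hh : l1norm (w - z) <= n%:R * r.
    rewrite -[n in n%:R]card_ord -sum1_card natr_sum mulr_suml /l1norm.
    apply: ler_sum => j _; rewrite mul1r !mxE ltW// (lt_le_trans (hw j))//.
    by rewrite ge_min lexx orbT.
  apply: le_lt_trans (ler_wpM2l (l1norm_ge0 _) hh) _.
  by rewrite mulrA ltr_pM2r// ltrDl.
have l1 : normc (aff w - aff z) < d.
  apply: lt_le_trans hl _; rewrite mulrC -ler_pdivlMr// /r ge_min lexx//.
have l2 : normc (aff w - aff z) < eps / (`|C| + 1).
  apply: lt_le_trans hl _; rewrite mulrC -ler_pdivlMr// /r ge_min lexx orbT//.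
apply: hA; rewrite /ball /= distrC (hG _ Uw) (hG _ Uz).
apply: le_lt_trans (hk _ l1) _.
apply: (@le_lt_trans _ _ ((`|C| + 1) * normc (aff w - aff z))).
  rewrite ler_wpM2r ?normc_ge0//; apply: le_trans (ler_norm C) _.
  by rewrite lerDl.
by rewrite mulrC -ltr_pdivlMr.
Qed.

(** With J the exterior root, (ln J)' = 1 / sig and (1 / sig)' = - w / sig^3. Composition with the
    affine function gives the first and second directional derivatives of Re (ln J). *)
Definition dfirst (v w : Cvec R n) : R := complex.Re (cform L v / jsig (aff w)).

Definition dsecond (v v' w : Cvec R n) : R :=
  - complex.Re (cform L v * cform L v' * (aff w / jsig (aff w) ^+ 3)).

Lemma is_derive_first z v : U z ->
  is_derive (0 : R) 1 (fun t : R => h (z + t%:C *: v)) (dfirst v z).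
Proof.
move=> Uz; have [d [C [d0 C0 hd]]] := ln_jouk_expand (hU Uz).
have [e e0 he] := U_line v Uz.
have b0 : 0 < normc (cform L v) + 1 by rewrite ltr_wpDl// normc_ge0.
apply: (@is_derive_quadratic _ _ (Num.min e (d / (normc (cform L v) + 1)))
  (C * normc (cform L v) ^+ 2)).
- by rewrite lt_min e0 divr_gt0.
- by rewrite mulr_ge0 ?exprn_ge0 ?normc_ge0// ltW.
move=> t; rewrite lt_min => /andP[t1 t2].
rewrite scale0r addr0 (hE Uz) (hE (he _ t1)) aff_line.
have hl : normc (aff z + t%:C * cform L v - aff z) = `|t| * normc (cform L v).
  by rewrite [aff z + _]addrC addrK normcM normc_real.
have := hd (aff z + t%:C * cform L v); rewrite hl [(`|t| * _) ^+ 2]exprMn real_normK ?num_real//.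
have -> : complex.Re ((aff z + t%:C * cform L v - aff z) / jsig (aff z)) =
    t * dfirst v z.
  rewrite [aff z + _]addrC addrK /dfirst -mulrA cReM /= mul0r subr0//.
rewrite mulrA mulrAC -[C * _ * _]mulrAC; apply.
apply: le_lt_trans (_ : `|t| * (normc (cform L v) + 1) < d).
  by rewrite ler_wpM2l// lerDl.
by rewrite -ltr_pdivlMr.
Qed.

Lemma rderive_first z v : U z -> rderive v h z = dfirst v z.
Proof.
move=> Uz; rewrite /rderive derive1E.
exact: (@derive_val _ _ _ _ _ _ _ (is_derive_first v Uz)).
Qed.

Lemma is_derive_second z v v' : U z ->
  is_derive (0 : R) 1 (fun t : R => rderive v h (z + t%:C *: v')) (dsecond v v' z).
Proof.
move=> Uz; have [d [C [d0 C0 hd]]] := jsig_inv_expand (hU Uz).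
have [e e0 he] := U_line v' Uz.
have b0 : 0 < normc (cform L v') + 1 by rewrite ltr_wpDl// normc_ge0.
apply: (@is_derive_quadratic _ _ (Num.min e (d / (normc (cform L v') + 1)))
  (normc (cform L v) * (C * normc (cform L v') ^+ 2))).
- by rewrite lt_min e0 divr_gt0.
- by rewrite !mulr_ge0 ?exprn_ge0 ?normc_ge0// ltW.
move=> t; rewrite lt_min => /andP[t1 t2].
rewrite scale0r addr0 (rderive_first _ Uz) (rderive_first _ (he _ t1)) /dfirst aff_line.
have hl : normc (aff z + t%:C * cform L v' - aff z) = `|t| * normc (cform L v').
  by rewrite [aff z + _]addrC addrK normcM normc_real.
have := hd (aff z + t%:C * cform L v'); rewrite hl [(`|t| * _) ^+ 2]exprMn real_normK ?num_real//.
rewrite [aff z + _ - aff z]addrAC subrr add0r => hC.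
have -> : complex.Re (cform L v / jsig (aff z + t%:C * cform L v')) -
    complex.Re (cform L v / jsig (aff z)) - t * dsecond v v' z =
  complex.Re (cform L v * ((jsig (aff z + t%:C * cform L v'))^-1 - (jsig (aff z))^-1 +
    t%:C * cform L v' * (aff z / jsig (aff z) ^+ 3))).
  rewrite /dsecond mulrDr mulrBr cReD cReB mulrN opprK; congr (_ + _).
  have -> : cform L v * (t%:C * cform L v' * (aff z / jsig (aff z) ^+ 3)) =
    t%:C * (cform L v * cform L v' * (aff z / jsig (aff z) ^+ 3)) by ring.
  by rewrite [RHS]cReM /= mul0r subr0.
have hlt : `|t| * normc (cform L v') < d.
  apply: le_lt_trans (_ : `|t| * (normc (cform L v') + 1) < d).
    by rewrite ler_wpM2l// lerDl.
  by rewrite -ltr_pdivlMr.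
apply: le_trans (Re_le_normc _) _; rewrite [X in X <= _]normcM.
apply: le_trans (ler_wpM2l (normc_ge0 (cform L v)) (hC hlt)) _.
by rewrite le_eqVlt; apply/orP; left; apply/eqP; ring.
Qed.

Lemma rderive_second z v v' : U z -> rderive v' (rderive v h) z = dsecond v v' z.
Proof.
move=> Uz; rewrite /rderive derive1E.
exact: (@derive_val _ _ _ _ _ _ _ (is_derive_second v v' Uz)).
Qed.

Lemma continuous_h z : U z -> {for z, continuous h}.
Proof.
move=> Uz; have [d [C [d0 C0 hd]]] := ln_jouk_expand (hU Uz).
apply: (@continuous_aff _ (fun x => ln (normc (jouk x))) z (Num.min d 1)
  (C + normc (jsig (aff z))^-1)) => //; first by rewrite lt_min d0 ltr01.
move=> x; rewrite lt_min => /andP[x1 x2]; have := hd _ x1.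
set y := x - aff z in x1 x2 *.
have h1 := Re_le_normc (y / jsig (aff z)); rewrite normcM in h1.
have h2 : C * normc y ^+ 2 <= C * normc y.
  by rewrite ler_wpM2l ?(ltW C0)// expr2 ler_piMl ?normc_ge0// ltW.
move: h1 h2; move: (complex.Re _) (ln _ - ln _) => a b.
rewrite mulrDl !ler_norml => /andP[? ?] ? /andP[? ?]; apply/andP; split; lra.
Qed.

Lemma continuous_first z v : U z -> {for z, continuous (rderive v h)}.
Proof.
move=> Uz; have [d [C [d0 C0 hd]]] := jsig_inv_lip (hU Uz).
apply: (@continuous_aff _ (fun x => complex.Re (cform L v / jsig x)) z d
  (normc (cform L v) * C)) => //; first by move=> w Uw; rewrite rderive_first.
move=> x /hd[hx _]; rewrite -cReB -mulrBr; apply: le_trans (Re_le_normc _) _.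
by rewrite normcM -mulrA ler_wpM2l ?normc_ge0.
Qed.

Lemma continuous_second z v v' : U z -> {for z, continuous (rderive v' (rderive v h))}.
Proof.
move=> Uz; have [d [C [d0 C0 hd]]] := jsig_inv_lip (hU Uz).
pose s := (jsig (aff z))^-1; pose b := cform L v * cform L v'.
pose M := normc b * (8 * normc s ^+ 3 + normc (aff z) * (7 * normc s ^+ 2 * C)).
apply: (@continuous_aff _ (fun x => - complex.Re (b * (x / jsig x ^+ 3))) z d M) => //.
  by move=> w Uw; rewrite rderive_second.
move=> x /hd; rewrite -/s; set s' := (jsig x)^-1 => -[hx hs].
rewrite -opprD normrN -cReB -mulrBr; apply: le_trans (Re_le_normc _) _.
rewrite [X in X <= _]normcM /M -[leRHS]mulrA; apply: ler_wpM2l; first exact: normc_ge0.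
rewrite -!exprVn -/s -/s'.
have -> : x * s' ^+ 3 - aff z * s ^+ 3 =
  (x - aff z) * s' ^+ 3 + aff z * ((s' - s) * (s' ^+ 2 + s' * s + s ^+ 2)) by ring.
have na : normc ((x - aff z) * s' ^+ 3) = normc (x - aff z) * normc s' ^+ 3.
  by rewrite normcM normcX.
have nb : normc (aff z * ((s' - s) * (s' ^+ 2 + s' * s + s ^+ 2))) =
    normc (aff z) * (normc (s' - s) * normc (s' ^+ 2 + s' * s + s ^+ 2)).
  by rewrite normcM [normc ((s' - s) * _)]normcM.
apply: le_trans (le_normcD _ _) _; rewrite na nb.
have s0 := normc_ge0 s; have s0' := normc_ge0 s'.
have q1 : normc s' ^+ 2 <= 4 * normc s ^+ 2.
  have -> : 4 * normc s ^+ 2 = (2 * normc s) ^+ 2 by ring.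
  by rewrite lerXn2r ?nnegrE ?mulr_ge0.
have q2 : normc s' ^+ 3 <= 8 * normc s ^+ 3.
  have -> : 8 * normc s ^+ 3 = (2 * normc s) ^+ 3 by ring.
  by rewrite lerXn2r ?nnegrE ?mulr_ge0.
have q3 : normc (s' ^+ 2 + s' * s + s ^+ 2) <= 7 * normc s ^+ 2.
  have h1 := le_normcD (s' ^+ 2 + s' * s) (s ^+ 2).
  have h2 := le_normcD (s' ^+ 2) (s' * s).
  rewrite !normcX in h1 h2; rewrite normcM in h2.
  have h3 := ler_wpM2r s0 hs.
  apply: le_trans h1 _; move: h2 h3 q1; rewrite -mulrA -expr2; lra.
have N0 := normc_ge0 (x - aff z).
have q4 : normc (s' - s) * normc (s' ^+ 2 + s' * s + s ^+ 2) <=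
    C * normc (x - aff z) * (7 * normc s ^+ 2) by rewrite ler_pM ?normc_ge0.
have q5 := ler_wpM2l N0 q2; have q6 := ler_wpM2l (normc_ge0 (aff z)) q4.
apply: le_trans (lerD q5 q6) _.
by rewrite le_eqVlt; apply/orP; left; apply/eqP; ring.
Qed.

(** The second derivative is the real part of a complex bilinear form in the directions, so passing
    from b to i b changes its sign. *)
Lemma pluriharmonic_jouk : pluriharmonic_on U h.
Proof.
split=> [z Uz|z b Uz].
  split; first exact: continuous_h.
    move=> v; split; last exact: continuous_first.
    exact: (@ex_derive _ _ _ _ _ _ _ (is_derive_first v Uz)).
  move=> v v'; split; last exact: continuous_second.
  exact: (@ex_derive _ _ _ _ _ _ _ (is_derive_second v v' Uz)).
rewrite !rderive_second// /dsecond cformZ -opprD -cReD.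
have -> : cform L b * cform L b * (aff z / jsig (aff z) ^+ 3) +
    (0 +i* 1) * cform L b * ((0 +i* 1) * cform L b) * (aff z / jsig (aff z) ^+ 3) =
  (1 + (0 +i* 1) ^+ 2) * (cform L b * cform L b * (aff z / jsig (aff z) ^+ 3)) by ring.
have -> : (0 +i* 1) ^+ 2 = -1 :> R[i] by exact: sqr_i.
by rewrite subrr mul0r oppr0.
Qed.

End Pluriharmonicity.

(** * Planar convexity and extremal ellipses *)

Lemma nbhs_rVP (R : realType) n (x : 'rV[R]_n) (A : set 'rV[R]_n) :
  nbhs x A <-> exists e : R, 0 < e /\
    forall y : 'rV[R]_n, (forall j, `|y 0 j - x 0 j| < e) -> A y.
Proof.
split.
  move=> /nbhs_ballP[e /= e0 h]; exists e; split=> // y hy; apply: h; split=> //.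
  by move=> i j; rewrite (ord1 i) -ball_normE /= distrC.
move=> [e [e0 h]]; apply/nbhs_ballP; exists e => // y [_ hy]; apply: h => j.
by move: (hy 0 j); rewrite -ball_normE /= distrC.
Qed.

Section RealForm.
Context {R : realType} {n : nat}.
Implicit Types (L x y : 'rV[R]_n).

Lemma rformD L x y : rform L (x + y) = rform L x + rform L y.
Proof. by rewrite /rform -big_split; apply: eq_bigr => j _; rewrite mxE mulrDr. Qed.

Lemma rformZ L (c : R) x : rform L (c *: x) = c * rform L x.
Proof. by rewrite /rform mulr_sumr; apply: eq_bigr => j _; rewrite mxE mulrCA. Qed.

Lemma rformB L x y : rform L (x - y) = rform L x - rform L y.
Proof. by rewrite rformD -scaleN1r rformZ mulN1r. Qed.

Lemma convex_combination (K : set 'rV[R]_n) x y (t : R) :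
  convex_set K -> K x -> K y -> 0 <= t <= 1 -> K ((1 - t) *: x + t *: y).
Proof.
move=> cK Kx Ky /andP[t0 t1].
have := cK y x (Itv01 t0 t1) (mem_set Ky) (mem_set Kx).
by rewrite inE addrC.
Qed.

End RealForm.

Section StripGeometry.
Context {R : realType}.

Lemma rV2_ext (T : Type) (v w : 'rV[T]_2) : v 0 0 = w 0 0 -> v 0 1 = w 0 1 -> v = w.
Proof.
move=> h0 h1; apply/rowP => -[[|[|//]] hj].
  by have -> : Ordinal hj = 0 by apply: val_inj.
by have -> : Ordinal hj = 1 by apply: val_inj.
Qed.

Lemma lincombE (T : pzRingType) k (x y : T) (v w : 'rV[T]_k) j :
  (x *: v + y *: w) 0 j = x * v 0 j + y * w 0 j.
Proof. by rewrite !mxE. Qed.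

(* Coordinates in the plane adapted to the strip: m is the coordinate along the
   lines, c + rform L the coordinate across, -1 and 1 on the two lines. *)
Lemma strip_coordinates (p1 q1 p2 q2 : 'rV[R]_2) : parallel_segments p1 q1 p2 q2 ->
  exists (c : R) (L m e : 'rV[R]_2), let d := q1 - p1 in
  [/\ forall v, v = rform m v *: d + rform L v *: e,
      forall v, v = cform m v *: cplx d + cform L v *: cplx e,
      rform L d = 0 /\ rform m d = 1 &
      c + rform L p1 = -1 /\ c + rform L p2 = 1].
Proof.
move=> [pq1 _ _ hdist]; set d := q1 - p1.
have d0 : d != 0 by rewrite subr_eq0 eq_sym.
pose a := d 0 0; pose b := d 0 1.
have D0 : a ^+ 2 + b ^+ 2 != 0.
  apply: contraNneq d0 => h.
  have /andP[/eqP a0 /eqP b0] : (a == 0) && (b == 0).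
    by rewrite -(sqrf_eq0 a) -(sqrf_eq0 b) -paddr_eq0 ?sqr_ge0// h.
  by apply/eqP/rV2_ext; rewrite [RHS]mxE; [exact: a0|exact: b0].
pose row2 (x y : R) : 'rV[R]_2 := \row_j (if j == 0 then x else y).
have rf x y v : rform (row2 x y) v = x * v 0 0 + y * v 0 1.
  by rewrite /rform big_ord_recl big_ord1 !mxE /=; congr (_ + _ * v 0 _); apply: val_inj.
have cf x y (v : Cvec R 2) : cform (row2 x y) v = x%:C * (v 0 0 : R[i]) + y%:C * (v 0 1 : R[i]).
  by rewrite /cform big_ord_recl big_ord1 !mxE /=; congr (_ + _ * v 0 _); apply: val_inj.
pose l1 := b * p1 0 0 - a * p1 0 1; pose l2 := b * p2 0 0 - a * p2 0 1.
have l12 : l2 - l1 != 0.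
  (* On equal levels p2 - p1 would be t d, with t the orthogonal projection coefficient, and the two
     lines would coincide. *)
  apply/eqP => h; pose t := (a * (p2 0 0 - p1 0 0) + b * (p2 0 1 - p1 0 1)) / (a ^+ 2 + b ^+ 2).
  have /eqP := hdist t; apply; apply/rowP => j; rewrite !mxE.
  have e1 : p2 0 0 = p1 0 0 + t * a.
    apply: (mulIf D0); rewrite /t mulrDl mulrAC divfK//.
    have : (l2 - l1) * b = 0 by rewrite h mul0r.
    by rewrite /l1 /l2 => hb; apply/eqP; rewrite -subr_eq0; apply/eqP; rewrite -[RHS]hb; ring.
  have e2 : p2 0 1 = p1 0 1 + t * b.
    apply: (mulIf D0); rewrite /t mulrDl mulrAC divfK//.
    have : (l2 - l1) * - a = 0 by rewrite h mul0r.
    by rewrite /l1 /l2 => hb; apply/eqP; rewrite -subr_eq0; apply/eqP; rewrite -[RHS]hb; ring.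
  case: j => -[|[|//]] hj.
    have -> : Ordinal hj = 0 by apply: val_inj.
    by rewrite e1 /a !mxE.
  have -> : Ordinal hj = 1 by apply: val_inj.
  by rewrite e2 /b !mxE.
pose k := 2 / (l2 - l1); have k0 : k != 0 by rewrite mulf_neq0 ?invr_eq0 ?pnatr_eq0.
pose D := a ^+ 2 + b ^+ 2.
exists (- (l1 + l2) / (l2 - l1)), (row2 (k * b) (- (k * a))), (row2 (a / D) (b / D)),
  (row2 (b / D / k) (- (a / D / k))).
(* The four matrix entries of the identity d m + e L = 1 for the vectors d, e and the coordinate
   forms m, L. *)
have s1 : a / D * a + k * b * (b / D / k) = 1 by rewrite /D; field; rewrite D0 k0.
have s2 : b / D * a + (- (k * a)) * (b / D / k) = 0 by rewrite /D; field; rewrite D0 k0.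
have s3 : a / D * b + k * b * (- (a / D / k)) = 0 by rewrite /D; field; rewrite D0 k0.
have s4 : b / D * b + (- (k * a)) * (- (a / D / k)) = 1 by rewrite /D; field; rewrite D0 k0.
have r0 x y : row2 x y 0 0 = x by rewrite mxE.
have r1 x y : row2 x y 0 1 = y by rewrite mxE.
have toC (x y z w u : R) : x * y + z * w = u -> x%:C * y%:C + z%:C * w%:C = u%:C :> R[i].
  by move=> <-; rewrite rmorphD !rmorphM.
rewrite -/d; split.
- move=> v; apply: rV2_ext; rewrite lincombE !rf ?r0 ?r1 -/a -/b.
    rewrite -[LHS]mul1r -s1 -[LHS]addr0 -[X in _ + X](mul0r (v 0 1)) -s2; ring.
  rewrite -[LHS]mul1r -s4 -[LHS]addr0 -[X in _ + X](mul0r (v 0 0)) -s3; ring.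
- have cE (x : 'rV[R]_2) j : cplx x 0 j = (x 0 j)%:C by rewrite mxE.
  have := toC _ _ _ _ _ s1; have := toC _ _ _ _ _ s2; have := toC _ _ _ _ _ s3.
  have := toC _ _ _ _ _ s4; rewrite rmorph1 rmorph0 => S4 S3 S2 S1.
  move=> v; apply: rV2_ext; rewrite lincombE !cf !cE ?r0 ?r1 -/a -/b.
    rewrite -[LHS]mul1r -S1 -[LHS]addr0 -[X in _ + X](mul0r (v 0 1 : R[i])) -S2; ring.
  rewrite -[LHS]mul1r -S4 -[LHS]addr0 -[X in _ + X](mul0r (v 0 0 : R[i])) -S3; ring.
- rewrite !rf -/a -/b; split; first by ring.
  by rewrite /D; field.
- rewrite !rf; split; rewrite /k.
    have -> : 2 / (l2 - l1) * b * p1 0 0 + - (2 / (l2 - l1) * a) * p1 0 1 =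
      2 / (l2 - l1) * l1 by rewrite /l1; ring.
    by field.
  have -> : 2 / (l2 - l1) * b * p2 0 0 + - (2 / (l2 - l1) * a) * p2 0 1 =
    2 / (l2 - l1) * l2 by rewrite /l2; ring.
  by field.
Qed.

End StripGeometry.

Section HalfDisc.
Context {R : realType}.
Variables (K : set 'rV[R]_2) (L m d e : 'rV[R]_2).
Hypothesis cK : convex_set K.
Hypothesis dec : forall v, v = rform m v *: d + rform L v *: e.

Lemma form_ext v w : rform m v = rform m w -> rform L v = rform L w -> v = w.
Proof. by move=> h1 h2; rewrite [LHS]dec [RHS]dec h1 h2. Qed.

(** By convexity K contains the triangle over [p, q] with apex [e'], hence a half disc around [x0]
    on the apex side. Its size is measured in the coordinates m and L, the side by the sign of a
    product. *)
Lemma half_disc p q x0 e' : K p -> K q -> K e' -> open_segment p q x0 ->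
  rform L (q - p) = 0 -> q != p -> rform L (e' - p) != 0 ->
  exists2 eta : R, 0 < eta & forall y, `|rform m (y - x0)| < eta ->
    `|rform L (y - x0)| < eta -> 0 <= rform L (y - x0) * rform L (e' - p) -> K y.
Proof.
move=> Kp Kq Ke [t0 /andP[t00 t01] /= hx0] Lqp qp H0.
set H := rform L (e' - p) in H0 *.
pose s := rform m (q - p); have s0 : s != 0.
  apply: contraNneq qp => h; rewrite -subr_eq0; apply/eqP/form_ext.
    by rewrite -/s h -(subrr 0) rformB subrr.
  by rewrite Lqp -(subrr 0) rformB subrr.
have mx0 : rform m x0 = rform m p + t0 * s.
  by rewrite -hx0 rformD !rformZ /s rformB; ring.
have Lx0 : rform L x0 = rform L p.
  have -> : rform L x0 = rform L p + t0 * rform L (q - p).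
    by rewrite -hx0 rformB rformD !rformZ; ring.
  by rewrite Lqp mulr0 addr0.
pose G := `|rform m (e' - x0)|; have G0 : 0 <= G by exact: normr_ge0.
have nH : 0 < `|H| by rewrite normr_gt0.
have ns : 0 < `|s| by rewrite normr_gt0.
pose mu := Num.min t0 (1 - t0).
have mu0 : 0 < mu by rewrite lt_min t00 subr_gt0.
have q0 : 0 < 1 + G / `|H| by rewrite ltr_wpDr// divr_ge0// ltW.
have pe : 0 < mu * `|s| / 2 / (1 + G / `|H|).
  by apply: divr_gt0 => //; apply: divr_gt0 => //; exact: mulr_gt0.
(* The first bound makes the weight [lam] of the apex at most 1 / 2. The second keeps the tangential
   offset [N] below mu |s| / 2, so the base point [tau] stays within [mu], the distance of t0 to the
   ends of [0, 1]. *)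
exists (Num.min (`|H| / 2) (mu * `|s| / 2 / (1 + G / `|H|))).
  by rewrite lt_min pe divr_gt0.
move=> y; rewrite !lt_min => /andP[_ my] /andP[Ly1 Ly2] sgn.
pose lam := rform L (y - x0) / H.
have lam0 : 0 <= lam.
  have -> : lam = rform L (y - x0) * H / H ^+ 2 by rewrite /lam; field.
  by rewrite divr_ge0// sqr_ge0.
have lamn : lam = `|rform L (y - x0)| / `|H| by rewrite -normf_div ger0_norm.
have lam2 : lam <= 2^-1.
  by rewrite lamn ler_pdivrMr// mulrC ltW.
have l1 : 0 < 1 - lam.
  by rewrite subr_gt0; apply: le_lt_trans lam2 _; rewrite invf_lt1// ltr1n.
pose eta := mu * `|s| / 2 / (1 + G / `|H|).
pose N := rform m (y - x0) - lam * rform m (e' - x0).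
have hN : `|N| <= mu * `|s| / 2.
  apply: le_trans (ler_normB _ _) _; rewrite normrM (ger0_norm lam0) -/G.
  have h1 : lam * G <= eta / `|H| * G.
    by rewrite ler_wpM2r// lamn ler_wpM2r ?invr_ge0 ?(ltW nH)// ltW.
  apply: (@le_trans _ _ (eta * (1 + G / `|H|))).
    by rewrite mulrDr mulr1 lerD ?(ltW my)// (le_trans h1)// mulrA mulrAC.
  by rewrite /eta divfK// gt_eqF.
pose tau := t0 + N / ((1 - lam) * s).
have htau : `|tau - t0| <= mu.
  rewrite /tau addrC addKr normf_div normrM (gtr0_norm l1).
  rewrite ler_pdivrMr ?mulr_gt0//; apply: le_trans hN _.
  rewrite -mulrA [`|s| / 2]mulrC ler_wpM2l ?(ltW mu0)// ler_wpM2r ?(ltW ns)//.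
  by move: lam2; lra.
have mu1 : mu <= t0 by rewrite /mu ge_min lexx.
have mu2 : mu <= 1 - t0 by rewrite /mu ge_min lexx orbT.
have tau01 : 0 <= tau <= 1.
  move: htau; rewrite ler_norml => /andP[h1 h2]; apply/andP; split.
    by move: h1 mu1; lra.
  by move: h2 mu2; lra.
have -> : y = (1 - lam) *: ((1 - tau) *: p + tau *: q) + lam *: e'.
  apply: form_ext; rewrite !(rformD, rformZ).
    have e1 : rform m q = rform m p + s by rewrite /s rformB addrC subrK.
    have e2 : (1 - lam) * (tau * s) = (1 - lam) * (t0 * s) + N.
      by rewrite /tau; field; rewrite s0 gt_eqF.
    have -> : (1 - lam) * ((1 - tau) * rform m p + tau * rform m q) =
      (1 - lam) * rform m p + (1 - lam) * (tau * s) by rewrite e1; ring.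
    by rewrite e2 /N !rformB mx0; ring.
  have e1 : rform L q = rform L p by move: Lqp; rewrite rformB => /subr0_eq.
  have e2 : lam * H = rform L (y - x0) by rewrite /lam divfK.
  have -> : (1 - lam) * ((1 - tau) * rform L p + tau * rform L q) + lam * rform L e' =
    rform L p + lam * H by rewrite e1 /H rformB; ring.
  by rewrite e2 rformB Lx0; ring.
apply: convex_combination => //; first exact: convex_combination.
by rewrite lam0 (le_trans lam2)// invf_le1// ler1n.
Qed.

Lemma form_small (x : 'rV[R]_2) (eta : R) : 0 < eta -> exists2 r : R, 0 < r &
  forall y : 'rV[R]_2, (forall j, `|y 0 j - x 0 j| < r) ->
    `|rform m (y - x)| < eta /\ `|rform L (y - x)| < eta.
Proof.
move=> eta0; pose A (l : 'rV[R]_2) := \sum_(j < 2) `|l 0 j| + 1.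
have A0 l : 0 < A l by rewrite ltr_wpDl// sumr_ge0.
have key (l y : 'rV[R]_2) (r : R) : 0 <= r -> (forall j, `|y 0 j - x 0 j| < r) ->
    `|rform l (y - x)| <= (\sum_(j < 2) `|l 0 j|) * r.
  move=> r0 h; apply: le_trans (ler_norm_sum _ _ _) _; rewrite mulr_suml.
  by apply: ler_sum => j _; rewrite normrM !mxE ler_wpM2l// ltW.
exists (eta / (A m + A L)); first by rewrite divr_gt0// addr_gt0.
move=> y hy; have r0 : 0 < eta / (A m + A L) by rewrite divr_gt0// addr_gt0.
have fin l : A l <= A m + A L -> `|rform l (y - x)| < eta.
  move=> hA; apply: le_lt_trans (key l y _ (ltW r0) hy) _.
  apply: (@lt_le_trans _ _ (A l * (eta / (A m + A L)))).
    by rewrite ltr_pM2r// ltrDl.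
  apply: (@le_trans _ _ ((A m + A L) * (eta / (A m + A L)))).
    by rewrite ler_wpM2r// ltW.
  by rewrite mulrC divfK// gt_eqF// addr_gt0.
by split; apply: fin; rewrite ?lerDl ?lerDr ltW.
Qed.

Lemma interior_form x : K° x -> exists2 eta : R, 0 < eta &
  forall y, `|rform m (y - x)| < eta -> `|rform L (y - x)| < eta -> K y.
Proof.
move=> /nbhs_rVP[r [r0 hr]].
pose A := \sum_(j < 2) (`|d 0 j| + `|e 0 j|) + 1.
have A0 : 0 < A by rewrite ltr_wpDl// sumr_ge0// => j _; exact: addr_ge0.
exists (r / A); first exact: divr_gt0.
move=> y h1 h2; apply: hr => j.
have -> : y 0 j - x 0 j = rform m (y - x) * d 0 j + rform L (y - x) * e 0 j.
  by rewrite -lincombE -dec !mxE.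
apply: le_lt_trans (ler_normD _ _) _; rewrite !normrM.
apply: (@le_lt_trans _ _ (r / A * (`|d 0 j| + `|e 0 j|))).
  by rewrite mulrDr lerD// ler_wpM2r// ltW.
rewrite -ltr_pdivlMl ?divr_gt0// invf_div divfK ?gt_eqF//.
have : `|d 0 j| + `|e 0 j| <= \sum_(j < 2) (`|d 0 j| + `|e 0 j|).
  by rewrite (bigD1 j)//= lerDl sumr_ge0// => i _; exact: addr_ge0.
by rewrite /A; lra.
Qed.

Lemma form_interior x (eta : R) : 0 < eta ->
  (forall y, `|rform m (y - x)| < eta -> `|rform L (y - x)| < eta -> K y) -> K° x.
Proof.
move=> eta0 h; have [r r0 hr] := form_small x eta0.
by apply/nbhs_rVP; exists r; split=> // y /hr[h1 h2]; exact: h.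
Qed.

End HalfDisc.

Lemma open_segment_rform (R : realType) n (L p q x : 'rV[R]_n) :
  open_segment p q x -> rform L (q - p) = 0 -> rform L x = rform L p.
Proof.
move=> [t _ /= <-] h; rewrite rformB in h; rewrite rformD !rformZ.
have -> : rform L q = rform L p by apply/eqP; rewrite -subr_eq0 h.
by ring.
Qed.

Section StripNeighbourhood.
Context {R : realType}.
Variables (K : set 'rV[R]_2) (L m d e : 'rV[R]_2).
Hypothesis cK : convex_set K.
Hypothesis dec : forall v, v = rform m v *: d + rform L v *: e.

(** A point of K beyond the line would, through half discs on both sides, make [x0] an interior
    point. *)
Lemma supporting_line p q x0 e' : K p -> K q -> K e' -> open_segment p q x0 ->
  ~ K° x0 -> rform L (q - p) = 0 -> q != p -> rform L (e' - p) != 0 ->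
  forall x, K x -> 0 <= rform L (x - p) * rform L (e' - p).
Proof.
move=> Kp Kq Ke hx0 nint Lqp qp Le x Kx; rewrite leNgt; apply/negP => hlt.
have Lx : rform L (x - p) != 0 by apply: contraTneq hlt => ->; rewrite mul0r ltxx.
have [eta1 eta10 h1] := half_disc cK dec Kp Kq Ke hx0 Lqp qp Le.
have [eta2 eta20 h2] := half_disc cK dec Kp Kq Kx hx0 Lqp qp Lx.
apply: nint; apply: (@form_interior _ K L m x0 (Num.min eta1 eta2)).
  by rewrite lt_min eta10.
move=> y; rewrite !lt_min => /andP[y1 y2] /andP[y3 y4].
have [s1|s1] := leP 0 (rform L (y - x0) * rform L (e' - p)); first exact: h1.
apply: h2 => //; rewrite -(pmulr_lge0 _ (_ : 0 < rform L (e' - p) ^+ 2)); last first.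
  by rewrite exprn_even_gt0.
have -> : rform L (y - x0) * rform L (x - p) * rform L (e' - p) ^+ 2 =
  (rform L (y - x0) * rform L (e' - p)) * (rform L (x - p) * rform L (e' - p)) by ring.
by rewrite mulr_le0// ltW.
Qed.

(** At a point of one segment an endpoint of the other serves as apex in [half_disc]; the apex side
    of the line is the side selected by the strip condition. *)
Lemma strip_nbhd (c : R) p1 q1 p2 q2 x0 : K p1 -> K q1 -> K p2 -> K q2 ->
  q1 != p1 -> q2 != p2 -> rform L (q1 - p1) = 0 -> rform L (q2 - p2) = 0 ->
  c + rform L p1 = -1 -> c + rform L p2 = 1 ->
  (K° `|` (open_segment p1 q1 `|` open_segment p2 q2)) x0 ->
  exists2 eta : R, 0 < eta & forall y, `|rform m (y - x0)| < eta ->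
    `|rform L (y - x0)| < eta -> `|c + rform L y| <= 1 -> K y.
Proof.
move=> Kp1 Kq1 Kp2 Kq2 n1 n2 l1 l2 c1 c2 [hi|hs].
  have [eta eta0 h] := interior_form dec hi; exists eta => // y y1 y2 _; exact: h.
have L12 : rform L (p2 - p1) = 2 by rewrite rformB; lra.
have L21 : rform L (p1 - p2) = -2 by rewrite rformB; lra.
case: hs => hs.
  have [|eta eta0 h] := half_disc cK dec Kp1 Kq1 Kp2 hs l1 n1.
    by rewrite L12 pnatr_eq0.
  exists eta => // y y1 y2; rewrite ler_norml => /andP[y3 _]; apply: h => //.
  by rewrite L12 mulr_ge0// rformB (open_segment_rform hs l1); lra.
have [|eta eta0 h] := half_disc cK dec Kp2 Kq2 Kp1 hs l2 n2.
  by rewrite L21 oppr_eq0 pnatr_eq0.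
exists eta => // y y1 y2; rewrite ler_norml => /andP[_ y3]; apply: h => //.
by rewrite L21 mulr_le0// ?oppr_le0// rformB (open_segment_rform hs l2); lra.
Qed.

End StripNeighbourhood.

(** * Ellipses, their real points and maximality *)

Section Ellipse.
Context {R : realType} {n : nat}.
Implicit Types (a x : 'rV[R]_n) (b B : Cvec R n).

Lemma conjvZ (k : R[i]) B : conjv (k *: B) = conjc k *: conjv B.
Proof. by apply/rowP => j; rewrite !mxE rmorphM. Qed.

Lemma conjvK B : conjv (conjv B) = B.
Proof. by apply/rowP => j; rewrite !mxE conjcK. Qed.

Lemma conjvD B B' : conjv (B + B') = conjv B + conjv B'.
Proof. by apply/rowP => j; rewrite !mxE rmorphD. Qed.

Lemma conjv_cplx x : conjv (cplx x) = cplx x.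
Proof. by apply/rowP => j; rewrite !mxE /= oppr0. Qed.

Lemma cplx_inj : injective (@cplx R n).
Proof.
by move=> x y /rowP h; apply/rowP => j; have := h j; rewrite !mxE => -[].
Qed.

Lemma cplxD x y : cplx (x + y) = cplx x + cplx y.
Proof. by apply/rowP => j; rewrite !mxE rmorphD. Qed.

Lemma cplxZ (k : R) x : cplx (k *: x) = k%:C *: cplx x.
Proof. by apply/rowP => j; rewrite !mxE rmorphM. Qed.

Lemma conjv_real B : conjv B = B -> exists x, B = cplx x.
Proof.
move=> h; exists (\row_j complex.Re (B 0 j : R[i])); apply/rowP => j; rewrite !mxE.
have : conjv B 0 j = B 0 j by rewrite h.
rewrite !mxE; case: (B 0 j) => x y /= [hy]; apply: complex_ext => //=; lra.
Qed.

Local Notation ell a B := (crv (cplx a) B (conjv B)).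

Lemma ellE a b (r : R) z :
  cplx a + r%:C *: (z *: b + z^-1 *: conjv b) = ell a (r%:C *: b) z.
Proof.
by rewrite /crv conjvZ conjc_real scalerDr !scalerA ![_ * r%:C]mulrC addrA.
Qed.

Lemma cform_ell (c : R) L a B z : c%:C + cform L (ell a B z) =
  (c + rform L a)%:C + z * cform L B + z^-1 * conjc (cform L B).
Proof. by rewrite /crv !cformD !cformZ cform_cplx cform_conjv rmorphD !addrA. Qed.

Lemma rform_ell (c : R) L a B t x : ell a B (expi t) = cplx x ->
  c + rform L x = c + rform L a + 2 * complex.Re (cform L B * expi t).
Proof.
move=> h; apply: (@complexI R); rewrite [LHS]rmorphD /= -cform_cplx -h cform_ell.
rewrite -expiV expiN -addrA -rmorphM [expi t * _]mulrC addcJ.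
by rewrite [in RHS]rmorphD rmorphM rmorph_nat.
Qed.

(** The hypothesis is used where be e^(it) is real, equal to |be| or - |be| according to the sign of
    [al]. *)
Lemma norm_le_of_circle (al : R) (be : R[i]) :
  (forall t, `|al + 2 * complex.Re (be * expi t)| <= 1) -> `|al| + 2 * normc be <= 1.
Proof.
move=> h; have [t _ ht] := polar be.
have h1 := h (- t); have h2 := h (pi - t).
rewrite {1}ht -mulrA -expiD subrr expi0 mulr1 in h1.
rewrite {1}ht -mulrA -expiD [t + _]addrC subrK expi_pi mulrN1 in h2.
have [a0|a0] := leP 0 al.
  by apply: le_trans h1; rewrite (ger0_norm a0); exact: ler_norm.
apply: le_trans h2; rewrite (ltr0_norm a0) -normrN; apply: le_trans (ler_norm _).
by rewrite /= mulrN opprD opprK.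
Qed.

End Ellipse.

Notation ell a B := (crv (cplx a) B (conjv B)).

Section ExtremalEllipse.
Context {R : realType} {n : nat}.
Implicit Types (a x v : 'rV[R]_n) (b B : Cvec R n).

(** Subtracting the conjugate equation gives (w - conj w) (1 - 1 / |z|^2) = 0 for each coordinate w
    of z B. A real point off the unit circle thus makes the ellipse a segment. *)
Lemma real_point_off_circle a B x z : z != 0 -> normc z != 1 ->
  ell a B z = cplx x -> exists v, z *: B = cplx v.
Proof.
move=> z0 z1 h; apply: conjv_real; apply/rowP => j.
have zc0 : conjc z != 0 by rewrite conjc_eq0.
have e1 : (a 0 j)%:C + z * B 0 j + z^-1 * conjc (B 0 j : R[i]) = (x 0 j)%:C.
  by have := congr1 (fun w : Cvec R n => w 0 j) h; rewrite !mxE.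
have e2 : (a 0 j)%:C + conjc z * conjc (B 0 j : R[i]) + (conjc z)^-1 * (B 0 j : R[i]) =
    (x 0 j)%:C.
  by rewrite -[RHS]conjc_real -e1 !rmorphD !rmorphM fmorphV /= conjcK oppr0.
rewrite !mxE rmorphM; set w := z * B 0 j in e1 *.
have wE : conjc z * conjc (B 0 j : R[i]) = conjc w by rewrite rmorphM.
rewrite wE in e2 *.
have f1 : z^-1 * conjc (B 0 j : R[i]) = conjc w / (z * conjc z).
  by rewrite -wE; field; rewrite z0 zc0.
have f2 : (conjc z)^-1 * (B 0 j : R[i]) = w / (z * conjc z).
  by rewrite /w; field; rewrite z0 zc0.
rewrite f1 in e1; rewrite f2 in e2.
have k0 : 1 - (z * conjc z)^-1 != 0.
  rewrite mulcJ subr_eq0 eq_sym invr_eq1; apply: contraNneq z1 => /(congr1 (@complex.Re R)) /= h1.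
  by rewrite -sqrp_eq1 ?normc_ge0// h1.
apply/eqP; rewrite -subr_eq0 -(mulIr_eq0 _ (mulIf k0)); apply/eqP.
have e3 : (a 0 j)%:C + w + conjc w / (z * conjc z) =
  (a 0 j)%:C + conjc w + w / (z * conjc z) by rewrite e1 e2.
transitivity ((a 0 j)%:C + conjc w + w / (z * conjc z) -
  ((a 0 j)%:C + w + conjc w / (z * conjc z))); first by ring.
by rewrite e3 subrr.
Qed.

Lemma real_multiple v x (mu : R[i]) : v != 0 -> cplx x = mu *: cplx v ->
  exists D : R, x = D *: v.
Proof.
move=> v0 h; have [j vj] : exists j, v 0 j != 0.
  apply: contrapT => hn; move/eqP: v0; apply; apply/rowP => j; rewrite mxE.
  by apply/eqP/negPn/negP => vj; apply: hn; exists j.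
exists (x 0 j / v 0 j); apply: cplx_inj; rewrite cplxZ h; congr (_ *: _).
have := congr1 (fun w : Cvec R n => w 0 j) h; rewrite !mxE => hj.
have vj' : (v 0 j)%:C != 0 :> R[i].
  by rewrite -(rmorph0 (real_complex R)) (inj_eq (@complexI R)).
by rewrite rmorphM fmorphV [RHS]/= hj mulfK.
Qed.

Lemma ell_degenerate a v (w z : R[i]) :
  ell a (w *: cplx v) z = cplx a + (z * w + z^-1 * conjc w) *: cplx v.
Proof. by rewrite /crv conjvZ conjv_cplx !scalerA scalerDl addrA. Qed.

Lemma addc_expi (k t theta : R) :
  expi t * (k%:C * expi (- theta)) + (expi t)^-1 * conjc (k%:C * expi (- theta)) =
  (2 * k * cos (t - theta))%:C.
Proof.
set w := k%:C * _.
have -> : (expi t)^-1 * conjc w = conjc (expi t * w).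
  by rewrite -expiV expiN [RHS]rmorphM.
rewrite addcJ /w mulrCA -expiD -(rmorph_nat (real_complex R)) -rmorphM; congr (_%:C).
by rewrite cReM /= mul0r subr0 mulrA.
Qed.

Variables (K : set 'rV[R]_n) (a : 'rV[R]_n) (b : Cvec R n) (r c : R) (L : 'rV[R]_n).
Hypotheses (cK : convex_set K) (b0 : b != 0) (r0 : 0 < r).
Hypothesis strip : forall x, K x -> `|c + rform L x| <= 1.
Hypothesis inscribed : real_ellipse a b r `<=` cplx @` K.
Hypothesis maximal : forall a' r', 0 < r' -> real_ellipse a' b r' `<=` cplx @` K -> r' <= r.

Let B := r%:C *: b.

(** Maximality of [r] enters here. With x2 - x1 = D v, the segment [x1, x2] is itself a degenerate
    ellipse of the same type, centred at the midpoint, of radius r |D| / 4. Hence |D| <= 4, and D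
    L(v) = 2 gives |L(v)| >= 1 / 2. *)
Lemma degenerate_half theta v x1 x2 : B = expi (- theta) *: cplx v -> K x1 -> K x2 ->
  (exists mu : R[i], cplx (x2 - x1) = mu *: cplx v) ->
  rform L (x2 - x1) = 2 -> 2^-1 <= normc (cform L B).
Proof.
move=> hB K1 K2 [mu hmu] L21.
have rc0 : r%:C != 0 :> R[i] by rewrite -normc_gt0 normc_real normr_gt0 gt_eqF.
have v0 : v != 0.
  apply: contraNneq b0 => h; rewrite -(scale1r b) -(mulVf rc0) -scalerA -/B hB h.
  have -> : cplx (0 : 'rV[R]_n) = 0 by apply/rowP => j; rewrite !mxE.
  by rewrite !scaler0.
have [D hD] := real_multiple v0 hmu.
have LD : D * rform L v = 2 by rewrite -L21 hD rformZ.
have D0 : D != 0.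
  by apply/eqP => h; move: LD; rewrite h mul0r => /eqP; rewrite eq_sym pnatr_eq0.
have nD : 0 < `|D| by rewrite normr_gt0.
have nB : normc (cform L B) = `|rform L v|.
  by rewrite hB cformZ normcM normc_expi mul1r cform_cplx normc_real.
rewrite nB.
have nLv : `|D| * `|rform L v| = 2 by rewrite -normrM LD ger0_norm.
suff : `|D| <= 4.
  move=> D4; have := ler_wpM2r (normr_ge0 (rform L v)) D4; rewrite nLv; lra.
have : r * (`|D| / 4) <= r.
  apply: (@maximal (x1 + 2^-1 *: (x2 - x1))); first by rewrite mulr_gt0// divr_gt0.
  move=> _ [t _ <-].
  pose tau := 2^-1 + `|D| / (2 * D) * cos (t - theta).
  exists ((1 - tau) *: x1 + tau *: x2).
    apply: convex_combination => //.
    have : `| `|D| / (2 * D) * cos (t - theta)| <= 2^-1.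
      rewrite normrM normf_div normr_id normrM (ger0_norm (ler0n R 2)).
      have -> : `|D| / (2 * `|D|) = 2^-1 by field; rewrite gt_eqF.
      rewrite ler_piMr ?invr_ge0//.
      by rewrite ler_norml cos_geN1 cos_le1.
    by rewrite ler_norml /tau => /andP[h1 h2]; apply/andP; split; lra.
  rewrite expiV ellE.
  have -> : (1 - tau) *: x1 + tau *: x2 = x1 + 2^-1 *: (x2 - x1) +
      (`|D| / 2 * cos (t - theta)) *: v.
    have -> : (1 - tau) *: x1 + tau *: x2 = x1 + tau *: (x2 - x1).
      by rewrite scalerBl scale1r scalerBr addrAC addrA.
    rewrite /tau scalerDl addrA; congr (_ + _); rewrite hD scalerA; congr (_ *: _).
    by field.
  have -> : (r * (`|D| / 4))%:C *: b = ((`|D| / 4)%:C * expi (- theta)) *: cplx v.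
    by rewrite [r * _]mulrC rmorphM -[LHS]scalerA (hB : r%:C *: b = _) scalerA.
  rewrite ell_degenerate addc_expi cplxD cplxZ; congr (_ + _ *: _); congr (_%:C).
  by field.
by rewrite ger_pMr// ler_pdivrMr// mul1r.
Qed.

Lemma degenerate_off_circle x z : z != 0 -> normc z != 1 -> ell a B z = cplx x ->
  exists theta v, B = expi (- theta) *: cplx v.
Proof.
move=> z0 z1 /(real_point_off_circle z0 z1)[v hv].
have [t _ zt] := polar z; exists t, ((normc z)^-1 *: v).
have nz : (normc z)%:C != 0 :> R[i] by rewrite -normc_gt0 normc_real normr_gt0 normc_eq0.
rewrite cplxZ scalerA -hv scalerA {2}zt fmorphV expiV.
have -> : (expi t)^-1 * ((normc z)%:C)^-1 * ((normc z)%:C * expi t) = 1.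
  by field; rewrite nz expi_neq0.
by rewrite scale1r.
Qed.

(** The real ellipse lies in the strip, so |c + L a| + 2 |L B| <= 1 and it suffices that |L B| >= 1
    / 2. If both contact parameters have modulus 1, the values -1 and 1 there give this; otherwise
    the ellipse is degenerate. *)
Lemma extremal_ellipse_strip x1 x2 z1 z2 : K x1 -> K x2 -> z1 != 0 -> z2 != 0 ->
  ell a B z1 = cplx x1 -> ell a B z2 = cplx x2 ->
  c + rform L x1 = -1 -> c + rform L x2 = 1 ->
  c + rform L a = 0 /\ normc (cform L B) = 2^-1.
Proof.
move=> K1 K2 z10 z20 h1 h2 c1 c2.
have inner t : `|c + rform L a + 2 * complex.Re (cform L B * expi t)| <= 1.
  have [y Ky hy] : (cplx @` K) (ell a B (expi t)).
    by apply: inscribed; exists t => //; rewrite expiV ellE.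
  by rewrite -(@rform_ell _ _ c L a B t y)//; exact: strip.
have hn := norm_le_of_circle inner.
suff half : 2^-1 <= normc (cform L B).
  have a0 := normr_ge0 (c + rform L a).
  by split; [apply/eqP; rewrite -normr_le0|]; lra.
have L21 : rform L (x2 - x1) = 2 by rewrite rformB; lra.
have deg theta v : B = expi (- theta) *: cplx v -> 2^-1 <= normc (cform L B).
  move=> hB; apply: (degenerate_half hB K1 K2) => //.
  pose mu z := z * expi (- theta) + z^-1 * conjc (expi (- theta)).
  exists (mu z2 - mu z1).
  have -> : cplx (x2 - x1) = cplx x2 - cplx x1.
    by rewrite -[x1 in LHS]scale1r -scaleNr cplxD cplxZ rmorphN rmorph1 scaleN1r.
  rewrite -h1 -h2 hB !ell_degenerate /mu scalerBl.
  by rewrite opprD addrACA subrr add0r.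
have [n1|n1] := eqVneq (normc z1) 1; last first.
  by have [th [v hv]] := degenerate_off_circle z10 n1 h1; exact: deg hv.
have [n2|n2] := eqVneq (normc z2) 1; last first.
  by have [th [v hv]] := degenerate_off_circle z20 n2 h2; exact: deg hv.
have [t1 e1] := unit_polar n1; have [t2 e2] := unit_polar n2.
rewrite e1 in h1; rewrite e2 in h2.
have := rform_ell c L h1; have := rform_ell c L h2; rewrite c1 c2.
have := Re_le_normc (cform L B * expi t1); have := Re_le_normc (cform L B * expi t2).
rewrite !normcM !normc_expi mulr1 !ler_norml.
by move=> /andP[? ?] /andP[? ?] ? ?; lra.
Qed.

End ExtremalEllipse.

(** * Sheared ellipses *)

Lemma linear_bound (R : realDomainType) (p q s N M b : R) : p <= N * q ->
  N * q <= N * (s + 2 * (s * M * b)) -> 0 <= s ->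
  2 * p <= s * (2 * (N * (1 + 2 * (M * b))) + 1).
Proof.
have -> : N * (s + 2 * (s * M * b)) = s * (N * (1 + 2 * (M * b))) by ring.
by move: (N * (1 + _)) => y h3 h4 s0; lra.
Qed.

Section InscribedFamily.
Context {R : realType}.
Variables (K : set 'rV[R]_2) (c : R) (L m d e a : 'rV[R]_2) (B : Cvec R 2).
Hypothesis decC : forall v : Cvec R 2, v = cform m v *: cplx d + cform L v *: cplx e.
Hypotheses (Ld : rform L d = 0) (md : rform m d = 1).
Hypothesis strip : forall x, K x -> `|c + rform L x| <= 1.
Hypothesis center : c + rform L a = 0.
Hypothesis LB : cform L B = 2^-1.
Hypothesis inscribed : forall t, (cplx @` K) (ell a B (expi t)).
Hypothesis strip_nbhd_ell : forall t x, ell a B (expi t) = cplx x ->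
  exists2 eta : R, 0 < eta & forall y, `|rform m (y - x)| < eta ->
    `|rform L (y - x)| < eta -> `|c + rform L y| <= 1 -> K y.

(** A shift along d leaves L unchanged and so respects the strip; the local room at each point of
    the ellipse is made uniform by compactness. *)
Lemma ell_covering : exists2 eps : R, 0 < eps & forall t s x,
  ell a B (expi t) = cplx x -> `|s| < eps -> K (x + s *: d).
Proof.
have inK t x : ell a B (expi t) = cplx x -> K x.
  by move=> h; have [y Ky] := inscribed t; rewrite h => /cplx_inj <-.
have [|eps eps0 h] := @uniform_radius R (- pi) pi (fun eps t => forall s x,
    ell a B (expi t) = cplx x -> `|s| < eps -> K (x + s *: d)).
  move=> t _; have [x Kx /esym hx] := inscribed t.
  have [eta eta0 hS] := strip_nbhd_ell hx.
  pose N := normc (cform m B) + normc (cform L B) + 1.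
  have N0 : 0 < N by rewrite ltr_wpDl// addr_ge0// normc_ge0.
  (* This tolerance moves each coordinate of the ellipse point by less than eta / 2 and leaves eta /
     2 for the shift. *)
  have p0 : 0 < eta / (4 * N) by rewrite divr_gt0// mulr_gt0.
  have [dl dl0 hdl] := expi_continuity t p0.
  exists (eta / 2), dl; split; [exact: divr_gt0|exact: dl0|].
  move=> e' t' /andP[e'0 e'1] /hdl ht s y hy hs.
  have diff (l : 'rV[R]_2) : normc (cform l B) <= N -> `|rform l (y - x)| < eta / 2.
    move=> hl; have -> : rform l (y - x) =
        2 * complex.Re (cform l B * (expi t' - expi t)).
      rewrite rformB; have := rform_ell 0 l hx; have := rform_ell 0 l hy.
      by rewrite !add0r mulrBr cReB => -> ->; ring.
    rewrite normrM (ger0_norm (ler0n R 2)).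
    apply: (@le_lt_trans _ _ (2 * (N * normc (expi t' - expi t)))).
      rewrite ler_wpM2l//; apply: le_trans (Re_le_normc _) _.
      by rewrite normcM ler_wpM2r ?normc_ge0.
    apply: (@lt_le_trans _ _ (2 * (N * (eta / (4 * N))))).
      by rewrite ltr_pM2l// ltr_pM2l.
    by rewrite le_eqVlt; apply/orP; left; apply/eqP; field; rewrite gt_eqF.
  have hm : `|rform m (y - x)| < eta / 2.
    by apply: diff; rewrite /N -addrA lerDl addr_ge0 ?normc_ge0.
  have hL : `|rform L (y - x)| < eta / 2.
    by apply: diff; rewrite /N -addrA addrCA lerDl addr_ge0 ?normc_ge0.
  have E (l : 'rV[R]_2) : rform l (y + s *: d - x) = rform l (y - x) + s * rform l d.
    by rewrite !rformB rformD rformZ; ring.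
  apply: hS.
  - rewrite E md mulr1; apply: le_lt_trans (ler_normD _ _) _.
    by rewrite [ltRHS]splitr ltrD// (lt_trans hs).
  - by rewrite E Ld mulr0 addr0 (lt_trans hL)// ltr_pdivrMr// ltr_pMr// ltr1n.
  - by rewrite rformD rformZ Ld mulr0 addr0 strip//; exact: inK hy.
exists eps; first exact: eps0.
move=> t s x; have [t' t'pi] := polar (expi t).
by rewrite normc_expi mul1r => -> ; exact: h.
Qed.

(** Since [w] and [ell a B z] are on the same level of L, they differ by mu d. A shear [dl] with z
    dl + conj dl / z = mu puts [w] on the new curve at the same parameter; its real points move by 2
    Re (e^(it) dl) d, less than eps, and remain in K. *)
Lemma siciak_le_ell (eps : R) :
  (forall t s x, ell a B (expi t) = cplx x -> `|s| < eps -> K (x + s *: d)) ->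
  forall w z, 1 < normc z -> c%:C + cform L w = (z + z^-1) / 2 ->
  2 * normc (cform m (w - ell a B z)) < eps * (normc z - (normc z)^-1) ->
  (siciak (cplx @` K) w <= (ln (normc z))%:E)%E.
Proof.
move=> cov w z z1 hw hmu; set mu := cform m _ in hmu.
set rho := normc z in z1 hmu *.
have rho0 : 0 < rho by rewrite (lt_trans ltr01).
have z0 : z != 0 by rewrite -normc_gt0.
have zc0 : conjc z != 0 by rewrite conjc_eq0.
have hwz : w = ell a B z + mu *: cplx d.
  rewrite -[LHS](subrKC (ell a B z)); congr (_ + _).
  rewrite [LHS]decC -/mu.
  suff -> : cform L (w - ell a B z) = 0 by rewrite scale0r addr0.
  have := cform_ell c L a B z; rewrite center LB rmorph0 add0r => h.
  have -> : cform L (w - ell a B z) =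
      (c%:C + cform L w) - (c%:C + cform L (ell a B z)).
    by rewrite cformD -scaleN1r cformZ; ring.
  rewrite hw h; have -> : conjc (2^-1) = 2^-1 :> R[i].
    by rewrite fmorphV rmorph_nat.
  by field.
have i1 : rho^-1 < 1 by rewrite invf_lt1.
pose k := rho ^+ 2 - rho ^- 2.
have kE : k = (rho - rho^-1) * (rho + rho^-1) by rewrite /k -subr_sqr exprVn.
have q0 : 0 < rho - rho^-1 by rewrite subr_gt0 (lt_trans i1).
have q1 : 0 < rho + rho^-1 by rewrite addr_gt0// invr_gt0.
have k0 : 0 < k by rewrite kE mulr_gt0.
have kc0 : k%:C != 0 :> R[i] by rewrite -normc_gt0 normc_real normr_gt0 gt_eqF.
(* Cramer's rule for that equation and its conjugate, in the unknowns dl and conj dl; the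
   determinant is |z|^2 - |z|^-2 = k. *)
pose dl := (mu * conjc z - conjc mu / z) / k%:C.
have dlE : z * dl + z^-1 * conjc dl = mu.
  have -> : conjc dl = (conjc mu * z - mu / conjc z) / k%:C.
    have cM (x y : R[i]) : conjc (x * y) = conjc x * conjc y by exact: rmorphM.
    have cB (x y : R[i]) : conjc (x - y) = conjc x - conjc y by exact: rmorphB.
    have cV (x : R[i]) : conjc x^-1 = (conjc x)^-1 by exact: fmorphV.
    by rewrite /dl cM cB !cM !cV !conjcK conjc_real.
  have kz : k%:C = z * conjc z - (z * conjc z)^-1.
    by rewrite mulcJ -fmorphV -rmorphB.
  apply: (mulIf kc0); rewrite mulrDl /dl [in RHS]kz.
  rewrite mulrA divfK// -[z^-1 * _ * _]mulrA divfK//.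
  by field; rewrite z0 zc0.
have dln : 2 * normc dl < eps.
  have h1 : normc dl <= normc mu / (rho - rho^-1).
    rewrite /dl normcM normcV normc_real gtr0_norm// kE invfM [(rho - _)^-1 * _]mulrC mulrA.
    rewrite ler_wpM2r ?invr_ge0 ?(ltW q0)// ler_pdivrMr//.
    apply: le_trans (le_normcB2 _ _) _; rewrite !normcM normcV !normc_conj -/rho.
    by rewrite -mulrDr.
  apply: (@le_lt_trans _ _ (2 * (normc mu / (rho - rho^-1)))).
    by rewrite ler_wpM2l.
  by rewrite mulrA ltr_pdivrMr.
pose B' := B + dl *: cplx d.
have ellB' x : ell a B' x = ell a B x + (x * dl + x^-1 * conjc dl) *: cplx d.
  rewrite /crv /B' conjvD conjvZ conjv_cplx !scalerDr !scalerA scalerDl.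
  by rewrite [cplx a + (_ + _)]addrA addrACA.
apply: ge_ereal_sup => _ [u [uL uK] <-].
have -> : w = ell a B' z by rewrite ellB' dlE.
apply: lelong_le_on_curve => //; last exact: ltW.
move=> t; apply: uK; have [x Kx /esym hx] := inscribed t.
pose s := 2 * complex.Re (expi t * dl).
have es : expi t * dl + (expi t)^-1 * conjc dl = s%:C.
  have -> : (expi t)^-1 * conjc dl = conjc (expi t * dl).
    by rewrite -expiV expiN [RHS]rmorphM.
  by rewrite addcJ /s rmorphM rmorph_nat.
exists (x + s *: d); last by rewrite ellB' es hx cplxD cplxZ.
apply: (cov t) => //; apply: le_lt_trans dln.
rewrite /s normrM (ger0_norm (ler0n R 2)) ler_wpM2l//.
by apply: le_trans (Re_le_normc _) _; rewrite normcM normc_expi mul1r.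
Qed.

(** A nearby point w is compared with the point of the curve at the parameter x = jouk (c + L w),
    which lies on the same level of L. The two are close, so a small shear suffices as long as |x|
    stays away from 1. *)
Lemma siciak_near_ell z0 : 1 < normc z0 ->
  \forall w \near ell a B z0, 1 < normc (jouk (c%:C + cform L w)) /\
    siciak (cplx @` K) w = (ln (normc (jouk (c%:C + cform L w))))%:E.
Proof.
move=> z1; have [eps eps0 cov] := ell_covering.
set z := ell a B z0.
have hz : c%:C + cform L z = (z0 + z0^-1) / 2.
  rewrite /z cform_ell center LB rmorph0 add0r.
  have -> : conjc (2^-1) = 2^-1 :> R[i] by rewrite fmorphV rmorph_nat.
  by field; rewrite -normc_gt0 (lt_trans ltr01).
have jz : jouk (c%:C + cform L z) = z0 by rewrite hz jouk_joukowski.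
have [|dj [Cj [dj0 Cj0 hj]]] := @jouk_local _ (c%:C + cform L z); first by rewrite jz.
(* From r1 < |x| follows the uniform bound r1 - 1 / r1 <= |x| - 1 / |x| for the smallness condition
   on the shear. *)
pose r1 := (1 + normc z0) / 2.
have r11 : 1 < r1 by rewrite /r1; lra.
have r12 : r1 < normc z0 by rewrite /r1; lra.
have kp : 0 < r1 - r1^-1.
  by rewrite subr_gt0 (lt_trans _ r11)// invf_lt1// (lt_trans ltr01).
pose NL := l1norm (cplx L) : R; pose Nm := l1norm (cplx m) : R; pose NB := l1norm B + l1norm (conjv B).
have NL0 : 0 <= NL by exact: l1norm_ge0.
have Nm0 : 0 <= Nm by exact: l1norm_ge0.
have NB0 : 0 <= NB by rewrite addr_ge0// l1norm_ge0.
pose M1 := NL + 1; have M10 : 0 < M1 by rewrite ltr_wpDl.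
pose M2 := Cj * M1; have M20 : 0 < M2 by rewrite mulr_gt0.
pose M3 := 2 * (Nm * (1 + 2 * (M2 * NB))) + 1.
have M30 : 0 < M3.
  by rewrite ltr_wpDl// mulr_ge0// mulr_ge0// addr_ge0// mulr_ge0// mulr_ge0// ltW.
(* The bounds keep c + L w where [jouk] is Lipschitz, keep |x| above [r1], and make the displacement
   along d admissible in [siciak_le_ell]. *)
pose r := Num.min (dj / M1) (Num.min ((normc z0 - r1) / M2) (eps * (r1 - r1^-1) / M3)).
have rp1 : 0 < dj / M1 by rewrite divr_gt0.
have rp2 : 0 < (normc z0 - r1) / M2 by rewrite divr_gt0// subr_gt0.
have rp3 : 0 < eps * (r1 - r1^-1) / M3 by rewrite divr_gt0// mulr_gt0.
have r0 : 0 < r by rewrite /r !lt_min rp1 rp2.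
apply/nbhs_CvecP; exists (r / 2); split; first exact: divr_gt0.
move=> w hw.
have hn : l1norm (w - z) < r.
  rewrite /l1norm !big_ord_recl big_ord0 addr0 [ltRHS]splitr.
  have hw' j : normc ((w - z) 0 j : R[i]) < r / 2.
    by rewrite mxE [(- _ : 'rV__) 0 j]mxE; exact: hw.
  by apply: ltrD; exact: hw'.
have hn0 : 0 <= l1norm (w - z) by exact: l1norm_ge0.
have g1 : l1norm (w - z) * M1 < dj.
  by rewrite -ltr_pdivlMr//; apply: lt_le_trans hn _; rewrite /r ge_min lexx.
have g2 : l1norm (w - z) * M2 < normc z0 - r1.
  by rewrite -ltr_pdivlMr//; apply: lt_le_trans hn _; rewrite /r !ge_min lexx orbT.
have g3 : l1norm (w - z) * M3 < eps * (r1 - r1^-1).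
  by rewrite -ltr_pdivlMr//; apply: lt_le_trans hn _; rewrite /r !ge_min lexx !orbT.
have hl : normc (c%:C + cform L w - (c%:C + cform L z)) <= l1norm (w - z) * M1.
  have -> : c%:C + cform L w - (c%:C + cform L z) = cform L (w - z).
    by rewrite cformD -(scaleN1r z) cformZ mulN1r opprD addrACA subrr add0r.
  apply: le_trans (normc_cform _ _) _; rewrite mulrC ler_wpM2l//.
  by rewrite /M1 lerDl.
have [h1 _ _ _ _] := hj _ (le_lt_trans hl g1).
set x := jouk (c%:C + cform L w) in h1 *; rewrite jz in h1.
have hx : normc (x - z0) <= l1norm (w - z) * M2.
  by apply: le_trans h1 _; rewrite /M2 mulrCA ler_wpM2l// ltW.
have x1 : r1 < normc x.
  by have := le_normcB z0 x; rewrite normcB_sym; move: hx g2; lra.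
have xg1 : 1 < normc x by apply: lt_trans x1.
have [x0 _ hxw] := joukP (c%:C + cform L w); rewrite -/x in x0 hxw.
split; first exact: xg1.
apply/eqP; rewrite eq_le; apply/andP; split; last first.
  exact: (siciak_ge_joukowski strip hxw xg1).
apply: (siciak_le_ell cov xg1 hxw).
have hk : r1 - r1^-1 <= normc x - (normc x)^-1.
  apply: lerB; first exact: ltW.
  by rewrite lef_pV2 ?posrE ?(lt_trans ltr01)// ltW.
apply: lt_le_trans (_ : eps * (r1 - r1^-1) <= _); last by rewrite ler_wpM2l// ltW.
apply: le_lt_trans g3.
have hd : l1norm (w - ell a B x) <= l1norm (w - z) + 2 * (l1norm (w - z) * M2 * NB).
  have -> : w - ell a B x = (w - z) + (z - ell a B x) by rewrite addrA subrK.
  apply: le_trans (l1normD _ _) _; rewrite lerD2l.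
  have hc j : normc ((z - ell a B x) 0 j : R[i]) <= l1norm (w - z) * M2 * NB.
    rewrite mxE [(- _ : 'rV__) 0 j]mxE.
    apply: le_trans (crv_lipschitz _ _ _ _ (ltW z1) (ltW xg1)) _.
    by rewrite ler_wpM2r// normcB_sym.
  apply: (@le_trans _ _ (\sum_(j < 2) (l1norm (w - z) * M2 * NB))).
    by apply: ler_sum => j _; exact: hc.
  by rewrite sumr_const card_ord mulr_natl.
have h3 := normc_cform m (w - ell a B x); rewrite -/Nm in h3.
have h4 := ler_wpM2l Nm0 hd.
exact: (linear_bound h3 h4 hn0).
Qed.

End InscribedFamily.

(** * Normal form of the curve and conclusion *)

Lemma pluriharmonic_near_jouk (R : realType) n (V : Cvec R n -> \bar R) (c : R)
    (L : 'rV[R]_n) (z : Cvec R n) :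
  (\forall w \near z, 1 < normc (jouk (c%:C + cform L w)) /\
    V w = (ln (normc (jouk (c%:C + cform L w))))%:E) ->
  pluriharmonic_near V z.
Proof.
pose A (w : Cvec R n) := 1 < normc (jouk (c%:C + cform L w)) /\
  V w = (ln (normc (jouk (c%:C + cform L w))))%:E.
move=> hA; exists A°.
have sub w : A° w -> A w by exact: interior_subset.
split; [exact: open_interior|exact: hA| |].
  by move=> w /sub[_ ->].
apply: (@pluriharmonic_jouk _ _ A° (fun w => fine (V w)) c L).
- exact: open_interior.
- by move=> w /sub[].
- by move=> w /sub[_ ->].
Qed.

Section Reparametrization.
Context {R : realType} {n : nat}.
Implicit Types (a : 'rV[R]_n) (B : Cvec R n).

Lemma ell_rotate a B (phi : R) z :
  ell a (expi (- phi) *: B) (expi phi * z) = ell a B z.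
Proof.
have e1 : expi phi * z * expi (- phi) = z.
  by rewrite mulrAC -expiD subrr expi0 mul1r.
have e2 : (expi phi * z)^-1 * conjc (expi (- phi)) = z^-1.
  by rewrite -expiN opprK invfM mulrAC mulVf ?mul1r// expi_neq0.
by rewrite /crv conjvZ !scalerA e1 e2.
Qed.

Lemma ell_conj a B z : ell a (conjv B) z^-1 = ell a B z.
Proof. by rewrite /crv conjvK invrK addrAC. Qed.

(** Two reparametrizations preserve the real ellipse: a rotation of z, which makes L B equal to 1 /
    2, and z -> 1 / z with B conjugated, which moves z outside the unit circle. *)
Lemma ell_normal_form a B (L : 'rV[R]_n) z : normc (cform L B) = 2^-1 ->
  z != 0 -> normc z != 1 -> exists B1 z1,
  [/\ cform L B1 = 2^-1, 1 < normc z1, ell a B z = ell a B1 z1 &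
      forall t, exists s, ell a B1 (expi t) = ell a B (expi s)].
Proof.
move=> hB z0 z1; have [phi _ hphi] := polar (cform L B).
have c2 : (2^-1 : R)%:C = 2^-1 :> R[i] by rewrite fmorphV rmorph_nat.
have LB1 : cform L (expi (- phi) *: B) = 2^-1.
  by rewrite cformZ hphi hB mulrCA -expiD addNr expi0 mulr1.
have rot t : ell a (expi (- phi) *: B) (expi t) = ell a B (expi (t - phi)).
  by rewrite -(ell_rotate a B phi (expi (t - phi))) -expiD addrC subrK.
have [lt1|gt1|eq1] := ltgtP (normc z) 1; last by rewrite eq1 eqxx in z1.
  exists (conjv (expi (- phi) *: B)), (expi phi * z)^-1; split.
  - by rewrite cform_conjv LB1 fmorphV rmorph_nat.
  - by rewrite normcV normcM normc_expi mul1r invf_gt1// normc_gt0.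
  - by rewrite ell_conj ell_rotate.
  - move=> t; exists (- t - phi).
    have := ell_conj a (expi (- phi) *: B) (expi (- t)).
    by rewrite -expiV opprK rot.
exists (expi (- phi) *: B), (expi phi * z); split=> //.
- by rewrite normcM normc_expi mul1r.
- by rewrite ell_rotate.
- by move=> t; exists (t - phi).
Qed.

End Reparametrization.

Theorem theorem3p2 (R : realType) (K : set 'rV[R]_2) (p1 q1 p2 q2 : 'rV[R]_2)
    (C : set (Cvec R 2))
    (hK : convex_body K)
    (hpar : parallel_segments p1 q1 p2 q2)
    (hs1 : segment p1 q1 `<=` K)
    (hs2 : segment p2 q2 `<=` K)
    (hC : extremal_curve K C)
    (hmeet1 : C `&` cplx @` (boundary K `&` open_segment p1 q1) !=set0)
    (hmeet2 : C `&` cplx @` (boundary K `&` open_segment p2 q2) !=set0)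
    (honly : C `&` cplx @` boundary K `<=`
             cplx @` (open_segment p1 q1 `|` open_segment p2 q2))
    (z : Cvec R 2) (hz : (C `\` cplx @` K) z) :
  pluriharmonic_near (siciak (cplx @` K)) z.
Proof.
have [_ cK _] := hK.
have [pq1 pq2 [k hk] _] := hpar.
have [c [L [m [e /= [dec decC [Ld md] [cp1 cp2]]]]]] := strip_coordinates hpar.
have ends p q : segment p q `<=` K -> K p /\ K q.
  move=> h; split; apply: h; [exists 0|exists 1].
  - by rewrite /= lexx ler01.
  - by rewrite subr0 scale1r scale0r addr0.
  - by rewrite /= lexx ler01.
  - by rewrite subrr scale1r scale0r add0r.
have [Kp1 Kq1] := ends _ _ hs1; have [Kp2 Kq2] := ends _ _ hs2.
have sub_seg p q : segment p q `<=` K -> open_segment p q `<=` K.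
  by move=> h x [t /andP[t0 t1] <-]; apply: h; exists t => //=; rewrite !ltW.
have Ld2 : rform L (q2 - p2) = 0 by rewrite hk rformZ Ld mulr0.
have qp1 : q1 != p1 by rewrite eq_sym.
have qp2 : q2 != p2 by rewrite eq_sym.
have L12 : rform L (p2 - p1) = 2 by rewrite rformB; lra.
have L21 : rform L (p1 - p2) = -2 by rewrite rformB; lra.
have [w1 [Cw1 [x1 [[_ nint1] seg1] hx1]]] := hmeet1.
have Cx1 : C (cplx x1) by rewrite hx1.
have [w2 [Cw2 [x2 [[_ nint2] seg2] hx2]]] := hmeet2.
have Cx2 : C (cplx x2) by rewrite hx2.
(* Both contact points are boundary points of K inside the segments, so each of the two lines
   supports K. *)
have strip x : K x -> `|c + rform L x| <= 1.
  move=> Kx; have n12 : rform L (p2 - p1) != 0 by rewrite L12 pnatr_eq0.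
  have n21 : rform L (p1 - p2) != 0 by rewrite L21 oppr_eq0 pnatr_eq0.
  have := supporting_line cK dec Kp1 Kq1 Kp2 seg1 nint1 Ld qp1 n12 Kx.
  have := supporting_line cK dec Kp2 Kq2 Kp1 seg2 nint2 Ld2 qp2 n21 Kx.
  by rewrite L12 L21 !rformB => h1 h2; rewrite ler_norml; apply/andP; split; lra.
have [a [b [r [b0 r0 ins maximal CE]]]] := hC.
pose B := r%:C *: b.
have ellC z' : z' != 0 -> C (ell a B z').
  by move=> z'0; rewrite CE; exists z'; [exact: z'0|exact: ellE].
have ofC w : C w -> exists2 z', z' != 0 & w = ell a B z'.
  by rewrite CE => -[z' z'0 <-]; exists z'; [exact: z'0|exact: ellE].
have insB t : (cplx @` K) (ell a B (expi t)).
  by apply: ins; exists t; [by []|rewrite expiV; exact: ellE].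
have [z1 z10 hz1] := ofC _ Cx1; have [z2 z20 hz2] := ofC _ Cx2.
have [center nB] := @extremal_ellipse_strip _ _ K a b r c L cK b0 r0 strip ins maximal
  x1 x2 z1 z2 (sub_seg _ _ hs1 _ seg1) (sub_seg _ _ hs2 _ seg2) z10 z20
  (esym hz1) (esym hz2) (etrans (congr1 _ (open_segment_rform seg1 Ld)) cp1)
  (etrans (congr1 _ (open_segment_rform seg2 Ld2)) cp2).
have [Cz nKz] := hz; have [z0 z00 hz0] := ofC _ Cz.
(* Parameters of modulus 1 give points of the real ellipse, which lies in K. *)
have nz0 : normc z0 != 1.
  by apply/eqP => /unit_polar[t ht]; apply: nKz; rewrite hz0 ht.
have [B1 [zeta [LB1 zeta1 hB1 rot]]] := ell_normal_form a nB z00 nz0.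
apply: (@pluriharmonic_near_jouk _ _ _ c L); rewrite hz0 -/B hB1.
apply: (@siciak_near_ell _ K c L m (q1 - p1) e a B1) => //.
- by move=> t; have [s ->] := rot t.
- move=> t x hx; apply: (strip_nbhd cK dec Kp1 Kq1 Kp2 Kq2 qp1 qp2 Ld Ld2 cp1 cp2).
  have [s hs] := rot t; rewrite hx in hs.
  have Kx : K x by have [y Ky] := insB s; rewrite -hs => /cplx_inj <-.
  (* A point of the real ellipse that is not interior to K is a boundary point on C, and [honly]
     puts it in one of the open segments. *)
  have [xi|xni] := pselect (K° x); [by left|right].
  have [|y hy /cplx_inj <- //] := honly (cplx x).
  split; first by rewrite hs; apply: ellC; exact: expi_neq0.
  by exists x => //; split=> //; exact: subset_closure.
Qed.
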